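(* Let $A\in\mathbb{C}^{2^n\times2^n}$ be a 1-sparse, Hermitian, invertible and row-computable matrix whose entries $A_{xy}$ can each be exactly represented using $n'$ bits of precision, and let $f(x)$ denote the column index of the nonzero entry in row $x$. Then for any $\delta>0$, a $$\Bigl(\bigl(\min_x|A_{xf(x)}|\bigr)^{-1},\,1,\,\delta\Bigr)\text{-block-encoding of }A^{-1}$$ can be implemented using at most $4$ oracle queries and $\mathcal O(\mathrm{poly}(n'\log(1/\delta)))$ auxiliary operations taken from a gate set consisting of $\mathrm{H}$, $\mathrm{T}$, $\mathrm{CNOT}$.
   Context: 1-sparse: at most one nonzero entry in each row and each column. Row-computable: $f$ is efficiently computable. Oracles: $O_f:|x\rangle|c\rangle\mapsto|x\rangle|c\oplus f(x)\rangle$ and $O_A:|x\rangle|y\rangle|c\rangle\mapsto|x\rangle|y\rangle|c\oplus A_{xy}\rangle$, with matrix elements encoded in polar form (modulus and phase); queries to inverses count as queries. An $(m+n)$-qubit unitary $U$ is an $(\alpha,m,\epsilon)$-block-encoding of an $n$-qubit operator $M$ if $\|M-\alpha(\langle 0^m|\otimes I_n)U(|0^m\rangle\otimes I_n)\|\le\epsilon$; work qubits used for arithmetic and oracle outputs, which start in and are returned to the all-zero state, are not counted in $m$. *)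

(* Defs.v *)
(* MathComp / MathComp-Analysis; complex numbers are R[i] for R : realType. *)
From mathcomp Require Import all_boot all_order all_algebra.
From mathcomp Require Import complex.
From mathcomp Require Import boolp classical_sets reals trigo.

Set Implicit Arguments.
Unset Strict Implicit.
Unset Printing Implicit Defensive.

Import Order.TTheory GRing.Theory Num.Theory.
Local Open Scope ring_scope.
Local Open Scope sesquilinear_scope.

Definition word (n : nat) := {ffun 'I_n -> bool}.

(* A basis state of n qubits is an index in 'I_(2^n); qubit 0 carries the most
   significant bit, so that |u>|v> has index u * 2^k + v for v on k qubits. *)
Definition bits n (x : 'I_(2 ^ n)) : word n :=
  [ffun i : 'I_n => odd (x %/ 2 ^ (n - i.+1))].

Lemma idx_subproof n (w : word n) :
  (\sum_(i < n) w i * 2 ^ (n - i.+1) < 2 ^ n)%N.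
Proof.
elim: n w => [|n IHn] w; first by rewrite big_ord0.
rewrite big_ord_recl /= subn1 /= expnS mul2n -addnn -addnS leq_add //.
  by case: (w _); rewrite ?mul1n ?mul0n.
have := IHn [ffun i => w (lift ord0 i)]; congr (_ < _)%N.
by apply: eq_bigr => i _; rewrite ffunE /bump /= add1n subSS.
Qed.

Definition idx n (w : word n) : 'I_(2 ^ n) := Ordinal (idx_subproof w).

Lemma bitsK n : cancel (@bits n) (@idx n).
Proof.
move=> x; apply: val_inj => /=.
have E k (m : nat) : (\sum_(i < k) odd (m %/ 2 ^ (k - i.+1))
    * 2 ^ (k - i.+1) = m %% 2 ^ k)%N.
  elim: k m => [|k IHk] m; first by rewrite big_ord0 expn0 modn1.
  rewrite big_ord_recr /= subnn expn0 divn1 muln1.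
  rewrite [RHS](divn_eq _ 2) modn_dvdm ?expnS ?dvdn_mulr // modn2 mulnC.
  congr addn; rewrite -expnS expnSr -modn_divl -IHk big_distrr /=.
  apply: eq_bigr => i _.
  by rewrite subSS -[(k - i)%N]prednK ?subn_gt0 // -subnS expnS divnMA mulnCA.
rewrite -[RHS](modn_small (ltn_ord x)) -E; apply: eq_bigr => i _.
by rewrite ffunE.
Qed.

Lemma idxK n : cancel (@idx n) (@bits n).
Proof.
apply: (bij_can_sym _ _).2 (@bitsK n); apply: inj_card_bij.
  exact: can_inj (@bitsK n).
by rewrite card_ffun card_bool !card_ord.
Qed.

Definition wcat m n (u : word m) (v : word n) : word (m + n) :=
  [ffun i => match split i with inl j => u j | inr j => v j end].
Definition wleft m n (w : word (m + n)) : word m := [ffun i => w (lshift n i)].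
Definition wright m n (w : word (m + n)) : word n := [ffun i => w (rshift m i)].
Definition wxor n (u v : word n) : word n := [ffun i => u i (+) v i].
Definition wzero n : word n := [ffun=> false].

Section Quantum.
Variable R : realType.
Local Notation C := R[i].

Definition polar (r theta : R) : C := Complex (r * cos theta) (r * sin theta).

Definition l2norm n (v : 'cV[C]_n) : R :=
  Num.sqrt (\sum_i Normc.normc (v i ord0) ^+ 2).

Definition opnorm m n (M : 'M[C]_(m, n)) : R :=
  sup [set l2norm (M *m v) | v in [set v | l2norm v <= 1]]%classic.

(* The operator |w> |-> |g w> on computational basis states. *)
Definition basis_mx k (g : word k -> word k) : 'M[C]_(2 ^ k) :=
  \matrix_(y, x) (bits y == g (bits x))%:R.

Definition hadamard : 'M[C]_(2 ^ 1) :=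
  \matrix_(y, x) (polar (Num.sqrt 2)^-1 0 * (-1) ^+ (y * x)%N).
Definition tgate : 'M[C]_(2 ^ 1) :=
  \matrix_(y, x) ((y == x)%:R * polar 1 (pi / 4 *+ x)).
Definition cnot : 'M[C]_(2 ^ 2) :=
  basis_mx (fun w => [ffun i => w i (+) ((i == ord_max) && w ord0)]).

Definition oracle_f n (f : 'I_(2 ^ n) -> 'I_(2 ^ n)) : 'M[C]_(2 ^ (n + n)) :=
  basis_mx (fun w => let x := wleft w in let c := wright w in
    wcat x (wxor c (bits (f (idx x))))).

(* Matrix entries are given to the oracle as a pair (modulus code, phase code)
   of two t-bit numbers. *)
Definition polar_code n t := 'I_(2 ^ n) -> 'I_(2 ^ n) -> 'I_(2 ^ t) * 'I_(2 ^ t).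

Definition oracle_A n t (enc : polar_code n t) :
    'M[C]_(2 ^ (n + n + (t + t))) :=
  basis_mx (fun w =>
    let x := wleft (wleft w) in let y := wright (wleft w) in
    let c := wright w in let e := enc (idx x) (idx y) in
    wcat (wcat x y) (wxor c (wcat (bits e.1) (bits e.2)))).

(* Fixed-point reading: the modulus has t binary digits, p of them after the
   binary point, and the phase is a t-digit binary fraction of a full turn.
   The phase code of a zero entry is unconstrained. *)
Definition represents n t (p : nat) (enc : polar_code n t)
    (A : 'M[C]_(2 ^ n)) : Prop :=
  forall x y, A x y = polar ((enc x y).1%:R / 2 ^+ p)
                            (2 * pi * ((enc x y).2%:R / 2 ^+ t)).

Definition one_sparse n (A : 'M[C]_n) : Prop :=
  (forall x y y', A x y != 0 -> A x y' != 0 -> y = y') /\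
  (forall y x x', A x y != 0 -> A x' y != 0 -> x = x').

Definition min_entry n (A : 'M[C]_(2 ^ n)) (f : 'I_(2 ^ n) -> 'I_(2 ^ n)) : R :=
  let m x := Normc.normc (A x (f x)) in
  \big[Num.min/m (idx (wzero n))]_x m x.

(* The k-qubit operator G acting on the wires a 0, ..., a (k-1) out of N. *)
Definition on_wires N k (a : 'I_k -> 'I_N) (G : 'M[C]_(2 ^ k)) :
    'M[C]_(2 ^ N) :=
  \matrix_(y, x)
    (G (idx [ffun i => bits y (a i)]) (idx [ffun i => bits x (a i)]) *
     [forall j, (j \notin codom a) ==> (bits y j == bits x j)]%:R).

(* The isometry placing k qubits on the wires a 0, ..., a (k-1) out of N, with
   |0> on every other wire. *)
Definition embed N k (a : 'I_k -> 'I_N) : 'M[C]_(2 ^ N, 2 ^ k) :=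
  \matrix_(y, x) ([forall i, bits y (a i) == bits x i] &&
                  [forall j, (j \notin codom a) ==> ~~ bits y j])%:R.

(* Both oracles are involutions, so an inverse query is an ordinary one. *)
Inductive gate (n t N : nat) :=
| GateH of 'I_N
| GateT of 'I_N
| GateCNOT (i j : 'I_N) of i != j
| QueryF (a : 'I_(n + n) -> 'I_N) of injective a
| QueryA (a : 'I_(n + n + (t + t)) -> 'I_N) of injective a.

Definition is_query n t N (g : gate n t N) : bool :=
  match g with QueryF _ _ | QueryA _ _ => true | _ => false end.

Definition gate_mx n t N (f : 'I_(2 ^ n) -> 'I_(2 ^ n)) (enc : polar_code n t)
    (g : gate n t N) : 'M[C]_(2 ^ N) :=
  match g with
  | GateH i => on_wires (fun=> i) hadamard
  | GateT i => on_wires (fun=> i) tgate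
  | GateCNOT i j _ => on_wires (fun k => if k == ord0 then i else j) cnot
  | QueryF a _ => on_wires a (oracle_f f)
  | QueryA a _ => on_wires a (oracle_A enc)
  end.

(* The head of the list is applied first. *)
Definition circuit n t N := seq (gate n t N).

Definition circuit_mx n t N (f : 'I_(2 ^ n) -> 'I_(2 ^ n))
    (enc : polar_code n t) (c : circuit n t N) : 'M[C]_(2 ^ N) :=
  foldr (fun g V => V *m gate_mx f enc g) 1%:M c.

Definition query_count n t N (c : circuit n t N) : nat :=
  count (@is_query n t N) c.
Definition aux_count n t N (c : circuit n t N) : nat :=
  count (predC (@is_query n t N)) c.

(* V realizes U with input read on the wires src and output found on the wires
   dst, all remaining wires being work qubits that start and end in |0>.
   Wires are only names: src and dst may differ, i.e. relabelling qubits is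
   not an operation. *)
Definition implements N k (V : 'M[C]_(2 ^ N)) (src dst : 'I_k -> 'I_N)
    (U : 'M[C]_(2 ^ k)) : Prop :=
  V *m embed src = embed dst *m U.

(* embed (rshift m) is |0^m> (x) I_n. *)
Definition block_encoding n (alpha : R) (m : nat) (eps : R)
    (U : 'M[C]_(2 ^ (m + n))) (M : 'M[C]_(2 ^ n)) : Prop :=
  U \is unitarymx /\
  let Z := embed (@rshift m n) in
  opnorm (M - (alpha%:C)%C *: (Z ^t* *m U *m Z)) <= eps.

End Quantum.

Arguments block_encoding {R n} alpha m eps U M.

(* Main.v *)
(* Since A is Hermitian and 1-sparse, f is an involution and
   A^-1 = sum_x A_{x f(x)}^-1 |f(x)><x|.  After the queries O_f and O_A the
   registers hold x, f(x) and the modulus and phase codes of A_{x f(x)}; the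
   extra qubit is rotated by a matrix whose (0,0) entry is close to
   mu / A_{x f(x)}; a second O_A erases the codes, and O_f read from f(x) to x
   erases x, because f(f(x)) = x.

   Every rotation is a product of rotations by fixed angles, each controlled by
   one bit: the bits of the phase code, and, for the modulus, the bits of
   arccos (mu / |A_{x f(x)}|) in the greedy expansion by the angles
   2 arctan 2^-j.  The latter are computed by comparing integer vectors
   (CORDIC), so only additions, shifts and comparisons occur.  If X is the
   negation and V a word approximating the rotation by half the angle, the
   circuit V X^b V^-1 X^b is exactly the identity for b = 0, and approximates
   the rotation for b = 1.

   The words V come from the Solovay-Kitaev theorem, proved in the quaternions:
   |pqp^-1q^-1 - 1| = |pq - qp| is twice the length of the cross product of the
   vector parts, so a 4^-m-net yields an 8^-m-net, up to a constant, by words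
   five times as long.  The initial net is reached greedily from Clifford
   conjugates of one element close to 1; the latter exists because the
   denominators of the powers of an element of real part 3/4 are unbounded. *)
Require Import Defs.
From HB Require Import structures.
From mathcomp Require Import all_boot all_order all_algebra.
From mathcomp Require Import complex.
From mathcomp Require Import boolp classical_sets reals sequences trigo exp.
From mathcomp Require Import ring lra zify.
Set Implicit Arguments.
Unset Strict Implicit.
Unset Printing Implicit Defensive.
Import Order.TTheory GRing.Theory Num.Theory.

(** * Programs computing the bits of the rotation angle *)

(** The circuit must not depend on [A]: it is built from [n], [n'], [p], [mu] and [delta] alone.
    This works because [mu] is itself a modulus code over [2 ^+ p], hence given by an integer [k]
    that can be compiled in, and because [A] and [f] enter only through queries. Outside the queries
    only the [2 n'] code bits, the scratch bits and one qubit are touched, so the auxiliary count is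
    independent of [n]. The obstacle is to obtain an arccosine by integer arithmetic. The angles
    [2 arctan 2^-j] are used rather than [arctan 2^-j] because their sines and cosines are rational
    with denominator [4^j + 1]: rotated vectors stay integral after a scaling known in advance, and
    the threshold is scaled along. Unitarity is never approximate: every rotation word acts exactly
    as a unit quaternion, so only the entry seen by the block encoding carries an error. That error
    is multiplied by [mu^-1], which is at most [2^n'], and this adds [n'] bits to the required
    precision. *)

(* Instruction number i of a program writes bit number i; operands are numbers
   of earlier bits (a missing operand reads as false). *)
Inductive instr (t : nat) :=
| Input of 'I_t
| One
| Xor of nat & nat
| And of nat & nat.
Arguments One {t}.
Arguments Xor {t}.
Arguments And {t}.

Section Programs.
Variable t : nat.
Notation input := ('I_t -> bool).
Notation program := (seq (instr t)).
Implicit Types (P Q : program) (f g : input -> bool) (F G : input -> nat).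

Definition instr_val (x : input) (m : seq bool) (o : instr t) : bool :=
  match o with
  | Input j => x j
  | One => true
  | Xor a b => nth false m a (+) nth false m b
  | And a b => nth false m a && nth false m b
  end.

Definition run P (x : input) : seq bool :=
  foldl (fun m o => rcons m (instr_val x m o)) [::] P.

Lemma run_rcons P o x : run (rcons P o) x = rcons (run P x) (instr_val x (run P x) o).
Proof. by rewrite /run -cats1 foldl_cat. Qed.

Lemma size_run P x : size (run P x) = size P.
Proof. by elim/last_ind: P => [//|P o IH]; rewrite run_rcons !size_rcons IH. Qed.

Lemma nth_run_cat P Q x i : i < size P ->
  nth false (run (P ++ Q) x) i = nth false (run P x) i.
Proof.
move=> iP; elim/last_ind: Q => [|Q o IH]; first by rewrite cats0.
rewrite -rcons_cat run_rcons nth_rcons size_run size_cat.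
by rewrite (leq_trans iP) ?leq_addr.
Qed.

Definition avail P f :=
  exists2 i, i < size P & forall x, nth false (run P x) i = f x.

(** Programs only grow at the end, so bits once computed stay available and instruction counts of
    successive extensions add up. The constructions below therefore extend a given program. *)
Definition ext n P P' := exists2 Q, P' = P ++ Q & size Q <= n.

Lemma ext_refl P : ext 0 P P.
Proof. by exists [::]; rewrite ?cats0. Qed.

Lemma ext_le m n P P' : m <= n -> ext m P P' -> ext n P P'.
Proof. by move=> mn [Q -> h]; exists Q => //; apply: leq_trans mn. Qed.

Lemma ext_trans m n P P' P'' : ext m P P' -> ext n P' P'' -> ext (m + n) P P''.
Proof.
move=> [Q -> h] [Q' -> h']; exists (Q ++ Q'); first by rewrite catA.
by rewrite size_cat leq_add.
Qed.

Lemma avail_ext n P P' f : ext n P P' -> avail P f -> avail P' f.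
Proof.
move=> [Q -> _] [i iP h]; exists i; first by rewrite size_cat ltn_addr.
by move=> x; rewrite nth_run_cat.
Qed.

Lemma eq_avail P f g : f =1 g -> avail P f -> avail P g.
Proof. by move=> fg [i iP h]; exists i => // x; rewrite h fg. Qed.

Lemma avail_op P f o : (forall x, instr_val x (run P x) o = f x) ->
  exists2 P', ext 1 P P' & avail P' f.
Proof.
move=> h; exists (rcons P o); first by exists [:: o]; rewrite ?cats1.
exists (size P); first by rewrite size_rcons.
by move=> x; rewrite run_rcons nth_rcons size_run ltnn eqxx.
Qed.

Lemma avail_xor P f g : avail P f -> avail P g ->
  exists2 P', ext 1 P P' & avail P' (fun x => f x (+) g x).
Proof.
by move=> [i _ hi] [j _ hj]; apply: (@avail_op _ _ (Xor i j)) => x; rewrite /= hi hj.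
Qed.

Lemma avail_and P f g : avail P f -> avail P g ->
  exists2 P', ext 1 P P' & avail P' (fun x => f x && g x).
Proof.
by move=> [i _ hi] [j _ hj]; apply: (@avail_op _ _ (And i j)) => x; rewrite /= hi hj.
Qed.

(** Xor with true is negation; false supplies the bits of a number beyond its width. *)
Definition consts P := avail P (fun=> true) /\ avail P (fun=> false).

Lemma consts_ext n P P' : ext n P P' -> consts P -> consts P'.
Proof. by move=> e [h1 h2]; split; apply: avail_ext e _. Qed.

Lemma avail_not P f : consts P -> avail P f ->
  exists2 P', ext 1 P P' & avail P' (fun x => ~~ f x).
Proof.
move=> [h1 _] /avail_xor/(_ h1)[P' e h]; exists P' => //.
by apply: eq_avail h => x; rewrite addbT.
Qed.

Definition bit (i n : nat) : bool := odd (n %/ 2 ^ i).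

(** All bits are demanded, including those from [W] on, which are false; widening a number then
    costs no instruction. *)
Definition numav P W F :=
  (forall x, F x < 2 ^ W) /\ (forall i, avail P (fun x => bit i (F x))).

Lemma numav_ext n P P' W F : ext n P P' -> numav P W F -> numav P' W F.
Proof. by move=> e [h1 h2]; split=> // i; apply: avail_ext e _. Qed.

Lemma numav_widen P W W' F : W <= W' -> numav P W F -> numav P W' F.
Proof.
move=> WW [h1 h2]; split=> // x; apply: leq_trans (h1 x) _.
by rewrite leq_exp2l.
Qed.

Lemma bit_ge W i n : n < 2 ^ W -> W <= i -> bit i n = false.
Proof.
by move=> h1 h2; rewrite /bit divn_small // (leq_trans h1) // leq_exp2l.
Qed.

Lemma eq_numav P W F G : F =1 G -> numav P W F -> numav P W G.
Proof.
move=> FG [h1 h2]; split=> [x|i]; first by rewrite -FG.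
by apply: eq_avail (h2 i) => x; rewrite FG.
Qed.

(** Bits are produced in increasing order, and bit [i] has to be obtained from an arbitrary
    extension [P1], since the lower bits have been appended to [P] by then. *)
Lemma numav_bits n P W F : consts P -> (forall x, F x < 2 ^ W) ->
  (forall i m P1, i < W -> ext m P P1 ->
    exists2 P', ext n P1 P' & avail P' (fun x => bit i (F x))) ->
  exists2 P', ext (W * n) P P' & numav P' W F.
Proof.
move=> cP FW H.
have H' V : V <= W -> exists2 P', ext (V * n) P P' &
    forall i, i < V -> avail P' (fun x => bit i (F x)).
  elim: V => [|V IH] VW; first by exists P => //; apply: ext_refl.
  have [P1 e1 h1] := IH (ltnW VW); have [P2 e2 h2] := H V _ P1 VW e1.
  exists P2; first by rewrite mulSn addnC; apply: ext_trans e1 e2.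
  move=> i; rewrite ltnS leq_eqVlt => /orP[/eqP-> //|/h1].
  exact: avail_ext e2.
have [P' e h] := H' W (leqnn W); exists P' => //; split=> // i.
have [/h //|Wi] := ltnP i W.
apply: eq_avail (consts_ext e cP).2 => x; symmetry; exact: bit_ge Wi.
Qed.

Lemma numav_mask P W b F : consts P -> avail P b -> numav P W F ->
  exists2 P', ext W P P' & numav P' W (fun x => b x * F x).
Proof.
move=> cP hb [FW hF]; rewrite -[W in ext W]muln1; apply: numav_bits => //.
  by move=> x; case: (b x); rewrite ?mul1n // mul0n expn_gt0.
move=> i m P1 _ e.
have [P2 e2 h2] := avail_and (avail_ext e hb) (avail_ext e (hF i)).
exists P2 => //; apply: eq_avail h2 => x.
by case: (b x); rewrite ?mul1n // mul0n /bit div0n.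
Qed.

Lemma numav_shift P W j F : consts P -> numav P W F ->
  numav P (W + j) (fun x => F x * 2 ^ j).
Proof.
move=> cP [FW hF]; split=> [x|i].
  by rewrite expnD ltn_pmul2r ?expn_gt0 // FW.
have [ij|ji] := ltnP i j.
  apply: eq_avail cP.2 => x; rewrite /bit -(subnK (ltnW ij)) expnD mulnA mulnK ?expn_gt0 //.
  by rewrite oddM oddX subn_eq0 leqNgt ij andbF.
apply: eq_avail (hF (i - j)) => x.
by rewrite /bit -{2}(subnK ji) expnD divnMr ?expn_gt0.
Qed.

Lemma numav_const P W k : consts P -> k < 2 ^ W -> numav P W (fun=> k).
Proof.
move=> cP kW; split=> // i.
by case: (bit i k); [exact: cP.1 | exact: cP.2].
Qed.

(** The carry into position [i] when [m], [n] and an incoming carry [c] are added; [c = true] serves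
    subtraction. *)
Definition carry (c : bool) i m n : bool := 2 ^ i <= m %% 2 ^ i + n %% 2 ^ i + c.

Lemma modn_expS m i : m %% 2 ^ i.+1 = bit i m * 2 ^ i + m %% 2 ^ i.
Proof.
rewrite /bit {1}(divn_eq m (2 ^ i)) {1}(divn_eq (m %/ 2 ^ i) 2) modn2.
rewrite mulnDl -mulnA -expnS -addnA modnMDl modn_small //.
have := ltn_pmod m (expn_gt0 2 i); rewrite expnS.
by case: odd; lia.
Qed.

Lemma div_carry (c : bool) i m n :
  (m + n + c) %/ 2 ^ i = m %/ 2 ^ i + n %/ 2 ^ i + carry c i m n.
Proof.
have p : 0 < 2 ^ i by rewrite expn_gt0.
rewrite {1}(divn_eq m (2 ^ i)) {1}(divn_eq n (2 ^ i)) /carry.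
set M := m %/ _; set N := n %/ _.
have := ltn_pmod m p; have := ltn_pmod n p; set a := m %% _; set b := n %% _ => hb ha.
have -> : M * 2 ^ i + a + (N * 2 ^ i + b) + c = (M + N) * 2 ^ i + (a + b + c) by lia.
rewrite divnMDl //; congr addn.
case: leqP => h; last by rewrite divn_small.
by rewrite -{1}(subnKC h) -{1}[2 ^ i]mul1n divnMDl // divn_small //; lia.
Qed.

Lemma bit_add (c : bool) i m n :
  bit i (m + n + c) = (bit i m (+) bit i n) (+) carry c i m n.
Proof. by rewrite {1}/bit div_carry !oddD oddb. Qed.

(** The majority of three bits, written so that it takes a single [And]. *)
Lemma carryS (c : bool) i m n : carry c i.+1 m n =
  ((bit i m (+) carry c i m n) && (bit i n (+) carry c i m n)) (+) carry c i m n.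
Proof.
have p : 0 < 2 ^ i by rewrite expn_gt0.
rewrite {1}/carry !modn_expS /carry expnS.
have := ltn_pmod m p; have := ltn_pmod n p.
move: (m %% 2 ^ i) (n %% 2 ^ i) => a b; move: (2 ^ i) => e hb ha.
have := leq_b1 c; move: (c : nat) => {}c hc.
have [h|h] := leqP e (a + b + c);
by case: (bit i m); case: (bit i n); rewrite ?mul1n ?mul0n /=; lia.
Qed.

(** A ripple-carry adder: the induction keeps the sum bits below [V] and the carry into [V]. Each
    position takes five instructions; [6 * W] leaves slack. *)
Lemma numav_addc (c : bool) P W F G : consts P -> numav P W F -> numav P W G ->
  exists2 P', ext (6 * W) P P' & numav P' W.+1 (fun x => F x + G x + c).
Proof.
move=> cP [FW hF] [GW hG].
have H V : exists P', [/\ ext (6 * V) P P',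
    forall i, i < V -> avail P' (fun x => bit i (F x + G x + c)) &
    avail P' (fun x => carry c V (F x) (G x))].
  elim: V => [|V [P1 [e1 h1 c1]]].
    exists P; split=> //; first exact: ext_refl.
    case: cP => p1 p2; rewrite /carry; case: c.
      by apply: eq_avail p1 => x; rewrite !modn1.
    by apply: eq_avail p2 => x; rewrite !modn1.
  have f1 := avail_ext e1 (hF V); have g1 := avail_ext e1 (hG V).
  have [P2 e2 h2] := avail_xor f1 c1.
  have [P3 e3 h3] := avail_xor (avail_ext e2 g1) (avail_ext e2 c1).
  have [P4 e4 h4] := avail_and (avail_ext e3 h2) h3.
  have e24 := ext_trans e2 (ext_trans e3 e4).
  have [P5 e5 h5] := avail_xor h4 (avail_ext e24 c1).
  have e25 := ext_trans e24 e5.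
  have [P6 e6 h6] := avail_xor (avail_ext e25 (avail_ext e1 (hG V))) (avail_ext
    (ext_trans (ext_trans e3 e4) e5) h2).
  have e26 := ext_trans e25 e6.
  exists P6; split.
  - by apply: ext_le (ext_trans e1 e26); lia.
  - move=> i; rewrite ltnS leq_eqVlt => /orP[/eqP->|iV].
      by apply: eq_avail h6 => x; rewrite bit_add addbA [X in X (+) _]addbC.
    exact: avail_ext e26 (h1 i iV).
  apply: eq_avail (avail_ext e6 h5) => x.
  by rewrite carryS.
have [P' [e h hc]] := H W; exists P' => //; split=> [x|i].
  by rewrite expnS; have := FW x; have := GW x; have := leq_b1 c; lia.
(* Bit [W] of the sum is the last carry, as neither operand has a bit there. *)
have [/h //|] := ltnP i W; rewrite leq_eqVlt => /orP[/eqP<-|Wi].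
  apply: eq_avail hc => x.
  by rewrite bit_add (bit_ge (FW x)) // (bit_ge (GW x)).
apply: eq_avail (consts_ext e cP).2 => x; symmetry; apply: bit_ge Wi.
by rewrite expnS; have := FW x; have := GW x; have := leq_b1 c; lia.
Qed.

Lemma numav_add P W F G : consts P -> numav P W F -> numav P W G ->
  exists2 P', ext (6 * W) P P' & numav P' W.+1 (fun x => F x + G x).
Proof.
move=> cP hF hG; have [P' e h] := numav_addc false cP hF hG; exists P' => //.
by apply: eq_numav h => x; rewrite addn0.
Qed.

Lemma bit_compl W i n : i < W -> n < 2 ^ W -> bit i (2 ^ W - 1 - n) = ~~ bit i n.
Proof.
move=> iW nW; have p : 0 < 2 ^ i by rewrite expn_gt0.
have := ltn_pmod n p; have := divn_eq n (2 ^ i).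
have : n %/ 2 ^ i < 2 ^ (W - i) by rewrite ltn_divLR // -expnD subnK // ltnW.
rewrite {2}/bit; set q := n %/ _; set r := n %% _ => qW nE rp.
(* Complementing acts separately above and below position [i]. Since [i < W], the number
   [2 ^ (W - i) - 1] is odd, which flips the parity of the quotient. *)
have e : 2 ^ W - 1 - n = (2 ^ (W - i) - 1 - q) * 2 ^ i + (2 ^ i - 1 - r).
  by rewrite nE -{1}(subnK (ltnW iW)) expnD; nia.
rewrite /bit e divnMDl // (divn_small (m := _ - r)); last by lia.
by rewrite addn0 -subnDA oddB ?oddD ?oddX ?subn_eq0; [rewrite leqNgt iW | lia].
Qed.

(** Adding 1 and the complement of [G] to [F] gives [2 ^ W + F - G], whose bit [W] tells whether
    [G <= F]; masking with that bit yields the truncated difference. *)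
Lemma numav_sub P W F G : consts P -> numav P W F -> numav P W G ->
  exists P', [/\ ext (9 * W) P P', numav P' W (fun x => F x - G x) &
    avail P' (fun x => G x <= F x)].
Proof.
move=> cP hF hG.
have [P1 e1 h1] : exists2 P', ext (W * 1) P P' & numav P' W (fun x => 2 ^ W - 1 - G x).
  apply: numav_bits => // [x|i m P1 iW e].
    by have := expn_gt0 2 W; lia.
  have [P2 e2 h2] := avail_not (consts_ext e cP) (avail_ext e (hG.2 i)).
  exists P2 => //; apply: eq_avail h2 => x.
  by rewrite bit_compl // hG.1.
have [P2 e2 h2] := numav_addc true (consts_ext e1 cP) (numav_ext e1 hF) h1.
have e12 := ext_trans e1 e2.
have TE x : F x + (2 ^ W - 1 - G x) + true = 2 ^ W + F x - G x.
  by have := hG.1 x; lia.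
have hb : avail P2 (fun x => G x <= F x).
  apply: eq_avail (h2.2 W) => x; rewrite TE /bit.
  have := hG.1 x; have := hF.1 x => Fx Gx.
  have [h|h] := leqP (G x) (F x).
    by rewrite -addnBA // -{1}[2 ^ W]mul1n divnMDl ?expn_gt0 // divn_small //; lia.
  by rewrite divn_small //; lia.
have [||P3 e3 h3] := @numav_bits 1 P2 W (fun x => F x - G x) (consts_ext e12 cP).
- by move=> x; have := hF.1 x; lia.
- move=> i m P3 iW e.
  have [P4 e4 h4] := avail_and (avail_ext e hb) (avail_ext e (h2.2 i)).
  exists P4 => //; apply: eq_avail h4 => x; rewrite TE /bit.
  have [h|h] := leqP (G x) (F x).
    rewrite /= -addnBA // -{1}(subnK (ltnW iW)) expnD divnMDl ?expn_gt0 //.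
    by rewrite oddD oddX subn_eq0 leqNgt iW.
  by rewrite (eqP (ltnW h : _ - _ == 0)) div0n.
exists P3; split=> //; last exact: avail_ext e3 hb.
by apply: ext_le (ext_trans e12 e3); lia.
Qed.


Lemma numav_mux P W b F G : consts P -> avail P b -> numav P W F -> numav P W G ->
  exists2 P', ext (8 * W + 1) P P' & numav P' W.+1 (fun x => if b x then F x else G x).
Proof.
move=> cP hb hF hG.
have [P1 e1 h1] := avail_not cP hb.
have [P2 e2 h2] := numav_mask (consts_ext e1 cP) (avail_ext e1 hb) (numav_ext e1 hF).
have e12 := ext_trans e1 e2.
have [P3 e3 h3] := numav_mask (consts_ext e12 cP) (avail_ext e2 h1) (numav_ext e12 hG).
have e13 := ext_trans e12 e3.
have [P4 e4 h4] := numav_add (consts_ext e13 cP) (numav_ext e3 h2) h3.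
exists P4; first by apply: ext_le (ext_trans e13 e4); lia.
by apply: eq_numav h4 => x; case: (b x); rewrite ?mul1n ?mul0n ?addn0.
Qed.

End Programs.

(* One step of the greedy rotation by the angle of half-tangent 2 ^- m; vectors
   are scaled by 4 ^ m + 1 to stay integral. *)
Definition cordic_cond (m : nat) (s : nat * nat * nat) : bool :=
  let: (X, Y, K) := s in X + Y * 2 ^ m.+1 + (K * 2 ^ (2 * m) + K) <= X * 2 ^ (2 * m).

Definition cordic_step (m : nat) (s : nat * nat * nat) : nat * nat * nat :=
  let: (X, Y, K) := s in
  if cordic_cond m s then
    (X * 2 ^ (2 * m) - (X + Y * 2 ^ m.+1),
     Y * 2 ^ (2 * m) - Y + X * 2 ^ m.+1, K * 2 ^ (2 * m) + K)
  else (X * 2 ^ (2 * m) + X, Y * 2 ^ (2 * m) + Y, K * 2 ^ (2 * m) + K).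

(** The third component is [k] times the accumulated scaling. A rotation is performed only if it
    keeps the first coordinate above this threshold, so the angle never exceeds the arccosine of
    [k / r]. The steps start at half-tangent 1/2: half-tangent 1 belongs to [pi / 2], the a priori
    bound on that arccosine. *)
Fixpoint cordic (k r j : nat) : nat * nat * nat :=
  if j is j'.+1 then cordic_step j'.+1 (cordic k r j') else (r, 0, k).

Definition cordic_bit (k r j : nat) := cordic_cond j.+1 (cordic k r j).

(** * The CORDIC iteration as a program *)

Section CordicProgram.
Variables (t : nat) (k : nat) (r : ('I_t -> bool) -> nat).
Hypothesis rt : forall x, r x < 2 ^ t.
Hypothesis kt : k < 2 ^ t.

(** The threshold grows by the same factor in both branches, so it can enter the program as a
    constant. *)
Lemma cordic_const x y j : (cordic k (r x) j).2 = (cordic k (r y) j).2.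
Proof.
elim: j => [//|j]; rewrite /= /cordic_step.
case: (cordic k (r x) j) => [[X Y] K]; case: (cordic k (r y) j) => [[X' Y'] K'] /= ->.
by case: ifP; case: ifP.
Qed.

Lemma cordic_step_program P W j : consts P ->
  numav P W (fun x => (cordic k (r x) j).1.1) ->
  numav P W (fun x => (cordic k (r x) j).1.2) ->
  (forall x, (cordic k (r x) j).2 < 2 ^ W) ->
  exists P', [/\ ext (100 * (W + 2 * j + 4)) P P',
    numav P' (W + 2 * j + 6) (fun x => (cordic k (r x) j.+1).1.1),
    numav P' (W + 2 * j + 6) (fun x => (cordic k (r x) j.+1).1.2),
    (forall x, (cordic k (r x) j.+1).2 < 2 ^ (W + 2 * j + 6)) &
    avail P' (fun x => cordic_bit k (r x) j)].
Proof.
move=> cP; rewrite /= /cordic_bit.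
set X := fun x => (cordic k (r x) j).1.1; set Y := fun x => (cordic k (r x) j).1.2.
move=> hX hY hK; set m := j.+1.
pose K0 := (cordic k (r (fun=> false)) j).2.
have KE x : (cordic k (r x) j).2 = K0 by apply: cordic_const.
have sE x : cordic k (r x) j = (X x, Y x, K0) by rewrite -(KE x) /X /Y -!surjective_pairing.
pose K1 := K0 * 2 ^ (2 * m) + K0.
have K0W : K0 < 2 ^ W by rewrite -(KE (fun=> false)).
have K1W : K1 < 2 ^ (W + 2 * m).+1.
  rewrite /K1 expnS expnD; have := expn_gt0 2 (2 * m); nia.
have cE n Q : ext n P Q -> consts Q by move=> e; apply: consts_ext e cP.
pose V := (W + 2 * m).+2.
have XP := numav_shift (2 * m) cP hX; have YP := numav_shift (2 * m) cP hY.
have X2 := numav_shift m.+1 cP hX; have Y2 := numav_shift m.+1 cP hY.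
have XW := numav_widen (leq_addr (2 * m) W) hX.
have YW := numav_widen (leq_addr (2 * m) W) hY.
have mW : W + m.+1 <= W + 2 * m by rewrite /m; lia.
have [P1 e1 hE] := numav_add cP XW (numav_widen mW Y2).
have [P2 e2 hD] := numav_add (cE _ _ e1) hE (numav_const (cE _ _ e1) K1W).
have e12 := ext_trans e1 e2.
have VW : W + 2 * m <= V by rewrite /V; lia.
have VW' : (W + 2 * m).+1 <= V by rewrite /V; lia.
have hPV := numav_widen VW XP.
have [P3 [e3 _ hb]] := numav_sub (cE _ _ e12) (numav_ext e12 hPV) hD.
have e13 := ext_trans e12 e3.
have [P4 [e4 hX1 _]] := numav_sub (cE _ _ e13) (numav_ext e13 hPV)
  (numav_ext (ext_trans e2 e3) (numav_widen VW' hE)).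
have e14 := ext_trans e13 e4.
have [P5 e5 hX0] := numav_add (cE _ _ e14) (numav_ext e14 XP) (numav_ext e14 XW).
have e15 := ext_trans e14 e5.
have [P6 e6 hX'] := numav_mux (cE _ _ e15) (avail_ext (ext_trans e4 e5) hb)
  (numav_ext e5 hX1) (numav_widen VW' hX0).
have e16 := ext_trans e15 e6.
have [P7 [e7 hY1 _]] := numav_sub (cE _ _ e16) (numav_ext e16 YP) (numav_ext e16 YW).
have e17 := ext_trans e16 e7.
have [P8 e8 hY2] := numav_add (cE _ _ e17) hY1 (numav_ext e17 (numav_widen mW X2)).
have e18 := ext_trans e17 e8.
have [P9 e9 hY0] := numav_add (cE _ _ e18) (numav_ext e18 YP) (numav_ext e18 YW).
have e19 := ext_trans e18 e9.
have b9 := avail_ext (ext_trans (ext_trans (ext_trans (ext_trans (ext_trans e4 e5) e6)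
  e7) e8) e9) hb.
have [Pa ea hY'] := numav_mux (cE _ _ e19) b9 (numav_ext e9 hY2) hY0.
have e1a := ext_trans e19 ea.
have condE x : cordic_cond m (cordic k (r x) j) =
    (X x + Y x * 2 ^ m.+1 + K1 <= X x * 2 ^ (2 * m)) by rewrite sE.
exists Pa; split.
- by apply: ext_le e1a; rewrite /V /m; lia.
- have h := numav_ext (ext_trans (ext_trans (ext_trans e7 e8) e9) ea) hX'.
  apply: (@numav_widen _ _ V.+1); first by rewrite /V /m; lia.
  by apply: eq_numav h => x; rewrite /cordic_step -condE sE; case: ifP.
- apply: (@numav_widen _ _ (W + 2 * m).+2); first by rewrite /m; lia.
  by apply: eq_numav hY' => x; rewrite /cordic_step -condE sE; case: ifP.
- move=> x; rewrite /cordic_step sE; have K1W' : K1 < 2 ^ (W + 2 * j + 6).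
    by apply: leq_trans K1W _; rewrite leq_exp2l // /m; lia.
  by case: ifP.
by apply: eq_avail (avail_ext ea b9) => x; rewrite condE.
Qed.

Hypothesis r_bits : forall i, exists f : option 'I_t, forall x,
  bit i (r x) = if f is Some j then x j else false.

Lemma cordic_program l : exists P, size P <= t + 2 + l * (100 * (t + (l + 3) ^ 2)) /\
  forall j, j < l -> avail P (fun x => cordic_bit k (r x) j).
Proof.
have [P0 [s0 c0 n0]] : exists P0, [/\ size P0 <= t + 2, consts P0 & numav P0 t r].
  (* Bit 5 does not exist when [And 5 5] is run, so this instruction writes the constant false. *)
  have h0 : consts [:: @One t; And 5 5].
    by split; [exists 0 | exists 1].
  have [|P e h] := @numav_bits _ 1 [:: @One t; And 5 5] t r h0 rt.
    move=> i m P1 it e; have [f fE] := r_bits i.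
    case: f fE => [j|] fE.
      by apply: (@avail_op _ _ _ (Input j)) => x; rewrite fE.
    exists P1; first by apply: ext_le (ext_refl _).
    by apply: eq_avail (consts_ext e h0).2 => x; rewrite fE.
  exists P; split=> //; last exact: consts_ext e h0.
  by case: e => Q -> sQ; rewrite size_cat /=; lia.
(* Step [j] widens the numbers by [2 j + 6] bits, which sums to [l * (l + 5)]. *)
have [P [[sP _] _ _ _ h]] : exists P, [/\
    size P <= t + 2 + l * (100 * (t + (l + 3) ^ 2)) /\
      consts P, numav P (t + l * (l + 5)) (fun x => (cordic k (r x) l).1.1),
    numav P (t + l * (l + 5)) (fun x => (cordic k (r x) l).1.2),
    (forall x, (cordic k (r x) l).2 < 2 ^ (t + l * (l + 5))) &
    forall j, j < l -> avail P (fun x => cordic_bit k (r x) j)]; last by exists P.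
elim: l => [|l [P [[sP cP] hX hY hK hb]]].
  exists P0; split=> //=; rewrite ?addn0 ?mul0n ?addn0 //.
  exact: (numav_const c0 (expn_gt0 2 t)).
have [P' [e hX' hY' hK' hb']] := cordic_step_program cP hX hY hK.
have wE : t + l * (l + 5) + 2 * l + 6 = t + l.+1 * (l.+1 + 5) by nia.
rewrite wE in hX' hY' hK'.
exists P'; split=> //.
- split; last exact: consts_ext e cP.
  case: e => Q -> sQ; rewrite size_cat; apply: leq_trans (leq_add sP sQ) _.
  have : (l + 3) ^ 2 <= (l.+1 + 3) ^ 2 by rewrite leq_exp2r // leq_add2r.
  have : t + l * (l + 5) + 2 * l + 4 <= t + (l.+1 + 3) ^ 2 by rewrite expnS expn1; lia.
  move: (t + (l.+1 + 3) ^ 2) ((l + 3) ^ 2) ((l.+1 + 3) ^ 2) => A B C hA hB.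
  rewrite mulSn; nia.
move=> j; rewrite ltnS leq_eqVlt => /orP[/eqP->//|/hb].
exact: avail_ext e.
Qed.
End CordicProgram.

Local Open Scope ring_scope.
Local Open Scope sesquilinear_scope.

(** * Quaternions *)

Record quat (R : Type) := Quat { qr : R; qi : R; qj : R; qk : R }.

Section QuatRing.
Variable R : realType.

Definition quat_tuple (q : quat R) : R * R * R * R :=
  (qr q, qi q, qj q, qk q).
Definition tuple_quat (t : R * R * R * R) : quat R :=
  Quat t.1.1.1 t.1.1.2 t.1.2 t.2.
Lemma quat_tupleK : cancel quat_tuple tuple_quat. Proof. by case. Qed.

HB.instance Definition _ := Choice.copy (quat R) (can_type quat_tupleK).

Definition qadd (p q : quat R) :=
  Quat (qr p + qr q) (qi p + qi q) (qj p + qj q) (qk p + qk q).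
Definition qopp (p : quat R) := Quat (- qr p) (- qi p) (- qj p) (- qk p).
Definition qmul (p q : quat R) :=
  Quat (qr p * qr q - qi p * qi q - qj p * qj q - qk p * qk q)
       (qr p * qi q + qi p * qr q + qj p * qk q - qk p * qj q)
       (qr p * qj q + qj p * qr q + qk p * qi q - qi p * qk q)
       (qr p * qk q + qk p * qr q + qi p * qj q - qj p * qi q).

Lemma qaddA : associative qadd.
Proof. by move=> p q r; congr Quat; rewrite /= addrA. Qed.
Lemma qaddC : commutative qadd.
Proof. by move=> p q; congr Quat; rewrite /= addrC. Qed.
Lemma qadd0 : left_id (Quat 0 0 0 0) qadd.
Proof. by case=> a b c d; congr Quat; rewrite /= add0r. Qed.
Lemma qaddN : left_inverse (Quat 0 0 0 0) qopp qadd.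
Proof. by case=> a b c d; congr Quat; rewrite /= addNr. Qed.
HB.instance Definition _ :=
  GRing.isZmodule.Build (quat R) qaddA qaddC qadd0 qaddN.

Lemma qmulA : associative qmul.
Proof. by move=> p q r; congr Quat; rewrite /=; ring. Qed.
Lemma qmul1l : left_id (Quat 1 0 0 0) qmul.
Proof. by case=> a b c d; congr Quat; rewrite /=; ring. Qed.
Lemma qmul1r : right_id (Quat 1 0 0 0) qmul.
Proof. by case=> a b c d; congr Quat; rewrite /=; ring. Qed.
Lemma qmulDl : left_distributive qmul qadd.
Proof. by move=> p q r; congr Quat; rewrite /=; ring. Qed.
Lemma qmulDr : right_distributive qmul qadd.
Proof. by move=> p q r; congr Quat; rewrite /=; ring. Qed.
HB.instance Definition _ :=
  GRing.Zmodule_isPzRing.Build (quat R) qmulA qmul1l qmul1r qmulDl qmulDr.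

Lemma qaddE (p q : quat R) : p + q =
  Quat (qr p + qr q) (qi p + qi q) (qj p + qj q) (qk p + qk q).
Proof. by []. Qed.
Lemma qoppE (p : quat R) : - p = Quat (- qr p) (- qi p) (- qj p) (- qk p).
Proof. by []. Qed.
Lemma qmulE (p q : quat R) : p * q = qmul p q. Proof. by []. Qed.
Lemma qoneE : 1 = Quat 1 0 0 0 :> quat R. Proof. by []. Qed.
Definition quatE := (qaddE, qoppE, qmulE, qoneE).

Definition qconj (q : quat R) := Quat (qr q) (- qi q) (- qj q) (- qk q).

Definition qnorm2 (q : quat R) := qr q ^+ 2 + qi q ^+ 2 + qj q ^+ 2 + qk q ^+ 2.
Definition qnorm (q : quat R) := Num.sqrt (qnorm2 q).

Lemma qnorm2_ge0 q : 0 <= qnorm2 q.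
Proof. by rewrite /qnorm2 !addr_ge0 ?sqr_ge0. Qed.
Lemma qnorm_ge0 q : 0 <= qnorm q. Proof. exact: sqrtr_ge0. Qed.
Lemma sqr_qnorm q : qnorm q ^+ 2 = qnorm2 q.
Proof. by rewrite sqr_sqrtr ?qnorm2_ge0. Qed.
Lemma qnorm2M p q : qnorm2 (p * q) = qnorm2 p * qnorm2 q.
Proof. by rewrite /qnorm2 /=; ring. Qed.
Lemma qnormM p q : qnorm (p * q) = qnorm p * qnorm q.
Proof. by rewrite /qnorm qnorm2M sqrtrM ?qnorm2_ge0. Qed.
Lemma qnormN q : qnorm (- q) = qnorm q.
Proof. by rewrite /qnorm /qnorm2 /= !sqrrN. Qed.
Lemma qnorm_conj q : qnorm (qconj q) = qnorm q.
Proof. by rewrite /qnorm /qnorm2 /= !sqrrN. Qed.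
Lemma qdistC p q : qnorm (p - q) = qnorm (q - p).
Proof. by rewrite -qnormN opprB. Qed.
Lemma qnorm1 : qnorm 1 = 1.
Proof. by rewrite /qnorm /qnorm2 /= !expr0n expr1n /= !addr0 sqrtr1. Qed.

Lemma qr_le_norm q : qr q <= qnorm q.
Proof.
apply: le_trans (ler_norm _) _; rewrite -sqrtr_sqr ler_wsqrtr // /qnorm2.
by rewrite -!addrA lerDl !addr_ge0 ?sqr_ge0.
Qed.

Lemma qnormD p q : qnorm (p + q) <= qnorm p + qnorm q.
Proof.
rewrite -(ler_pXn2r (ltn0Sn 1)) ?nnegrE ?addr_ge0 ?qnorm_ge0 //.
rewrite sqrrD !sqr_qnorm -qnorm_conj.
have := qr_le_norm (qconj p * q); rewrite qnormM /qnorm2 /=.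
by rewrite -mulr_natr; lra.
Qed.

Lemma qnormB p q : qnorm (p - q) <= qnorm p + qnorm q.
Proof. by rewrite -(qnormN q) qnormD. Qed.

Lemma qdistD r p q : qnorm (p - q) <= qnorm (p - r) + qnorm (r - q).
Proof. by rewrite -(subrKA r); apply: qnormD. Qed.

Lemma qmulVr q : qnorm q = 1 -> q * qconj q = 1.
Proof.
move=> /(congr1 (fun x => x ^+ 2)); rewrite sqr_qnorm expr1n /qnorm2 => h.
by rewrite !quatE /qmul /= -h; congr Quat; ring.
Qed.
Lemma qmulVl q : qnorm q = 1 -> qconj q * q = 1.
Proof.
move=> /(congr1 (fun x => x ^+ 2)); rewrite sqr_qnorm expr1n /qnorm2 => h.
by rewrite !quatE /qmul /= -h; congr Quat; ring.
Qed.

(* The commutator of p and q is 1 + [p, q] (q p)^-1 for the ring commutator. *)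
Lemma commutator_approx (p q p' q' : quat R) (s : R) :
  0 <= s <= 4^-1 ->
  qnorm p' = 1 -> qnorm q' = 1 ->
  qnorm (p - 1) <= s -> qnorm (q - 1) <= s ->
  qnorm (p - p') <= s ^+ 2 -> qnorm (q - q') <= s ^+ 2 ->
  qnorm (p * q - q * p) <= s ^+ 2 ->
  qnorm (p' * q' * qconj p' * qconj q' - 1 - (p * q - q * p)) <= 15 * s ^+ 3.
Proof.
move=> /andP[s0 s4] p'1 q'1 hp hq hpp hqq hX.
set X := p * q - q * p in hX *; set X' := p' * q' - q' * p'.
have -> : p' * q' * qconj p' * qconj q' = 1 + X' * (qconj p' * qconj q').
  rewrite /X' mulrBl !mulrA -[q' * p' * _]mulrA qmulVr // mulr1 qmulVr //.
  by rewrite addrC subrK.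
have sub (x y : R) : 0 <= x -> x <= y -> x * x <= y * y by move=> *; nra.
set dp := p' - p; set dq := q' - q.
have dpE : qnorm dp <= s ^+ 2 by rewrite qdistC.
have dqE : qnorm dq <= s ^+ 2 by rewrite qdistC.
(* Scalars drop out of a commutator, so [p] and [q] may be replaced by [p - 1] and [q - 1]; this
   turns an error of order [s ^+ 2] into one of order [s ^+ 3]. *)
have XX : X' - X = ((p - 1) * dq - dq * (p - 1)) +
    (dp * (q - 1) - (q - 1) * dp) + (dp * dq - dq * dp).
  rewrite /X' /X /dp /dq; case: p p' q q' {hp hq hpp hqq hX p'1 q'1 dp dq dpE dqE X X'}
    => a b c d [a1 b1 c1 d1] [a2 b2 c2 d2] [a3 b3 c3 d3].
  by rewrite !quatE /qmul /=; congr Quat; ring.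
have nM x y (a b : R) : qnorm x <= a -> qnorm y <= b ->
    qnorm (x * y - y * x) <= 2 * (a * b).
  move=> hx hy; apply: le_trans (qnormB _ _) _; rewrite !qnormM.
  rewrite [qnorm y * _]mulrC -mulr2n -[leLHS]mulr_natl.
  by rewrite ler_wpM2l // ler_pM ?qnorm_ge0.
have hXX : qnorm (X' - X) <= 4 * s ^+ 3 + 2 * s ^+ 4.
  rewrite XX; apply: le_trans (qnormD _ _) _.
  have := qnormD ((p - 1) * dq - dq * (p - 1)) (dp * (q - 1) - (q - 1) * dp).
  have := nM _ _ _ _ hp dqE; have := nM _ _ _ _ dpE hq.
  by have := nM _ _ _ _ dpE dqE; rewrite !exprS expr0 !mulr1; lra.
have hX' : qnorm X' <= s ^+ 2 + 4 * s ^+ 3 + 2 * s ^+ 4.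
  have := qnormD (X' - X) X; rewrite subrK; lra.
have h1 : qnorm (qconj p' * qconj q' - 1) <= 2 * (s + s ^+ 2).
  have c1 (x y : quat R) : qnorm (y - x) <= s ^+ 2 -> qnorm (y - 1) <= s ->
      qnorm (qconj x - 1) <= s + s ^+ 2.
    move=> hx hy.
    have -> : qconj x - 1 = qconj (x - 1).
      by rewrite !quatE /qconj /=; congr Quat; ring.
    by rewrite qnorm_conj; have := qdistD y x 1; rewrite (qdistC x y); lra.
  have -> : qconj p' * qconj q' - 1 =
      qconj p' * (qconj q' - 1) + (qconj p' - 1).
    by rewrite mulrBr mulr1 addrA subrK.
  apply: le_trans (qnormD _ _) _.
  rewrite qnormM qnorm_conj p'1 mul1r.
  by have := c1 _ _ hpp hp; have := c1 _ _ hqq hq; lra.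
have -> : 1 + X' * (qconj p' * qconj q') - 1 - X =
    X' * (qconj p' * qconj q' - 1) + (X' - X).
  by rewrite mulrBr mulr1 addrA subrK [1 + _]addrC addrK.
apply: le_trans (qnormD _ _) _; rewrite qnormM.
have := ler_pM (qnorm_ge0 _) (qnorm_ge0 _) hX' h1.
have s2 : s ^+ 2 <= s / 4 by rewrite expr2; nra.
have s20 : 0 <= s ^+ 2 by rewrite sqr_ge0.
have s30 : 0 <= s ^+ 3 by rewrite exprn_ge0.
have s4' : s ^+ 4 <= s ^+ 3 / 4 by rewrite exprS mulrC ler_wpM2l.
have s3 : s ^+ 3 <= s ^+ 2 / 4 by rewrite exprS mulrC ler_wpM2l.
(* For [s <= 1/4] the first factor is at most [4 s^2] and the second at most [5/2 s]. With the bound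
   [4 s^3 + 2 s^4 <= 9/2 s^3] of [hXX] the total stays below [15 s^3]. *)
have : (s ^+ 2 + 4 * s ^+ 3 + 2 * s ^+ 4) * (2 * (s + s ^+ 2)) <= 10 * s ^+ 3.
  have -> : 10 * s ^+ 3 = (4 * s^+2) * (2 * (s * (1 + 4^-1))) by field.
  apply: ler_pM; nra.
lra.
Qed.


(** The squared distance is [2 (1 - a)], and [1 - a <= 1 - a ^+ 2] for [0 <= a <= 1]. *)
Lemma near_one (a b c d n : R) : 0 <= a ->
  a ^+ 2 + n = 1 -> n = b ^+ 2 + c ^+ 2 + d ^+ 2 ->
  qnorm (Quat a b c d - 1) ^+ 2 <= 2 * n.
Proof.
move=> a0 h hn; rewrite sqr_qnorm /qnorm2 /= !subr0.
have n0 : 0 <= n by rewrite hn !addr_ge0 ?sqr_ge0.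
by rewrite -addrA -addrA addrA in hn *; nra.
Qed.

(** Write [v] for the vector [(x, y, z)]. The vector part of [p] is some [w] orthogonal to [v] with
    squared length [r / 2], that of [q] is the cross product of [v] and [w] divided by [r], of the
    same length by the Lagrange identity. The commutator is twice the cross product of the vector
    parts, which the triple product expansion evaluates to [v]. *)
Lemma commutator_exists (x y z r : R) : 0 <= r <= 1 ->
  x ^+ 2 + y ^+ 2 + z ^+ 2 = r ^+ 2 ->
  exists p q, [/\ qnorm p = 1, qnorm q = 1,
    qnorm (p - 1) ^+ 2 <= r, qnorm (q - 1) ^+ 2 <= r &
    p * q - q * p = Quat 0 x y z].
Proof.
move=> /andP[r0 r1] xyz.
have [r00|rn0] := eqVneq r 0.
  have xyz0 : x ^+ 2 + y ^+ 2 + z ^+ 2 = 0 by rewrite xyz r00 expr0n.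
  have sq0 (t : R) : t ^+ 2 = 0 -> t = 0 by move/eqP; rewrite sqrf_eq0 => /eqP.
  have := sqr_ge0 x; have := sqr_ge0 y; have := sqr_ge0 z => z2 y2 x2.
  have -> : x = 0 by apply: sq0; lra.
  have -> : y = 0 by apply: sq0; lra.
  have -> : z = 0 by apply: sq0; lra.
  exists 1, 1; rewrite subrr qnorm1 r00 /qnorm /qnorm2 /=.
  by rewrite mulr1 subrr !expr0n /= !addr0 sqrtr0 expr0n.
have rp : 0 < r by rewrite lt0r rn0.
have [a [b [c [abc n2]]]] : exists a b c, a * x + b * y + c * z = 0 /\
    a ^+ 2 + b ^+ 2 + c ^+ 2 = r / 2.
  have [h|h] := eqVneq (x ^+ 2 + y ^+ 2) 0.
    have x0 : x = 0.
      apply/eqP; rewrite -sqrf_eq0; apply/eqP.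
      by have := sqr_ge0 x; have := sqr_ge0 y; lra.
    exists (Num.sqrt (r / 2)), 0, 0.
    by rewrite x0 sqr_sqrtr ?divr_ge0 // ; split; ring.
  have hp : 0 < x ^+ 2 + y ^+ 2 by rewrite lt0r h addr_ge0 ?sqr_ge0.
  pose t := Num.sqrt (r / 2 / (x ^+ 2 + y ^+ 2)).
  have t2 : t ^+ 2 = r / 2 / (x ^+ 2 + y ^+ 2).
    by rewrite sqr_sqrtr // !divr_ge0 // ltW.
  exists (- y * t), (x * t), 0; split; first by ring.
  by rewrite !exprMn t2; field.
pose e := Num.sqrt (1 - r / 2).
have e2 : e ^+ 2 = 1 - r / 2 by rewrite sqr_sqrtr //; lra.
have e0 : 0 <= e by rewrite sqrtr_ge0.
have n2' : ((y * c - z * b) / r) ^+ 2 + ((z * a - x * c) / r) ^+ 2 +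
    ((x * b - y * a) / r) ^+ 2 = r / 2.
  have -> : r / 2 = ((x ^+ 2 + y ^+ 2 + z ^+ 2) * (a ^+ 2 + b ^+ 2 + c ^+ 2)
      - (a * x + b * y + c * z) ^+ 2) / r ^+ 2 by rewrite abc n2 xyz; field.
  by field.
have unit_of b1 b2 b3 : b1 ^+ 2 + b2 ^+ 2 + b3 ^+ 2 = r / 2 ->
    qnorm (Quat e b1 b2 b3) = 1 /\ qnorm (Quat e b1 b2 b3 - 1) ^+ 2 <= r.
  move=> h; split.
    apply: (@pexpIrn _ 2) => //; rewrite ?nnegrE ?qnorm_ge0 //.
    by rewrite sqr_qnorm expr1n /qnorm2 /= e2; lra.
  by have -> : r = 2 * (r / 2); [field | apply: near_one; rewrite ?e2 ?h //; ring].
have [p1 p2] := unit_of _ _ _ n2; have [q1 q2] := unit_of _ _ _ n2'.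
exists (Quat e a b c), (Quat e ((y * c - z * b) / r) ((z * a - x * c) / r)
   ((x * b - y * a) / r)); split=> //.
have cr (t p : R) : 2 * ((a ^+ 2 + b ^+ 2 + c ^+ 2) * t -
    p * (a * x + b * y + c * z)) / r = t by rewrite n2 abc; field.
rewrite !quatE /qmul /=; congr Quat; first by ring.
- by rewrite -[RHS](cr _ a); field.
- by rewrite -[RHS](cr _ b); field.
by rewrite -[RHS](cr _ c); field.
Qed.
End QuatRing.

(** * Words in H and T *)

Inductive letter := LH | LT | LD.

Definition linv (l : letter) := match l with LH => LH | LT => LD | LD => LT end.
Definition winv (w : seq letter) := rev (map linv w).

Section Words.
Variable R : realType.
Local Notation C := R[i].

Definition rsqrt2 : R := (Num.sqrt 2)^-1.
Local Notation s := rsqrt2.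

Lemma ss2 : s * s * 2 = 1.
Proof.
by rewrite /rsqrt2 -invfM -expr2 sqr_sqrtr ?ler0n // mulVf // pnatr_eq0.
Qed.

Lemma mul_ss2 x : x = s * s * 2 * x. Proof. by rewrite ss2 mul1r. Qed.

Definition omega : C := Complex s s.
Definition omegaV : C := Complex s (- s).

Definition act1 (l : letter) (u : C * C) : C * C :=
  match l with
  | LH => (Complex s 0 * (u.1 + u.2), Complex s 0 * (u.1 - u.2))
  | LT => (u.1, omega * u.2)
  | LD => (u.1, omegaV * u.2)
  end.
Definition act (w : seq letter) u := foldl (fun u l => act1 l u) u w.

(* The 2 x 2 matrix [[a + ib, c + id], [- c + id, a - ib]]. *)
Definition qact (q : quat R) (u : C * C) : C * C :=
  (Complex (qr q) (qi q) * u.1 + Complex (qj q) (qk q) * u.2,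
   Complex (- qj q) (qk q) * u.1 + Complex (qr q) (- qi q) * u.2).

Lemma act_cat w1 w2 u : act (w1 ++ w2) u = act w2 (act w1 u).
Proof. by rewrite /act foldl_cat. Qed.

Lemma qactM p q u : qact (p * q) u = qact p (qact q u).
Proof.
case: p q u => a b c d [a' b' c' d'] [[x0 y0] [x1 y1]]; rewrite /qact /=.
congr pair; apply/eqP; rewrite eq_complex /=; apply/andP; split; apply/eqP.
all: ring.
Qed.

Lemma qact1 u : qact 1 u = u.
Proof.
case: u => [[x0 y0] [x1 y1]]; rewrite qoneE /qact /=.
by congr pair; apply/eqP; rewrite eq_complex /=; apply/andP; split; apply/eqP; ring.
Qed.

Ltac eqss := apply/eqP; rewrite eq_complex /=; apply/andP; split; apply/eqP;
  rewrite [RHS]mul_ss2; ring.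

Lemma act1K l u : act1 l (act1 (linv l) u) = u.
Proof.
case: l u => [] [[x0 y0] [x1 y1]]; rewrite /act1 /=; congr pair => //; eqss.
Qed.

Lemma linvK : involutive linv. Proof. by case. Qed.

Lemma act_winvl w u : act (winv w) (act w u) = u.
Proof.
elim: w u => [//|l w IH] u.
rewrite /winv /= rev_cons -cats1 act_cat -/(winv w) IH /=.
by rewrite -{2}(linvK l) act1K.
Qed.

(** The action is required to be that of [q] exactly, with no global phase divided out. T has
    determinant [omega] and is no unit quaternion, so letters enter only through conjugations and
    products in which the determinants cancel. *)
Definition reach (L : nat) (q : quat R) :=
  exists2 w, (size w <= L)%N & (forall u, act w u = qact q u) /\ qnorm q = 1.

Lemma reach_norm L q : reach L q -> qnorm q = 1.
Proof. by case=> w _ []. Qed.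

Lemma reach_le L M q : (L <= M)%N -> reach L q -> reach M q.
Proof. by move=> LM [w h1 h2]; exists w => //; apply: leq_trans LM. Qed.

Lemma reach1 : reach 0 1.
Proof. by exists [::]; split; [move=> u; rewrite qact1 | exact: qnorm1]. Qed.

Lemma reachM L M p q : reach L p -> reach M q -> reach (L + M) (p * q).
Proof.
move=> [w hw [wp p1]] [v hv [vq q1]]; exists (v ++ w).
  by rewrite size_cat addnC leq_add.
by split; [move=> u; rewrite act_cat vq wp qactM | rewrite qnormM p1 q1 mulr1].
Qed.

Lemma reach_conj L q : reach L q -> reach L (qconj q).
Proof.
move=> [w hw [wq q1]]; exists (winv w).
  by rewrite size_rev size_map.
split; last by rewrite qnorm_conj.
move=> u; rewrite -{1}[u]qact1 -(qmulVr q1) qactM -wq act_winvl.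
by [].
Qed.

(** Conjugation by H swaps the first and third axes and negates the second. Together with
    conjugation by S = T^2, a quarter turn about the first axis, it yields the cyclic permutation of
    the axes and the sign changes used in the greedy search. *)
Lemma reach_H L q : reach L q ->
  reach (L + 2) (Quat (qr q) (qk q) (- qj q) (qi q)).
Proof.
move=> [w hw [wq q1]]; exists (LH :: w ++ [:: LH]).
  by rewrite /= size_cat /=; lia.
split; last by rewrite -q1 /qnorm /qnorm2 /=; congr Num.sqrt; ring.
case=> [[x0 y0] [x1 y1]]; rewrite /act /= foldl_cat -/(act w _) wq.
by case: q {wq q1} => a b c d; rewrite /qact /=; congr pair; eqss.
Qed.

Lemma act_TT u : act [:: LT; LT] u = (u.1, Complex 0 1 * u.2).
Proof.
by case: u => [[x0 y0] [x1 y1]]; rewrite /act /=; congr pair; eqss.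
Qed.

Lemma act_DD u : act [:: LD; LD] u = (u.1, Complex 0 (-1) * u.2).
Proof.
by case: u => [[x0 y0] [x1 y1]]; rewrite /act /=; congr pair; eqss.
Qed.

Lemma reach_S L q : reach L q ->
  reach (L + 4) (Quat (qr q) (qi q) (qk q) (- qj q)).
Proof.
move=> [w hw [wq q1]]; exists ([:: LD; LD] ++ w ++ [:: LT; LT]).
  by rewrite !size_cat /=; lia.
split; last by rewrite -q1 /qnorm /qnorm2 /=; congr Num.sqrt; ring.
move=> u; rewrite !act_cat act_TT wq act_DD.
case: q u {wq q1} => a b c d [[x0 y0] [x1 y1]]; rewrite /qact /=.
by congr pair; apply/eqP; rewrite eq_complex /=; apply/andP; split; apply/eqP; ring.
Qed.

Lemma reach_Z L q : reach L q ->
  reach (L + 8) (Quat (qr q) (qi q) (- qj q) (- qk q)).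
Proof. by move=> /reach_S/reach_S; rewrite -addnA. Qed.

Lemma act_T4 u : act (nseq 4 LT) u = (u.1, - u.2).
Proof.
case: u => [[x0 y0] [x1 y1]]; rewrite /act /=; congr pair.
apply/eqP; rewrite eq_complex /=; apply/andP; split; apply/eqP;
by rewrite [RHS]mul_ss2 [RHS]mul_ss2; ring.
Qed.

Lemma act_HT4H u : act (LH :: nseq 4 LT ++ [:: LH]) u = (u.2, u.1).
Proof.
rewrite -cat1s act_cat act_cat act_T4.
by case: u => [[x0 y0] [x1 y1]]; rewrite /act /=; congr pair; eqss.
Qed.

(** X Z X Z is -1, with Z = T^4 and X = H Z H. The word has 20 letters; the bound is generous. *)
Lemma reachN1 : reach 100 (-1).
Proof.
exists (let x := LH :: nseq 4 LT ++ [:: LH] in let z := nseq 4 LT in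
  x ++ z ++ x ++ z) => //.
split; last by rewrite qnormN qnorm1.
move=> u; rewrite !act_cat act_T4 act_HT4H act_T4 act_HT4H /qact /=.
case: u => [[x0 y0] [x1 y1]]; congr pair;
by apply/eqP; rewrite eq_complex /=; apply/andP; split; apply/eqP; ring.
Qed.

Lemma reachA : reach 4 (Quat ((1 + s) / 2) (s / 2) ((s - 1) / 2) (- s / 2)).
Proof.
have E z : [/\ z = s * s * 2 * z, s * z = s * s * 2 * (s * z) &
    s * s * z = s * s * 2 * (s * s * z)] by rewrite -!mul_ss2.
exists [:: LD; LH; LT; LH] => //; split.
  case=> [[x0 y0] [x1 y1]]; rewrite /act /qact /=; congr pair;
  apply/eqP; rewrite eq_complex /=; apply/andP; split; apply/eqP;
  by have [] := E x0; have [] := E x1; have [] := E y0; have [] := E y1; lra.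
rewrite /qnorm (_ : qnorm2 _ = 1) ?sqrtr1 // /qnorm2 /=.
by have [] := E 1; rewrite !expr2; lra.
Qed.

(** Multiplying H T H T^-1 by its conjugate under Z cancels the terms linear in [s], so the real
    part becomes rational, as the argument on denominators of powers requires. *)
Lemma reach_three_quarters : exists2 q, reach 16 q & qr q = 3 / 4.
Proof.
exists (Quat ((1 + s) / 2) (s / 2) ((s - 1) / 2) (- s / 2) *
  Quat ((1 + s) / 2) (s / 2) (- ((s - 1) / 2)) (- (- s / 2))).
  exact: (reachM reachA (reach_Z reachA)).
have e : s * s = 2^-1 by rewrite [RHS]mul_ss2; field.
rewrite /=; transitivity ((2 + s * s * 2) / 4); first by field.
by rewrite ss2; field.
Qed.

End Words.

(** * Elements close to 1 and their conjugates *)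

Section SolovayKitaev.
Variable R : realType.


Section SignedPermutations.
Variable P : nat -> R -> R -> R -> Prop.
Hypothesis Pcyc : forall n a b c, P n a b c -> P (n + 6)%N c a b.
Hypothesis Pflip : forall n a b c, P n a b c -> P (n + 8)%N (- a) b c.

Let Pcyc2 n a b c : P n a b c -> P (n + 12)%N b c a.
Proof. by move=> /Pcyc/Pcyc; rewrite -addnA. Qed.

Let Pflip2 n a b c : P n a b c -> P (n + 26)%N a (- b) c.
Proof. by move=> /Pcyc2/Pflip/Pcyc; rewrite -!addnA. Qed.

Let Pflip3 n a b c : P n a b c -> P (n + 26)%N a b (- c).
Proof. by move=> /Pcyc/Pflip/Pcyc2; rewrite -!addnA. Qed.

Let max_first n a b c : P n a b c -> exists n' a' b' c',
  [/\ (n' <= n + 12)%N, P n' a' b' c',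
      a' ^+ 2 + b' ^+ 2 + c' ^+ 2 = a ^+ 2 + b ^+ 2 + c ^+ 2,
      b' ^+ 2 <= a' ^+ 2 & c' ^+ 2 <= a' ^+ 2].
Proof.
move=> h.
case: (lerP (b ^+ 2) (a ^+ 2)) => ab; case: (lerP (c ^+ 2) (a ^+ 2)) => ac.
- by exists n, a, b, c; rewrite leq_addr.
- exists (n + 6)%N, c, a, b; split; [by lia | exact: Pcyc | lra | lra | lra].
- exists (n + 12)%N, b, c, a; split; [by lia | exact: Pcyc2 | lra | lra | lra].
case: (lerP (b ^+ 2) (c ^+ 2)) => bc.
  exists (n + 6)%N, c, a, b; split; [by lia | exact: Pcyc | lra | lra | lra].
exists (n + 12)%N, b, c, a; split; [by lia | exact: Pcyc2 | lra | lra | lra].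
Qed.

Let signs n a b c x y z : P n a b c -> exists n' a' b' c',
  [/\ (n' <= n + 60)%N, P n' a' b' c',
      [/\ a' ^+ 2 = a ^+ 2, b' ^+ 2 = b ^+ 2 & c' ^+ 2 = c ^+ 2] &
      [/\ 0 <= a' * x, 0 <= b' * y & 0 <= c' * z]].
Proof.
move=> h.
have [n1 [a' [n1n h1 e1 p1]]] : exists n' a', [/\ (n' <= n + 8)%N,
    P n' a' b c, a' ^+ 2 = a ^+ 2 & 0 <= a' * x].
  case: (lerP 0 (a * x)) => s; first by exists n, a; rewrite leq_addr.
  by exists (n + 8)%N, (- a); rewrite sqrrN mulNr oppr_ge0 ltW //; split=> //; apply: Pflip.
have [n2 [b' [n2n h2 e2 p2]]] : exists n' b', [/\ (n' <= n1 + 26)%N,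
    P n' a' b' c, b' ^+ 2 = b ^+ 2 & 0 <= b' * y].
  case: (lerP 0 (b * y)) => s; first by exists n1, b; rewrite leq_addr.
  by exists (n1 + 26)%N, (- b); rewrite sqrrN mulNr oppr_ge0 ltW //; split=> //;
    apply: Pflip2.
have [n3 [c' [n3n h3 e3 p3]]] : exists n' c', [/\ (n' <= n2 + 26)%N,
    P n' a' b' c', c' ^+ 2 = c ^+ 2 & 0 <= c' * z].
  case: (lerP 0 (c * z)) => s; first by exists n2, c; rewrite leq_addr.
  by exists (n2 + 26)%N, (- c); rewrite sqrrN mulNr oppr_ge0 ltW //; split=> //;
    apply: Pflip3.
by exists n3, a', b', c'; split=> //; lia.
Qed.

(** The entry of largest modulus is moved opposite the largest of [x], [y], [z], and signs are
    chosen so that all three products are nonnegative. The dot product is then at least the product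
    of the two largest entries, each at least its vector's length over the square root of 3. The
    cost 84 is 12 to find the largest entry, 12 to move it and 60 for the signs. *)
Lemma signed_perm_dot n b c d x y z : P n b c d ->
  exists n' b' c' d', [/\ (n' <= n + 84)%N, P n' b' c' d',
    0 <= b' * x + c' * y + d' * z,
    b' ^+ 2 + c' ^+ 2 + d' ^+ 2 = b ^+ 2 + c ^+ 2 + d ^+ 2 &
    (b ^+ 2 + c ^+ 2 + d ^+ 2) * (x ^+ 2 + y ^+ 2 + z ^+ 2) <=
      9 * (b' * x + c' * y + d' * z) ^+ 2].
Proof.
move=> /max_first[n1 [b1 [c1 [d1 [n1n h1 <- cb db]]]]].
have prod_le (u v U V p dt : R) : 0 <= U -> 0 <= V -> U <= 3 * u ^+ 2 ->
    V <= 3 * v ^+ 2 -> 0 <= u * v -> u * v <= dt -> U * V <= 9 * dt ^+ 2.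
  move=> U0 V0 hU hV uv0 uvd.
  have : U * V <= (3 * u ^+ 2) * (3 * v ^+ 2) by rewrite ler_pM.
  have : (u * v) ^+ 2 <= dt ^+ 2 by rewrite ler_pXn2r ?nnegrE // (le_trans uv0).
  by rewrite exprMn; lra.
have [ym|[ym|ym]] : (y ^+ 2 <= x ^+ 2 /\ z ^+ 2 <= x ^+ 2) \/
    (x ^+ 2 <= y ^+ 2 /\ z ^+ 2 <= y ^+ 2) \/
    (x ^+ 2 <= z ^+ 2 /\ y ^+ 2 <= z ^+ 2).
- case: (lerP (y ^+ 2) (x ^+ 2)) => yx; case: (lerP (z ^+ 2) (x ^+ 2)) => zx;
  case: (lerP (z ^+ 2) (y ^+ 2)) => zy;
  by [left; lra | right; left; lra | right; right; lra].
- have [n2 [b' [c' [d' [n2n h2 [eb ec ed] [pb pc pd]]]]]] := signs x y z h1.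
  exists n2, b', c', d'; rewrite -eb -ec -ed in cb db *; split=> //; [lia | lra |].
  apply: (prod_le b' x) => //; rewrite ?addr_ge0 ?sqr_ge0 //; lra.
- have [n2 [b' [c' [d' [n2n h2 [eb ec ed] [pb pc pd]]]]]] := signs x y z (Pcyc h1).
  exists n2, b', c', d'; rewrite -eb -ec -ed in cb db *; split=> //; [lia | lra | lra |].
  apply: (prod_le c' y) => //; rewrite ?addr_ge0 ?sqr_ge0 //; lra.
have [n2 [b' [c' [d' [n2n h2 [eb ec ed] [pb pc pd]]]]]] := signs x y z (Pcyc2 h1).
exists n2, b', c', d'; rewrite -eb -ec -ed in cb db *; split=> //; [lia | lra | lra |].
apply: (prod_le d' z) => //; rewrite ?addr_ge0 ?sqr_ge0 //; lra.
Qed.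
End SignedPermutations.

(** The power with exponent [2 ^ j]. Repeated squaring is used because the real part of a unit
    quaternion then evolves by the doubling formula [2 a^2 - 1]. *)
Fixpoint dbl_pow (q : quat R) j := if j is j'.+1 then dbl_pow q j' * dbl_pow q j' else q.

Lemma reach_dbl_pow L q j : reach L q -> reach (L * 2 ^ j) (dbl_pow q j).
Proof.
move=> h; elim: j => [|j IH] /=; first by rewrite expn0 muln1.
by rewrite expnS mul2n -addnn mulnDr; apply: reachM.
Qed.

(** An odd number over [2^m] is sent by [2 a^2 - 1] to an odd number over [2^(2m-1)]. Starting from
    [m = 2] the exponent is [2^j + 1] after [j] squarings. *)
Lemma dbl_pow_odd q j : qnorm q = 1 -> qr q = 3 / 4 ->
  exists k : int, qr (dbl_pow q j) * 2 ^+ (2 ^ j).+1 = (2 * k + 1)%:~R.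
Proof.
move=> q1 q34.
have n1 i : qnorm (dbl_pow q i) = 1.
  by elim: i => [//|i IH]; rewrite /= qnormM IH mulr1.
elim: j => [|j [k IH]].
  by exists 1; rewrite /= q34 expn0 (_ : (2 * 1 + 1)%:~R = 3) // !exprS expr0; field.
have := n1 j; set a := dbl_pow q j in IH * => na.
have {}na : qnorm2 a = 1 by rewrite -sqr_qnorm na expr1n.
have -> : qr (dbl_pow q j.+1) = 2 * qr a ^+ 2 - 1.
  by move: na; rewrite /= -/a /qnorm2; lra.
exists (2 * k * (k + 1) - 2 ^+ (2 ^ j.+1).-1 * 2).
have e2 : (2 ^ j.+1 = (2 ^ j.+1).-1.+1)%N by rewrite prednK // expn_gt0.
have -> : (2 * qr a ^+ 2 - 1) * 2 ^+ (2 ^ j.+1).+1 =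
   (qr a * 2 ^+ (2 ^ j).+1) ^+ 2 - 2 ^+ (2 ^ j.+1).+1.
  rewrite exprMn -exprM mulSn mulnC -expnS addSnnS add1n.
  by rewrite !exprS; ring.
rewrite IH {1}e2; set E := (2 ^ j.+1).-1.
rewrite (exprS _ E.+1) (exprS _ E) expr2 !(intrD, intrM, mulrNz, rmorphXn) /=.
by ring.
Qed.

Lemma dbl_pow_neq q i j : qnorm q = 1 -> qr q = 3 / 4 -> (i < j)%N ->
  qr (dbl_pow q i) <> qr (dbl_pow q j).
Proof.
move=> q1 q34 ij e.
have [k hk] := dbl_pow_odd i q1 q34; have [m hm] := dbl_pow_odd j q1 q34.
have lt2 : (2 ^ i < 2 ^ j)%N by rewrite ltn_exp2l.
have : ((2 * k + 1) * 2 ^+ (2 ^ j - 2 ^ i))%:~R = (2 * m + 1)%:~R :> R.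
  rewrite -hm intrM -hk e rmorphXn /= -mulrA -exprD; congr (_ * _ ^+ _).
  by lia.
move/intr_inj; have -> : (2 ^ j - 2 ^ i = (2 ^ j - 2 ^ i).-1.+1)%N by lia.
by rewrite exprS; nia.
Qed.

Lemma floor_close (M : nat) (x y : R) : -1 <= x -> -1 <= y ->
  Num.truncn ((1 + x) * M.+1%:R) = Num.truncn ((1 + y) * M.+1%:R) ->
  (x - y) ^+ 2 <= (M.+1%:R ^-1) ^+ 2.
Proof.
move=> hx hy e.
have p : 0 < M.+1%:R :> R by rewrite ltr0Sn.
have := @truncn_itv R ((1 + x) * M.+1%:R); have := @truncn_itv R ((1 + y) * M.+1%:R).
rewrite e -natr1 => /(_ _)/andP[]; first by nra.
move=> a1 a2 /(_ _)/andP[]; first by nra.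
move=> a3 a4.
have : `|x - y| <= M.+1%:R^-1.
  rewrite -(ler_pM2r p) mulVf ?gt_eqF // -{1}(gtr0_norm p) -normrM ler_norml.
  by apply/andP; split; lra.
move=> h; rewrite natr1 -[(x - y) ^+ 2]real_normK ?num_real //.
by have := normr_ge0 (x - y); set m := `|_| in h *; move=> m0; rewrite !expr2 ler_pM.
Qed.

(** Pigeonhole on the four coordinates: among more powers than cells two share a cell, and the
    quotient of these two is close to 1. It differs from 1 since the real parts of distinct powers
    [h i] have different denominators. *)
Lemma small_element (t : R) : 0 < t -> exists L (q : quat R),
  [/\ reach L q, 0 < 1 - qr q & 1 - qr q <= t].
Proof.
move=> t0.
have [q rq q34] := reach_three_quarters R.
have q1 := reach_norm rq.
pose M := Num.bound (2 / t).
have Mt : 2 / t < M.+1%:R.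
  apply: lt_trans (archi_boundP _) _; first by rewrite divr_ge0 // ltW.
  by rewrite ltr_nat.
pose h := dbl_pow q.
have h1 i : qnorm (h i) = 1 by apply: reach_norm (reach_dbl_pow i rq).
have bnd i : [/\ -1 <= qr (h i) <= 1, -1 <= qi (h i) <= 1,
    -1 <= qj (h i) <= 1 & -1 <= qk (h i) <= 1].
  have : qnorm2 (h i) = 1 by rewrite -sqr_qnorm h1 expr1n.
  rewrite /qnorm2 => n2.
  have := sqr_ge0 (qr (h i)); have := sqr_ge0 (qi (h i)).
  have := sqr_ge0 (qj (h i)); have := sqr_ge0 (qk (h i)) => k0 j0 i0 r0.
  by split; apply/andP; split; nra.
pose cell (x : R) : 'I_(2 * M.+1).+1 := inord (Num.truncn ((1 + x) * M.+1%:R)).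
pose F (i : 'I_((2 * M.+1).+1 ^ 4).+1) :=
  (cell (qr (h i)), cell (qi (h i)), cell (qj (h i)), cell (qk (h i))).
have /injectivePn[i [j ij Fij]] : ~~ injectiveb F.
  apply/negP => /injectiveP/leq_card; rewrite !card_prod !card_ord; apply/negP;
    rewrite -ltnNge.
  by rewrite !expnS expn0 muln1 !mulnA.
have cellE (x y : R) : -1 <= x <= 1 -> -1 <= y <= 1 -> cell x = cell y ->
    (x - y) ^+ 2 <= (M.+1%:R ^-1) ^+ 2.
  have lt (z : R) : -1 <= z <= 1 -> (Num.truncn ((1 + z) * M.+1%:R) < (2 * M.+1).+1)%N.
    move=> /andP[z1 z2]; rewrite ltnS -(ler_nat R).
    have p : 0 < M.+1%:R :> R by rewrite ltr0Sn.
    apply: (@le_trans _ _ ((1 + z) * M.+1%:R)).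
      by rewrite truncn_le; nra.
    by rewrite natrM; nra.
  move=> hx hy /(congr1 val); rewrite /= !inordK ?lt //.
  by apply: floor_close; [case/andP: hx | case/andP: hy].
case: Fij => er ei ej ek.
have {cellE} d2 : qnorm2 (h i - h j) <= 4 * (M.+1%:R ^-1) ^+ 2.
  have [a1 a2 a3 a4] := bnd i; have [b1 b2 b3 b4] := bnd j.
  have := cellE _ _ a1 b1 er; have := cellE _ _ a2 b2 ei.
  have := cellE _ _ a3 b3 ej; have := cellE _ _ a4 b4 ek.
  rewrite /qnorm2 !quatE /=; set m := (_^-1 ^+ 2).
  by lra.
wlog {er ei ej ek} lij : i j ij d2 / (i < j)%N.
  move=> H; have := ij; rewrite neq_ltn => /orP[|]; first exact: H.
  by apply: H; rewrite 1?eq_sym // -sqr_qnorm qdistC sqr_qnorm.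
have ri (k : nat) := reach_dbl_pow k rq.
exists (16 * 2 ^ i + 16 * 2 ^ j)%N, (qconj (h i) * h j).
(* With cells of side [1 / (M + 1)] this is at most [2 / (M + 1)^2], hence at most [t] by the choice
   of [M]. *)
have e : 1 - qr (qconj (h i) * h j) = qnorm2 (h i - h j) / 2.
  have := h1 i; have := h1 j => /(congr1 (fun x => x ^+ 2)) + /(congr1 (fun x => x ^+ 2)).
  by rewrite !sqr_qnorm expr1n /qnorm2 /=; lra.
split; first by apply: reachM (ri j); apply/reach_conj/ri.
- rewrite e divr_gt0 // lt0r qnorm2_ge0 andbT; apply/eqP => d0.
  apply: (dbl_pow_neq q1 q34 lij); apply/eqP; rewrite -subr_eq0 -sqrf_eq0.
  move: d0; rewrite /qnorm2 /= => d0.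
  have := sqr_ge0 (qr (h i) - qr (h j)); have := sqr_ge0 (qi (h i) - qi (h j)).
  have := sqr_ge0 (qj (h i) - qj (h j)); have := sqr_ge0 (qk (h i) - qk (h j)).
  by rewrite -/(h i) -/(h j) => *; apply/eqP; lra.
rewrite e.
have p : 0 < M.+1%:R :> R by rewrite ltr0Sn.
have p1 : M.+1%:R^-1 <= 1 :> R by rewrite invf_le1 // ler1n.
have p0 : 0 < M.+1%:R^-1 :> R by rewrite invr_gt0.
have : M.+1%:R^-1 <= t / 2 by rewrite -[t / 2]invf_div lef_pV2 ?posrE ?divr_gt0 // ltW.
set m : R := _^-1 in d2 p0 p1 * => hm.
have : m ^+ 2 <= m by rewrite expr2 ler_piMl // ltW.
by lra.
Qed.
End SolovayKitaev.

(** * The Solovay-Kitaev theorem *)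

Section SolovayKitaev.
Variable R : realType.
Implicit Types (u p q : quat R).

Lemma qconjM p q : qconj (p * q) = qconj q * qconj p.
Proof. by rewrite !quatE /qconj /qmul /=; congr Quat; ring. Qed.

Lemma qdist2 p q : qnorm p = 1 -> qnorm q = 1 ->
  qnorm2 (p - q) = 2 * (1 - qr (qconj q * p)).
Proof.
move=> /(congr1 (fun x => x ^+ 2)) + /(congr1 (fun x => x ^+ 2)).
by rewrite !sqr_qnorm expr1n /qnorm2 /=; lra.
Qed.

Lemma qnorm2B1 p :
  qnorm2 (p - 1) = (qr p - 1) ^+ 2 + (qi p ^+ 2 + qj p ^+ 2 + qk p ^+ 2).
Proof. by rewrite !quatE /qnorm2 /=; ring. Qed.

(** Let [x] and [y] be 1 minus the real parts of [u] and [g], and [t] the dot product of the vector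
    parts of [h] and [u]. The new defect is [x + y - x y - t]. The vector parts of [u] and [g] have
    squared lengths at least [x] and [y], so [9 t^2 >= x y >= 36 y^2], that is [t >= 2 y]; this is
    the origin of 36. *)
Lemma greedy_step L g u : reach L g -> qnorm u = 1 ->
  0 < 1 - qr g <= 1 -> 36 * (1 - qr g) <= 1 - qr u <= 1 ->
  exists2 h, reach (L + 84) h &
    1 - qr (qconj h * u) <= (1 - qr u) - (1 - qr g).
Proof.
move=> rg u1 /andP[y0 y1] /andP[x0 x1].
pose P n b c d := reach n (Quat (qr g) b c d).
have Pcyc n a b c : P n a b c -> P (n + 6)%N c a b.
  by move=> /reach_H/reach_S; rewrite /= opprK -addnA.
have Pflip n a b c : P n a b c -> P (n + 8)%N (- a) b c.
  by move=> /reach_Z/reach_conj; rewrite /= /qconj /= !opprK.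
have Pg : P L (qi g) (qj g) (qk g) by rewrite /P; case: (g) rg.
have [n [b [c [d [nL rh d0 n2 dot]]]]] :=
  signed_perm_dot Pcyc Pflip (qi u) (qj u) (qk u) Pg.
exists (Quat (qr g) b c d); first exact: reach_le nL rh.
have := reach_norm rg => /(congr1 (fun x => x ^+ 2)).
move: u1 => /(congr1 (fun x => x ^+ 2)).
rewrite !sqr_qnorm expr1n /qnorm2 /= => hu hg.
set t := _ + _ + _ in d0 dot.
set y := 1 - qr g in y0 y1 x0 *; set x := 1 - qr u in x0 x1 *.
have hy : y <= qi g ^+ 2 + qj g ^+ 2 + qk g ^+ 2.
  have -> : qi g ^+ 2 + qj g ^+ 2 + qk g ^+ 2 = y * (2 - y) by rewrite /y; lra.
  by rewrite ler_peMr; lra.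
have hx : x <= qi u ^+ 2 + qj u ^+ 2 + qk u ^+ 2.
  have -> : qi u ^+ 2 + qj u ^+ 2 + qk u ^+ 2 = x * (2 - x) by rewrite /x; lra.
  by rewrite ler_peMr; lra.
have x00 : 0 <= x by lra.
have t2 : (2 * y) ^+ 2 <= t ^+ 2.
  have : y * (36 * y) <= y * x by rewrite ler_wpM2l // ltW.
  by have := ler_pM (ltW y0) x00 hy hx; lra.
have ty : 2 * y <= t by rewrite -(@ler_pXn2r _ 2) ?nnegrE // mulr_ge0 // ltW.
have xy : 0 <= x * y by rewrite mulr_ge0 // ltW.
have -> : 1 - (qr g * qr u - - b * qi u - - c * qj u - - d * qk u) =
   x + y - x * y - t by rewrite /x /y /t; ring.
lra.
Qed.

Lemma greedy L g j u : reach L g -> qnorm u = 1 ->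
  0 < 1 - qr g <= 1 -> 1 - qr u <= 1 -> 1 - qr u <= (36 + j%:R) * (1 - qr g) ->
  exists2 h, reach (j * (L + 84)) h & 1 - qr (qconj h * u) <= 36 * (1 - qr g).
Proof.
move=> rg + hg; elim: j u => [|j IH] u u1 ux uj.
  exists 1; first exact: reach1.
  have -> : qconj 1 * u = u by rewrite -[qconj 1]mul1r qmulVr ?qnorm1 // mul1r.
  by rewrite addr0 in uj.
case: (lerP (36 * (1 - qr g)) (1 - qr u)) => hu; last first.
  exists 1; first by apply: reach_le (reach1 R).
  have -> : qconj 1 * u = u by rewrite -[qconj 1]mul1r qmulVr ?qnorm1 // mul1r.
  exact: ltW.
have /(greedy_step rg u1 hg)[h rh hh] : 36 * (1 - qr g) <= 1 - qr u <= 1.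
  by rewrite hu ux.
have [|||k rk hk] := IH (qconj h * u).
- by rewrite qnormM qnorm_conj u1 (reach_norm rh) mulr1.
- by case/andP: hg => *; lra.
- by apply: le_trans hh _; move: uj; rewrite -natr1; lra.
exists (h * k); last by rewrite qconjM -mulrA.
by rewrite mulSn; apply: reachM.
Qed.

Lemma base_net (e : R) : 0 < e -> exists L, forall u, qnorm u = 1 ->
  exists2 q, reach L q & qnorm (u - q) <= e.
Proof.
move=> e0.
(* The greedy search stops at defect [36 (1 - qr g)], and the squared distance is twice the defect;
   [e ^+ 2 / 72] makes it at most [e ^+ 2]. *)
have [|L [g [rg g0 g1]]] := @small_element R (Num.min 1 (e ^+ 2 / 72)).
  by rewrite lt_min ltr01 divr_gt0 // exprn_gt0.
have /andP[ga gb] : (1 - qr g <= 1) && (1 - qr g <= e ^+ 2 / 72).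
  by rewrite -le_min.
pose j := Num.bound (1 - qr g)^-1.
have hj : 1 <= j%:R * (1 - qr g).
  by rewrite -ler_pdivrMr // div1r ltW // archi_boundP // invr_ge0 ltW.
have pos u : qnorm u = 1 -> 0 <= qr u -> exists2 q, reach (j * (L + 84)) q &
    qnorm (u - q) <= e.
  move=> u1 u0; have [|||q rq hq] := @greedy L g j u rg u1.
  - by rewrite g0 ga.
  - by lra.
  - by lra.
  exists q => //; rewrite -(@ler_pXn2r _ 2) ?nnegrE ?qnorm_ge0 // ?(ltW e0) //.
  by rewrite sqr_qnorm qdist2 ?(reach_norm rq) //; lra.
(* The search requires a defect at most 1, i.e. a nonnegative real part; otherwise [- u] is
   approximated and the word for -1 is added. *)
exists (100 + j * (L + 84))%N => u u1.
case: (lerP 0 (qr u)) => hu.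
  by have [q rq hq] := pos u u1 hu; exists q => //; apply: reach_le rq; rewrite leq_addl.
have [||q rq hq] := pos (- u); rewrite ?qnormN //=; first by lra.
exists (-1 * q); first by apply: reachM => //; apply: reachN1.
by rewrite mulN1r opprK -qnormN opprD.
Qed.

Definition net L (e : R) := forall u, qnorm u = 1 ->
  exists2 q, reach L q & qnorm (u - q) <= e.

(** The quotient [v] of [u] by its approximant [g] is within [s ^+ 2] of 1. Its vector part is a
    commutator of [p] and [q] within [s] of 1, and these are replaced by net elements. The four
    factors of the group commutator and [g] give the factor 5. Dropping the real part of [v - 1]
    costs at most [s ^+ 3], besides the [15 * s ^+ 3] of the commutator. *)
Lemma net_step L (s : R) : 0 <= s <= 4^-1 -> net L (s ^+ 2) ->
  net (5 * L) (16 * s ^+ 3).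
Proof.
move=> s14 H u u1; have [g rg hg] := H u u1.
have g1 := reach_norm rg.
have /andP[s0 s4] := s14.
have s1 : s <= 1 by lra.
have s43 : s ^+ 4 <= s ^+ 3 by rewrite exprS ler_piMl ?exprn_ge0.
have s30 : 0 <= s ^+ 3 by rewrite exprn_ge0.
have s21 : s ^+ 2 <= 1 by rewrite expr_le1.
have [v vE] : exists v, v = u * qconj g by exists (u * qconj g).
have v1 : qnorm v = 1 by rewrite vE qnormM u1 qnorm_conj g1 mulr1.
have hv : qnorm (v - 1) <= s ^+ 2.
  by rewrite vE -(qmulVr g1) -mulrBl qnormM qnorm_conj g1 mulr1.
have n2v : qnorm2 (v - 1) <= s ^+ 4.
  by rewrite -sqr_qnorm (exprM s 2 2) lerXn2r ?nnegrE ?qnorm_ge0 // sqr_ge0.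
have ev : qnorm2 (v - 1) = 2 * (1 - qr v).
  rewrite qdist2 ?qnorm1 //.
  by rewrite (_ : qconj 1 * v = v) // -[qconj 1]mul1r qmulVr ?qnorm1 // mul1r.
pose n := qi v ^+ 2 + qj v ^+ 2 + qk v ^+ 2.
have n0 : 0 <= n by rewrite !addr_ge0 ?sqr_ge0.
have nle : n <= s ^+ 4.
  by apply: le_trans n2v; rewrite qnorm2B1 -/n lerDr sqr_ge0.
have rle : Num.sqrt n <= s ^+ 2.
  rewrite -(@ler_pXn2r _ 2) ?nnegrE ?sqrtr_ge0 ?sqr_ge0 //.
  by rewrite sqr_sqrtr // -exprM.
have [||p [q [p1 q1 hp hq e]]] := @commutator_exists R (qi v) (qj v) (qk v) (Num.sqrt n).
- by rewrite sqrtr_ge0 (le_trans rle).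
- by rewrite sqr_sqrtr.
have [p' rp hp'] := H p p1; have [q' rq hq'] := H q q1.
have le_s (x : quat R) : qnorm x ^+ 2 <= Num.sqrt n -> qnorm x <= s.
  move=> h; rewrite -(@ler_pXn2r _ 2) ?nnegrE ?qnorm_ge0 //.
  exact: le_trans rle.
have := @commutator_approx R p q p' q' s s14 (reach_norm rp) (reach_norm rq)
  (le_s _ hp) (le_s _ hq) hp' hq'.
have -> : qnorm (p * q - q * p) = Num.sqrt n.
  by rewrite e /qnorm /qnorm2 /= expr0n add0r.
move=> /(_ rle); set k := p' * q' * _ * _ => hk.
exists (k * g).
  have -> : (5 * L = L + L + L + L + L)%N by rewrite !mulSn mul0n addn0 !addnA.
  exact: (reachM (reachM (reachM (reachM rp rq) (reach_conj rp)) (reach_conj rq)) rg).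
have -> : u = v * g by rewrite vE -mulrA qmulVl // mulr1.
rewrite -mulrBl qnormM g1 mulr1.
have := qdistD (1 + (p * q - q * p)) v k.
have -> : qnorm (1 + (p * q - q * p) - k) = qnorm (k - 1 - (p * q - q * p)).
  by rewrite qdistC opprD addrA.
have : qnorm (v - (1 + (p * q - q * p))) <= s ^+ 3.
  rewrite e /qnorm /qnorm2 /= !add0r addr0 !subrr expr0n !addr0 /= sqrtr_sqr.
  have := qnorm2_ge0 (v - 1); rewrite ev => v0; move: n2v; rewrite ev => v4.
  by rewrite distrC ger0_norm; lra.
lra.
Qed.

Lemma net_le L M (e f : R) : (L <= M)%N -> e <= f -> net L e -> net M f.
Proof.
move=> LM ef H u /H[q rq hq]; exists q; first exact: reach_le rq.
exact: le_trans ef.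
Qed.

Theorem solovay_kitaev : exists K, forall e, net (K * e.+1 ^ 6) (2^-1 ^+ e).
Proof.
(* For exponents above 51 the inequality [4 * (2 m + 1) <= 3 * (e + 1)] used below is guaranteed
   despite the rounding in [m]. *)
have [|K HK] := @base_net (2^-1 ^+ 51); first by rewrite exprn_gt0 // invr_gt0 ltr0n.
exists K => e; elim/ltn_ind: e => e IH.
have [e51|e51] := leqP e 51.
  apply: net_le HK; first by rewrite leq_pmulr // expn_gt0.
  by rewrite ler_wiXn2l //; lra.
(* With [s = 2^-m] the new precision is [16 s^3 = 2^(4 - 3m)], hence the demand [e + 4 <= 3 m]. *)
pose m := ((e + 6) %/ 3)%N.
have m1 : (e + 4 <= 3 * m)%N by rewrite /m; lia.
have m2 : (2 * m < e)%N by rewrite /m; lia.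
have := IH _ m2; rewrite (mulnC 2 m) exprM => /net_step.
have h2 : 0 <= (2^-1 : R) <= 1 by lra.
have /andP[h20 h21] := h2.
have h4 : (2^-1 : R) ^+ 2 = 4^-1 by field.
have -> : 0 <= (2^-1 : R) ^+ m <= 4^-1.
  by rewrite exprn_ge0 //= -h4 ler_wiXn2l //; lia.
move=> /(_ isT); apply: net_le.
  rewrite mulnCA leq_mul2l; apply/orP; right.
  (* Words five times as long are affordable since [5 * 3^6 <= 4^6], which accounts for the exponent
     6. *)
  have : (4 * (m * 2).+1 <= 3 * e.+1)%N by rewrite /m; lia.
  move: (m * 2).+1 e.+1 => a b ab.
  have : ((4 * a) ^ 6 <= (3 * b) ^ 6)%N by rewrite leq_exp2r.
  by rewrite !expnMn; move: (a ^ 6)%N (b ^ 6)%N => A B; lia.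
rewrite -exprM.
have -> : 16 = 2^-1 ^- 4 :> R by field.
rewrite mulrC -(@subnKC 4 (m * 3)); last by lia.
rewrite exprD mulrC mulKf ?expf_neq0 ?invr_eq0 ?pnatr_eq0 //.
by rewrite ler_wiXn2l //; lia.
Qed.
End SolovayKitaev.

(** * Accuracy of the computed angle *)

Section CordicAnalysis.
Variable R : realType.

Definition half_angle (m : nat) : R := atan (2^-1 ^+ m).

Lemma cos_half_angle_gt0 m : 0 < cos (half_angle m).
Proof. by rewrite cos_gt0_pihalf // atan_gtNpi2 atan_ltpi2. Qed.

Lemma sqr_cos_half_angle m :
  cos (half_angle m) ^+ 2 = 2 ^+ (2 * m) / (2 ^+ (2 * m) + 1).
Proof.
have p : 0 < 2 ^+ m :> R by rewrite exprn_gt0.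
rewrite cos_atan [LHS]exprVn sqr_sqrtr ?addr_ge0 ?sqr_ge0 //.
rewrite mulnC exprM (exprVn _ m); field.
by rewrite !gt_eqF //= addr_gt0 // exprn_gt0.
Qed.

Lemma cos_double_half_angle m :
  cos (half_angle m *+ 2) = (2 ^+ (2 * m) - 1) / (2 ^+ (2 * m) + 1).
Proof.
rewrite cos_mulr2n sqr_cos_half_angle -mulr_natr; field.
by rewrite gt_eqF // addr_gt0 // exprn_gt0.
Qed.

Lemma sin_double_half_angle m :
  sin (half_angle m *+ 2) = 2 ^+ m.+1 / (2 ^+ (2 * m) + 1).
Proof.
have c0 := lt0r_neq0 (cos_half_angle_gt0 m).
have p : 0 < 2 ^+ m :> R by rewrite exprn_gt0.
rewrite sin_mulr2n -[sin _](divfK c0) -/(tan _) atanK mulrCA -expr2.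
rewrite sqr_cos_half_angle mulnC exprM exprVn -mulr_natr (exprS _ m); field.
by rewrite !gt_eqF //= addr_gt0 // exprn_gt0.
Qed.

Lemma half_angle_ge0 m : 0 <= half_angle m.
Proof. by rewrite -atan0 le_atan // exprn_ge0 // invr_ge0 ler0n. Qed.

Lemma half_angle0 : half_angle 0 *+ 2 = pi / 2.
Proof. by rewrite /half_angle expr0 atan1 -mulr_natr; field. Qed.

Lemma half_angleS_lt m : half_angle m.+1 *+ 2 < pi / 2.
Proof.
rewrite -half_angle0 ltrMn2r /= lt_atan // expr0 exprn_ilt1 //; lra.
Qed.

(** This makes the greedy expansion converge: a remainder at most the current angle is at most twice
    the next one, so subtracting the next angle at most once suffices. The reason is
    [tan (2 b) >= 2 tan b] for the half-angle [b] below [pi / 4]. *)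
Lemma half_angle_double m : half_angle m *+ 2 <= half_angle m.+1 *+ 2 *+ 2.
Proof.
rewrite lerMn2r /=; set u : R := 2^-1 ^+ m.+1.
have u0 : 0 < u by rewrite exprn_gt0 // invr_gt0 ltr0n.
have u1 : u < 1 by rewrite exprn_ilt1 // ?invr_ge0 ?ler0n // invf_lt1 ?ltr0n ?ltr1n.
have u2 : 0 < 1 - u ^+ 2 by rewrite subr_gt0 expr_lt1 // ltW.
rewrite -[leRHS]tanK; last first.
  rewrite in_itv /= half_angleS_lt andbT.
  apply: (@lt_le_trans _ _ 0); last by rewrite mulrn_wge0 ?half_angle_ge0.
  by rewrite oppr_lt0 divr_gt0 ?pi_gt0.
apply: le_atan; rewrite tan_mulr2n ?gt_eqF ?cos_half_angle_gt0 // atanK -/u.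
have -> : 2^-1 ^+ m = u *+ 2 by rewrite /u exprS -mulr_natr; field.
rewrite ler_pdivlMr // ler_piMr //; first by rewrite mulrn_wge0 // ltW.
by have := sqr_ge0 u; lra.
Qed.

Variables (k r : nat).
Hypothesis k0 : (0 < k)%N.
Hypothesis kr : (k <= r)%N.

Definition cordic_angle (l : nat) : R :=
  \sum_(j < l) (if cordic_bit k r j then half_angle j.+1 *+ 2 else 0).

Definition cordic_scale (l : nat) : R := \prod_(j < l) (2 ^+ (2 * j.+1) + 1).

Lemma cordic_scale_gt0 l : 0 < cordic_scale l.
Proof. by apply: prodr_gt0 => i _; rewrite addr_gt0 // exprn_gt0. Qed.

Local Notation phi := (acos (k%:R / r%:R : R)).

Lemma ratio_itv : 0 <= (k%:R / r%:R : R) <= 1.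
Proof.
have r0 : (0 < r)%N by apply: leq_trans kr.
by rewrite divr_ge0 ?ler0n //= ler_pdivrMr ?ltr0n // mul1r ler_nat.
Qed.

Lemma cos_phi : cos phi = k%:R / r%:R.
Proof.
have /andP[h1 h2] := ratio_itv.
by rewrite acosK // in_itv /= h2 andbT (le_trans _ h1) // lerN10.
Qed.

Lemma phi_ge0 : 0 <= phi.
Proof. by have /andP[h1 h2] := ratio_itv;
  rewrite acos_ge0 // h2 andbT (le_trans _ h1) // lerN10. Qed.

Lemma cos_le_pi (x y : R) : 0 <= x <= pi -> 0 <= y <= pi -> (cos x <= cos y) = (y <= x).
Proof. by move=> hx hy; rewrite !leNgt ltr_cos // in_itv. Qed.

Lemma phi_le : phi <= pi / 2.
Proof.
have /andP[h1 h2] := ratio_itv.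
have p0 := pi_gt0 R.
have h3 : 0 <= phi <= pi.
  by rewrite phi_ge0 acos_lepi // h2 andbT (le_trans _ h1) // lerN10.
rewrite -cos_le_pi ?cos_pihalf ?cos_phi //.
by apply/andP; split; lra.
Qed.

(** The integer vector is exactly [r] times the accumulated scaling in the direction of the
    accumulated angle, so no rounding error arises; only the truncation of the expansion remains. *)
Lemma cordicE l :
  [/\ (cordic k r l).1.1%:R = r%:R * cordic_scale l * cos (cordic_angle l),
      (cordic k r l).1.2%:R = r%:R * cordic_scale l * sin (cordic_angle l),
      (cordic k r l).2%:R = k%:R * cordic_scale l &
      0 <= phi - cordic_angle l <= half_angle l *+ 2].
Proof.
elim: l => [|l [hX hY hK /andP[h1 h2]]].
  rewrite /cordic_angle /cordic_scale !big_ord0 cos0 sin0 subr0 half_angle0 !mulr1 mulr0.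
  by rewrite phi_ge0 phi_le.
have r0 : 0 < r%:R :> R by rewrite ltr0n (leq_trans k0).
have S0 : 0 <= cordic_angle l.
  by apply: sumr_ge0 => i _; case: ifP; rewrite // mulrn_wge0 ?half_angle_ge0.
have N0 := cordic_scale_gt0 l.
have SN : cordic_scale l.+1 = cordic_scale l * (2 ^+ (2 * l.+1) + 1).
  by rewrite /cordic_scale big_ord_recr.
have SA : cordic_angle l.+1 = cordic_angle l +
    (if cordic_bit k r l then half_angle l.+1 *+ 2 else 0).
  by rewrite /cordic_angle big_ord_recr.
have hb := half_angleS_lt l; have h0 := half_angle_ge0 l.+1.
have hd := half_angle_double l; have hp := phi_le; have p0 := pi_gt0 R.
have b0 : 0 <= half_angle l.+1 *+ 2 by rewrite mulrn_wge0.
have := cos_double_half_angle l.+1; have := sin_double_half_angle l.+1.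
rewrite SN SA; move: SA => _.
rewrite -[cordic k r l.+1]/(cordic_step l.+1 (cordic k r l)).
rewrite /cordic_step /cordic_bit /cordic_cond.
have : (0 < 2 ^ (2 * l.+1))%N by rewrite expn_gt0.
have := natrX R 2 l.+2; have := natrX R 2 (2 * l.+1).
move: (2 ^ l.+2)%N (2 ^ (2 * l.+1))%N => d' c'.
have : 1 <= 2 ^+ (2 * l.+1) :> R by rewrite exprn_ege1 // ler1n.
move: (2 ^+ (2 * l.+1)) (2 ^+ l.+2) => c d c2 cE dE c'0.
set s := cordic k r l in hX hY hK *.
set b := half_angle l.+1 *+ 2 in hb hd b0 *.
set S := cordic_angle l in h1 h2 hX hY S0 *; set N := cordic_scale l in hX hY hK N0 *.
have c1 : 0 < c + 1 by lra.
move: hX hY hK; case: s => [[X Y] K]; cbn [fst snd] => hX hY hK sb cb.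
have cosE : r%:R * N * (c + 1) * cos (S + b) = X%:R * (c - 1) - d * Y%:R.
  by rewrite cosD sb cb hX hY; field; rewrite gt_eqF.
have sinE : r%:R * N * (c + 1) * sin (S + b) = Y%:R * (c - 1) + d * X%:R.
  by rewrite sinD sb cb hX hY; field; rewrite gt_eqF.
(* The integer comparison compares cosines. Both angles lie in [[0, pi]], where the cosine
   decreases: [S <= phi <= pi / 2] and [b < pi / 2]. *)
have condE : (X + Y * d' + (K * c' + K) <= X * c')%N = (S + b <= phi).
  rewrite -(ler_nat R) !(natrD, natrM) cE ?dE hK.
  have i1 : 0 <= phi <= pi by rewrite phi_ge0; lra.
  have i2 : 0 <= S + b <= pi by apply/andP; split; lra.
  rewrite -(cos_le_pi i1 i2) cos_phi.
  have -> : (k%:R / r%:R <= cos (S + b)) =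
    (k%:R * N * (c + 1) <= r%:R * N * (c + 1) * cos (S + b)).
    rewrite ler_pdivrMr // -(ler_pM2r (mulr_gt0 N0 c1)) mulrA; congr (_ <= _); ring.
  rewrite cosE; apply/idP/idP; lra.
case: ifP; rewrite condE => hc; cbn [fst snd].
  split.
  (* The tested inequality itself shows that this subtraction of naturals does not truncate. *)
  - rewrite natrB; last by rewrite -condE in hc; apply: leq_trans (leq_addr _ _) hc.
    by rewrite !(natrD, natrM) cE ?dE !mulrA cosE; ring.
  - rewrite natrD natrB; last by rewrite leq_pmulr.
    by rewrite !natrM cE ?dE !mulrA sinE; ring.
  - by rewrite natrD natrM cE hK; ring.
  by apply/andP; split; lra.
split.
- by rewrite addr0 natrD natrM cE hX; ring.
- by rewrite addr0 natrD natrM cE hY; ring.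
- by rewrite natrD natrM cE hK; ring.
by rewrite addr0 h1 /=; move/negbT: hc; rewrite -ltNge; lra.
Qed.

(** With remainder [g] the difference is [cos S (1 - cos g) + sin S sin g], and each term is at most
    [2 * 2^-l] since [g] is at most the last angle. For [l > 0] that angle is at most [pi / 2], so
    sines can be compared. *)
Lemma cordic_approx l : (0 < l)%N ->
  `|cos (cordic_angle l) - k%:R / r%:R| <= 4 * 2^-1 ^+ l.
Proof.
move=> l0; have [_ _ _ /andP[g0 g1]] := cordicE l.
have hp := phi_le; have p0 := pi_gt0 R.
have S0 : 0 <= cordic_angle l.
  by apply: sumr_ge0 => i _; case: ifP; rewrite // mulrn_wge0 ?half_angle_ge0.
have hb : half_angle l *+ 2 <= pi / 2.
  by case: l l0 {g0 g1 S0} => // l _; apply/ltW/half_angleS_lt.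
rewrite -cos_phi; set S := cordic_angle l in g0 g1 S0 *.
set g := phi - S in g0 g1.
have hphi : phi = S + g by rewrite /g addrC subrK.
have cosle : cos phi <= cos S by rewrite cos_le_pi; lra.
rewrite ger0_norm ?subr_ge0 // hphi cosD.
have sg : sin g <= 2 * 2^-1 ^+ l.
  apply: (@le_trans _ _ (sin (half_angle l *+ 2))).
    by rewrite leNgt ltr_sin ?in_itv /= -?leNgt //; apply/andP; split; lra.
  rewrite sin_double_half_angle ler_pdivrMr ?addr_gt0 ?exprn_gt0 //.
  rewrite exprS mulrDr mulr1 mulnC exprM expr2.
  have -> : 2 * 2^-1 ^+ l * (2 ^+ l * 2 ^+ l) = 2 * 2 ^+ l :> R.
    by rewrite mulrA -(mulrA 2) -exprMn mulVf ?pnatr_eq0 // expr1n mulr1.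
  by rewrite lerDl mulr_ge0 // exprn_ge0 // invr_ge0 ler0n.
have cg : 1 - cos g <= 2 * 2^-1 ^+ l.
  have : cos (half_angle l *+ 2) <= cos g by rewrite cos_le_pi; lra.
  rewrite cos_double_half_angle.
  have -> : (2 ^+ (2 * l) - 1) / (2 ^+ (2 * l) + 1) = 1 - 2 / (2 ^+ (2 * l) + 1) :> R.
    by field; rewrite gt_eqF // addr_gt0 // exprn_gt0.
  have : 2 / (2 ^+ (2 * l) + 1) <= 2 * 2^-1 ^+ l :> R.
    rewrite ler_pM2l // exprVn lef_pV2 ?posrE ?addr_gt0 ?exprn_gt0 //.
    rewrite (@le_trans _ _ (2 ^+ (2 * l))) ?lerDl // ler_weXn2l ?ler1n //; lia.
  lra.
have cS : 0 <= cos S <= 1.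
  by rewrite cos_le1 andbT cos_ge0_pihalf //; apply/andP; split; lra.
have sS : 0 <= sin S <= 1 by rewrite sin_le1 andbT sin_ge0_pi //; apply/andP; split; lra.
have sg0 : 0 <= sin g by rewrite sin_ge0_pi //; apply/andP; split; lra.
have cg1 := cos_le1 g.
nra.
Qed.

End CordicAnalysis.

(** * Gates acting on basis states *)

Section Kets.
Variable R : realType.
Local Notation C := R[i].

Definition ket N (w : word N) : 'cV[C]_(2 ^ N) := \col_y (bits y == w)%:R.

Lemma ket_idx N (x : 'I_(2 ^ N)) : ket (bits x) = delta_mx x ord0.
Proof.
apply/matrixP => y z; rewrite !mxE (ord1 z) eqxx andbT.
by rewrite (can_eq (@bitsK N)).
Qed.

Lemma mulmx_ket m N (A : 'M[C]_(m, 2 ^ N)) w : A *m ket w = col (idx w) A.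
Proof. by rewrite -[w in LHS]idxK ket_idx colE. Qed.

Lemma eq_on_kets m N (A B : 'M[C]_(m, 2 ^ N)) :
  (forall w, A *m ket w = B *m ket w) -> A = B.
Proof.
move=> h; apply/matrixP => i j; have := h (bits j).
by rewrite !mulmx_ket bitsK => /matrixP/(_ i ord0); rewrite !mxE.
Qed.

Definition upd N (w : word N) (i : 'I_N) (b : bool) : word N :=
  [ffun j => if j == i then b else w j].

Lemma upd_upd N (w : word N) i b b' : upd (upd w i b) i b' = upd w i b'.
Proof. by apply/ffunP => j; rewrite !ffunE; case: eqP. Qed.

Lemma upd_id N (w : word N) i : upd w i (w i) = w.
Proof. by apply/ffunP => j; rewrite !ffunE; case: eqP => [->|]. Qed.

Lemma upd_same N (w : word N) i b : upd w i b i = b.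
Proof. by rewrite ffunE eqxx. Qed.

Lemma upd_other N (w : word N) i j b : j != i -> upd w i b j = w j.
Proof. by rewrite ffunE => /negbTE->. Qed.

Lemma upd_swap N (w : word N) i j b c : i != j ->
  upd (upd w i b) j c = upd (upd w j c) i b.
Proof.
move=> ij; apply/ffunP => z; rewrite !ffunE.
by case: (eqVneq z j) => [->|//]; rewrite eq_sym (negbTE ij).
Qed.

Definition place N k (a : 'I_k -> 'I_N) (w : word N) (v : word k) : word N :=
  [ffun j => if [pick i | a i == j] is Some i then v i else w j].

Lemma place_in N k (a : 'I_k -> 'I_N) w v i : injective a -> place a w v (a i) = v i.
Proof.
by move=> ai; rewrite ffunE; case: pickP => [j /eqP/ai-> //|/(_ i)]; rewrite eqxx.
Qed.

Lemma place_out N k (a : 'I_k -> 'I_N) w v j : j \notin codom a -> place a w v j = w j.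
Proof.
rewrite ffunE; case: pickP => [i /eqP <-|//]; by rewrite codom_f.
Qed.

Lemma eq_place N k (a : 'I_k -> 'I_N) (w w' : word N) v : injective a ->
  (w' == place a w v) = ([ffun i => w' (a i)] == v) &&
    [forall j, (j \notin codom a) ==> (w' j == w j)].
Proof.
move=> ai; apply/eqP/andP => [->|[/eqP e /forallP h]].
  split; first by apply/eqP/ffunP => i; rewrite ffunE place_in.
  by apply/forallP => j; apply/implyP => hj; rewrite place_out.
apply/ffunP => j; case: (boolP (j \in codom a)) => [/codomP[i ->]|hj].
  by rewrite place_in // -e ffunE.
by rewrite place_out //; apply/eqP; apply: (implyP (h j)).
Qed.

Lemma on_wires_basis N k (a : 'I_k -> 'I_N) g w : injective a ->
  on_wires a (basis_mx R g) *m ket w = ket (place a w (g [ffun i => w (a i)])).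
Proof.
move=> ai; rewrite mulmx_ket; apply/matrixP => y z; rewrite !mxE eq_place // !idxK.
by rewrite -natrM mulnb.
Qed.

Lemma idx1 (v : word 1) : idx v = v ord0 :> nat.
Proof. by rewrite /= big_ord1 subnn muln1. Qed.

Lemma on_wires1 N (i : 'I_N) (G : 'M[C]_(2 ^ 1)) w :
  on_wires (fun=> i) G *m ket w =
  G (idx [ffun=> false]) (idx [ffun=> w i]) *: ket (upd w i false) +
  G (idx [ffun=> true]) (idx [ffun=> w i]) *: ket (upd w i true).
Proof.
rewrite mulmx_ket; apply/matrixP => y z; rewrite !mxE !idxK.
have cod j : (j \in codom (fun _ : 'I_1 => i)) = (j == i).
  by apply/codomP/eqP => [[_ ->]|->]; [|exists ord0].
have E b : (bits y == upd w i b) = (bits y i == b) &&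
    [forall j, (j \notin codom (fun _ : 'I_1 => i)) ==> (bits y j == w j)].
  apply/eqP/andP => [->|[/eqP e /forallP h]].
    rewrite upd_same; split=> //; apply/forallP => j; rewrite cod; apply/implyP => ji.
    by rewrite upd_other.
  apply/ffunP => j; rewrite [RHS]ffunE; have [->|ji] := eqVneq j i; first by rewrite e.
  by apply/eqP; apply: (implyP (h j)); rewrite cod.
rewrite !E; case: [forall j, _]; last by rewrite !andbF !mulr0 addr0.
by rewrite !andbT !mulr1; case: (bits y i); rewrite !(mulr1, mulr0, addr0, add0r).
Qed.

(** Along the circuit, superpositions are confined to one wire [i]; both summands overwrite bit [i]
    of [w], so a state is an amplitude pair and a classical word. *)
Definition cket N (i : 'I_N) (u : C * C) (w : word N) : 'cV[C]_(2 ^ N) :=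
  u.1 *: ket (upd w i false) + u.2 *: ket (upd w i true).

Definition eket (b : bool) : C * C := if b then (0, 1) else (1, 0).

Lemma ket_cket N (i : 'I_N) w : ket w = cket i (eket (w i)) w.
Proof.
rewrite /cket -{1}(upd_id w i); case: (w i); rewrite /= scale1r scale0r.
  by rewrite add0r.
by rewrite addr0.
Qed.

Lemma cket_upd N (i : 'I_N) u w b : cket i u (upd w i b) = cket i u w.
Proof. by rewrite /cket !upd_upd. Qed.

Lemma mulmx_cket N m (A : 'M[C]_(m, 2 ^ N)) i u w :
  A *m cket i u w = u.1 *: (A *m ket (upd w i false)) + u.2 *: (A *m ket (upd w i true)).
Proof. by rewrite mulmxDr -!scalemxAr. Qed.

Lemma on_wires1_cket N (i : 'I_N) (G : 'M[C]_(2 ^ 1)) u w :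
  on_wires (fun=> i) G *m cket i u w =
  cket i (G (idx [ffun=> false]) (idx [ffun=> false]) * u.1 +
          G (idx [ffun=> false]) (idx [ffun=> true]) * u.2,
          G (idx [ffun=> true]) (idx [ffun=> false]) * u.1 +
          G (idx [ffun=> true]) (idx [ffun=> true]) * u.2) w.
Proof.
rewrite mulmx_cket !on_wires1 !upd_same !upd_upd /cket /=.
rewrite !scalerDr !scalerA !scalerDl addrACA.
by congr (_ + _ + (_ + _)); congr (_ *: _); rewrite mulrC.
Qed.

Lemma cos_pi4 : cos (pi / 4) = rsqrt2 R.
Proof.
have p0 := pi_gt0 R.
have c0 : 0 <= cos (pi / 4 : R) by apply: cos_ge0_pihalf; apply/andP; split; lra.
have := cos_mulr2n (pi / 4 : R);
  have -> : (pi / 4) *+ 2 = pi / 2 :> R by rewrite -mulr_natr; field.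
rewrite cos_pihalf => /esym/eqP; rewrite subr_eq0 => /eqP h.
rewrite -[LHS]ger0_norm // -sqrtr_sqr /rsqrt2 -sqrtrV ?ler0n //; congr Num.sqrt.
by rewrite -[cos _ ^+ 2](@mulfK _ 2) ?pnatr_eq0 // mulr_natr h div1r.
Qed.

Lemma sin_pi4 : sin (pi / 4) = rsqrt2 R.
Proof. by rewrite -cos_pi4 -cosBpihalf -cosN; congr cos; field. Qed.

Lemma omegaE : polar (1 : R) (pi / 4) = omega R.
Proof. by rewrite /polar cos_pi4 sin_pi4 !mul1r. Qed.

Lemma hadamard_cket N (i : 'I_N) u w :
  on_wires (fun=> i) (hadamard R) *m cket i u w = cket i (act1 LH u) w.
Proof.
rewrite on_wires1_cket !mxE !idx1 !ffunE /= /polar cos0 sin0 mulr1 mulr0.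
rewrite -/(rsqrt2 R); congr (cket _ _ _); case: u => u v /=.
by rewrite !expr0 expr1; congr pair; ring.
Qed.

Lemma tgate_cket N (i : 'I_N) u w :
  on_wires (fun=> i) (tgate R) *m cket i u w = cket i (act1 LT u) w.
Proof.
have e b b' : (idx [ffun=> b] == idx [ffun=> b'] :> 'I_(2 ^ 1)) = (b == b').
  rewrite (can_eq (@idxK 1)); apply/eqP/eqP => [/ffunP/(_ ord0)|->//].
  by rewrite !ffunE.
rewrite on_wires1_cket !mxE !e !idx1 !ffunE /= mulr0n mulr1n omegaE.
have -> : polar (1 : R) 0 = 1 by rewrite /polar cos0 sin0 mulr1 mulr0.
by rewrite !mul0r !mul1r add0r addr0.
Qed.

Lemma tgate_diag N (i j : 'I_N) u w : i != j ->
  on_wires (fun=> i) (tgate R) *m cket j u w =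
  (if w i then omega R else 1) *: cket j u w.
Proof.
move=> ij.
have T v : on_wires (fun=> i) (tgate R) *m ket v = (if v i then omega R else 1) *: ket v.
  rewrite {1}(ket_cket i v) tgate_cket [in RHS](ket_cket i v).
  case: (v i); rewrite /cket /eket /=;
    rewrite ?mulr0 ?mulr1 !scale0r ?scale1r ?add0r ?addr0 //.
by rewrite mulmx_cket !T !upd_other // [in RHS]/cket scalerDr !scalerA ![_ * u.1]mulrC
  ![_ * u.2]mulrC.
Qed.

End Kets.

(** * Circuits for words, negation and Toffoli *)

Section Circuits.
Variable R : realType.
Variables (n t N : nat).
Variables (f : 'I_(2 ^ n) -> 'I_(2 ^ n)) (enc : polar_code n t).
Local Notation C := R[i].
Local Notation cmx := (circuit_mx R f enc).
Notation circ := (circuit n t N).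

Lemma circuit_mx_cat (c1 c2 : circ) : cmx (c1 ++ c2) = cmx c2 *m cmx c1.
Proof.
elim: c1 => [|g c1 IH] /=; first by rewrite mulmx1.
by rewrite IH mulmxA.
Qed.

Lemma circuit_mx1 (g : gate n t N) : cmx [:: g] = gate_mx R f enc g.
Proof. by rewrite /= mul1mx. Qed.

Definition letter_circuit (i : 'I_N) (l : letter) : circ :=
  match l with
  | LH => [:: GateH n t i]
  | LT => [:: GateT n t i]
  | LD => nseq 7 (GateT n t i)
  end.

Lemma omega_sqr : (forall z, omega R * (omega R * z) = Complex 0 1 * z) /\
  (forall z, omegaV R * (omegaV R * z) = Complex 0 (-1) * z).
Proof.
split=> z; rewrite mulrA; congr (_ * _); apply/eqP; rewrite eq_complex /=;
  apply/andP; split; apply/eqP; by rewrite [RHS]mul_ss2; ring.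
Qed.

Lemma omega7 (z : C) : iter 7 ( *%R (omega R)) z = omegaV R * z.
Proof.
have [e _] := omega_sqr; rewrite /= !e.
case: z => x y; apply/eqP; rewrite eq_complex /=; apply/andP; split; apply/eqP; ring.
Qed.

Lemma letter_cket (i : 'I_N) l u w :
  cmx (letter_circuit i l) *m cket i u w = cket i (act1 l u) w.
Proof.
case: l; rewrite /letter_circuit.
- by rewrite circuit_mx1 hadamard_cket.
- by rewrite circuit_mx1 tgate_cket.
have H m : cmx (nseq m (GateT n t i)) *m cket i u w =
    cket i (u.1, iter m ( *%R (omega R)) u.2) w.
  elim: m => [|m IH]; first by rewrite mul1mx; case: (u).
  have -> : nseq m.+1 (GateT n t i) = nseq m (GateT n t i) ++ [:: GateT n t i].
    by rewrite cats1 -(addn1 m) nseqD cats1.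
  by rewrite circuit_mx_cat circuit_mx1 -mulmxA IH tgate_cket.
by rewrite H omega7.
Qed.

Definition word_circuit (i : 'I_N) (w : seq letter) : circ :=
  flatten (map (letter_circuit i) w).

Lemma word_cket (i : 'I_N) l u w :
  cmx (word_circuit i l) *m cket i u w = cket i (act l u) w.
Proof.
elim: l u => [|a l IH] u; first by rewrite mul1mx.
by rewrite /word_circuit /= circuit_mx_cat -mulmxA letter_cket IH.
Qed.

(** The gate carries a proof that its wires differ. Returning the empty circuit otherwise makes this
    a total function of the wires, so circuits can be assembled before distinctness is proved. *)
Definition cnot_circuit (i j : 'I_N) : circ :=
  if @idP (i != j) is ReflectT h then [:: GateCNOT n t h] else [::].

Lemma cnot_circuitE i j (ij : i != j) : cnot_circuit i j = [:: GateCNOT n t ij].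
Proof.
have H b (r : reflect (i != j) b) :
    (if r is ReflectT h then [:: GateCNOT n t h] else [::]) = [:: GateCNOT n t ij].
  by case: r => [h|//]; rewrite (bool_irrelevance h ij).
exact: H.
Qed.

Definition realizes (c : circ) (g : word N -> word N) :=
  forall w, cmx c *m ket R w = ket R (g w).

Lemma realizes_nil : realizes [::] id.
Proof. by move=> w; rewrite mul1mx. Qed.

Lemma realizes_cat c1 c2 g1 g2 :
  realizes c1 g1 -> realizes c2 g2 -> realizes (c1 ++ c2) (g2 \o g1).
Proof. by move=> h1 h2 w; rewrite circuit_mx_cat -mulmxA h1 h2. Qed.

Lemma realizes_cket c g i u w : realizes c g ->
  (forall w b, g (upd w i b) = upd (g w) i b) ->
  cmx c *m cket i u w = cket i u (g w).
Proof. by move=> h hg; rewrite mulmx_cket !h !hg. Qed.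

Definition flip (w : word N) (i : 'I_N) (b : bool) := upd w i (w i (+) b).

Lemma cnot_inj i j : i != j ->
  injective (fun k : 'I_2 => if k == ord0 then i else j : 'I_N).
Proof.
move=> ij [[|[|//]] p] [[|[|//]] q] //= e; apply: val_inj => //=.
  by rewrite e eqxx in ij.
by rewrite e eqxx in ij.
Qed.

Lemma cnot_realizes i j : i != j ->
  realizes (cnot_circuit i j) (fun w => flip w j (w i)).
Proof.
move=> ij w; rewrite cnot_circuitE circuit_mx1 on_wires_basis //; last exact: cnot_inj.
congr ket; apply/eqP; rewrite eq_sym eq_place //; last exact: cnot_inj.
apply/andP; split.
  apply/eqP/ffunP => -[[|[|[]]] p] //=; rewrite !ffunE /=.
    by rewrite (negbTE ij) addbF.
  by rewrite eqxx.
apply/forallP => z; apply/implyP => hz; rewrite /flip upd_other //.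
by apply/eqP => zj; case/negP: hz; rewrite zj; apply/codomP; exists ord_max.
Qed.

Definition swap (b : bool) (u : C * C) := if b then (u.2, u.1) else u.

Lemma cnot_cket i j u w : i != j ->
  cmx (cnot_circuit i j) *m cket j u w = cket j (swap (w i) u) w.
Proof.
move=> ij; rewrite mulmx_cket !(cnot_realizes ij) /flip !upd_same !upd_upd.
rewrite !upd_other // /cket; case: (w i); last by [].
by rewrite addrC.
Qed.

Definition not_circuit (i : 'I_N) := word_circuit i (LH :: nseq 4 LT ++ [:: LH]).

(** The standard decomposition with seven T and T^-1 gates. If both controls are 1, the part on [k]
    applies [-i X]. The final blocks on [i] and [j], with control bits [a] and [b], contribute the
    phase [omega^(a + b - (a xor b)) = i^(a b)], which removes the [-i]. *)
Definition toffoli_circuit (i j k : 'I_N) : circ :=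
  word_circuit k [:: LH] ++ cnot_circuit j k ++ word_circuit k [:: LD] ++
  cnot_circuit i k ++ word_circuit k [:: LT] ++
  cnot_circuit j k ++ word_circuit k [:: LD] ++
  cnot_circuit i k ++ word_circuit k [:: LT; LH] ++
  word_circuit i [:: LT] ++ word_circuit j [:: LT] ++
  cnot_circuit i j ++ word_circuit j [:: LD] ++ cnot_circuit i j.


Lemma cketZ k p (u : C * C) (w : word N) : p *: cket k u w = cket k (p * u.1, p * u.2) w.
Proof. by rewrite /cket scalerDr !scalerA. Qed.

Lemma letterT_diag i j u w : i != j ->
  cmx (word_circuit i [:: LT]) *m cket j u w =
  (if w i then omega R else 1) *: cket j u w.
Proof. by move=> ij; rewrite circuit_mx1 tgate_diag. Qed.

Lemma omegaVK : omegaV R * omega R = 1.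
Proof.
apply/eqP; rewrite eq_complex /=; apply/andP; split; apply/eqP; last by ring.
by rewrite -[RHS](ss2 R); ring.
Qed.

Lemma letterD_diag i j u w : i != j ->
  cmx (word_circuit i [:: LD]) *m cket j u w =
  (if w i then omegaV R else 1) *: cket j u w.
Proof.
move=> ij.
have D v : cmx (word_circuit i [:: LD]) *m ket R v =
  (if v i then omegaV R else 1) *: ket R v.
  rewrite {1}(ket_cket R i v) word_cket [in RHS](ket_cket R i v).
  case: (v i); rewrite /cket /eket /=;
    rewrite ?mulr0 ?mulr1 !scale0r ?scale1r ?add0r ?addr0 //.
by rewrite mulmx_cket !D !upd_other // [in RHS]/cket scalerDr !scalerA ![_ * u.1]mulrC
  ![_ * u.2]mulrC.
Qed.

Lemma not_realizes i : realizes (not_circuit i) (fun w => flip w i true).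
Proof.
move=> w; rewrite {1}(ket_cket R i) word_cket act_HT4H.
rewrite (ket_cket R i (flip _ _ _)) /flip upd_same cket_upd.
by case: (w i).
Qed.

Lemma toffoli_realizes i j k : i != j -> i != k -> j != k ->
  realizes (toffoli_circuit i j k) (fun w => flip w k (w i && w j)).
Proof.
move=> ij ik jk w.
rewrite {1}(ket_cket R k) /toffoli_circuit.
do 9 rewrite [in LHS]circuit_mx_cat -[in LHS]mulmxA ?word_cket ?cnot_cket //.
set u := act _ _.
do 2 rewrite [in LHS]circuit_mx_cat -[in LHS]mulmxA letterT_diag // -?scalemxAr.
have cn v z : cmx (cnot_circuit i j) *m cket k v z = cket k v (flip z j (z i)).
  apply: (realizes_cket (g := fun w => flip w j (w i))); first exact: cnot_realizes.
  by move=> z' b; rewrite /flip !upd_other // upd_swap // eq_sym.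
rewrite [in LHS]circuit_mx_cat -[in LHS]mulmxA cn.
rewrite [in LHS]circuit_mx_cat -[in LHS]mulmxA letterD_diag // -scalemxAr cn.
have -> : flip (flip w j (w i)) j (flip w j (w i) i) = w.
  by rewrite /flip upd_same (upd_other _ _ ij) upd_upd -addbA addbb addbF upd_id.
rewrite [flip w j (w i) j]upd_same !cketZ.
rewrite [RHS](ket_cket R k) /flip upd_same cket_upd; congr cket.
have [oo vv] := omega_sqr; rewrite {}/u.
have ov z : omega R * (omegaV R * z) = z by rewrite mulrA [omega R * _]mulrC omegaVK mul1r.
have vo z : omegaV R * (omega R * z) = z by rewrite mulrA omegaVK mul1r.
case: (w i) (w j) (w k) => -[] [];
  rewrite /act /eket /=; rewrite ?(oo, vv, ov, vo, mul1r);
  congr pair; apply/eqP; rewrite eq_complex /=; apply/andP; split; apply/eqP;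
  by rewrite [RHS]mul_ss2; ring.
Qed.

End Circuits.

(** * Circuits for programs and controlled rotations *)

Arguments cnot_circuit : simpl never.
Arguments word_circuit : simpl never.
Arguments not_circuit : simpl never.
Arguments toffoli_circuit : simpl never.

Section Compilation.
Variable R : realType.
Variables (n t N : nat).
Variables (f : 'I_(2 ^ n) -> 'I_(2 ^ n)) (enc : polar_code n t).
Local Notation C := R[i].
Local Notation cmx := (circuit_mx R f enc).
Local Notation circ := (circuit n t N).
Local Notation realizes := (realizes R f enc).

Section Program.
Variables (m S : nat) (inw : 'I_m -> 'I_N) (mw : nat -> 'I_N).
Hypothesis mw_inj : forall i j, (i < S)%N -> (j < S)%N -> mw i = mw j -> i = j.
Hypothesis inw_mw : forall j i, (i < S)%N -> inw j != mw i.

(** Operands not below [k] read as false and produce no gate. Toffoli needs distinct controls, so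
    the conjunction of a bit with itself is a CNOT. *)
Definition instr_circuit (k : nat) (o : instr m) : circ :=
  match o with
  | Input j => cnot_circuit n t (inw j) (mw k)
  | One => not_circuit n t (mw k)
  | Xor a b => (if (a < k)%N then cnot_circuit n t (mw a) (mw k) else [::]) ++
               (if (b < k)%N then cnot_circuit n t (mw b) (mw k) else [::])
  | And a b => if (a < k)%N && (b < k)%N then
                 if a == b then cnot_circuit n t (mw a) (mw k)
                 else toffoli_circuit n t (mw a) (mw b) (mw k)
               else [::]
  end.

Definition memory (k : nat) (w : word N) := [seq w (mw i) | i <- iota 0 k].

Definition instr_action (k : nat) (o : instr m) (w : word N) :=
  flip w (mw k) (instr_val (fun j => w (inw j)) (memory k w) o).

Lemma nth_memory k w a : nth false (memory k w) a = (a < k)%N && w (mw a).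
Proof.
have [ak|ka] := ltnP a k; last by rewrite nth_default // size_map size_iota.
by rewrite (nth_map 0%N) ?size_iota // nth_iota.
Qed.

Lemma flip0 (w : word N) i : flip w i false = w.
Proof. by rewrite /flip addbF upd_id. Qed.

Lemma flip_flip (w : word N) i b b' : flip (flip w i b) i b' = flip w i (b (+) b').
Proof. by rewrite /flip upd_same upd_upd addbA. Qed.

Lemma mw_neq a k : (a < k)%N -> (k < S)%N -> mw a != mw k.
Proof.
move=> ak kS; apply/eqP => /mw_inj e.
by have := e (ltn_trans ak kS) kS => ae; rewrite ae ltnn in ak.
Qed.

Lemma instr_realizes k o : (k < S)%N -> realizes (instr_circuit k o) (instr_action k o).
Proof.
move=> kS w; case: o => [j||a b|a b]; rewrite /instr_action /= ?nth_memory.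
- by rewrite cnot_realizes ?inw_mw.
- exact: (not_realizes R f enc (mw k) w).
- have X a' : realizes (if (a' < k)%N then cnot_circuit n t (mw a') (mw k) else [::])
      (fun w => flip w (mw k) ((a' < k)%N && w (mw a'))).
    case: ltnP => ak; first by apply: cnot_realizes; apply: mw_neq.
    by move=> v; rewrite /= mul1mx flip0.
  rewrite (realizes_cat (X a) (X b)) /= flip_flip; congr (ket _ (flip _ _ (_ (+) _))).
  case: ltnP => //= bk; by rewrite upd_other ?mw_neq.
case: ltnP => ak /=; last by rewrite mul1mx flip0.
case: ltnP => bk /=; last by rewrite mul1mx andbF flip0.
case: (eqVneq a b) => [->|ab]; first by rewrite cnot_realizes ?mw_neq // andbb.
have mab : mw a != mw b.
  apply/eqP => /mw_inj e; case/negP: ab; apply/eqP; apply: e; exact: (ltn_trans _ kS).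
by rewrite toffoli_realizes ?mab ?(mw_neq ak) ?(mw_neq bk).
Qed.

(** An instruction never reads the bit it flips. Hence uncomputation consists of the same circuits
    in reverse order. *)
Lemma instr_actionK k o : (k < S)%N -> involutive (instr_action k o).
Proof.
move=> kS w; rewrite {1}/instr_action.
have -> : instr_val (fun j => instr_action k o w (inw j)) (memory k (instr_action k o
  w)) o =
    instr_val (fun j => w (inw j)) (memory k w) o.
  have e : memory k (instr_action k o w) = memory k w.
    apply: (@eq_from_nth _ false); rewrite !size_map //= => a.
    rewrite size_iota => ak; rewrite !nth_memory ak /=.
    by rewrite /instr_action upd_other ?mw_neq.
  by rewrite e; case: o e => //= j _; rewrite upd_other ?inw_mw.
by rewrite /instr_action flip_flip addbb flip0.
Qed.

Fixpoint program_circuit k (P : seq (instr m)) : circ :=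
  if P is o :: P' then instr_circuit k o ++ program_circuit k.+1 P' else [::].

Fixpoint program_uncompute k (P : seq (instr m)) : circ :=
  if P is o :: P' then program_uncompute k.+1 P' ++ instr_circuit k o else [::].

Fixpoint program_action k (P : seq (instr m)) (w : word N) :=
  if P is o :: P' then program_action k.+1 P' (instr_action k o w) else w.

Fixpoint program_inverse k (P : seq (instr m)) (w : word N) :=
  if P is o :: P' then instr_action k o (program_inverse k.+1 P' w) else w.

Lemma program_realizes k P : (k + size P <= S)%N ->
  realizes (program_circuit k P) (program_action k P).
Proof.
elim: P k => [|o P IH] k /= h; first exact: realizes_nil.
apply: (realizes_cat (g1 := instr_action k o)); first by apply: instr_realizes; lia.
by apply: IH; lia.
Qed.

Lemma uncompute_realizes k P : (k + size P <= S)%N ->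
  realizes (program_uncompute k P) (program_inverse k P).
Proof.
elim: P k => [|o P IH] k /= h; first exact: realizes_nil.
apply: (realizes_cat (g1 := program_inverse k.+1 P)); first by apply: IH; lia.
by apply: instr_realizes; lia.
Qed.

Lemma program_actionK k P : (k + size P <= S)%N ->
  cancel (program_action k P) (program_inverse k P).
Proof.
elim: P k => [//|o P IH] k /= h w.
by rewrite IH ?instr_actionK //; lia.
Qed.

(** This lets the program run while wire [c] is in superposition: the program neither reads nor
    writes it. *)
Lemma program_action_upd k P c b w : (k + size P <= S)%N ->
  (forall j, c != inw j) -> (forall i, (i < S)%N -> c != mw i) ->
  program_action k P (upd w c b) = upd (program_action k P w) c b.
Proof.
move=> h cin cmw; elim: P k w h => [//|o P IH] k w /= h.
rewrite -IH; last by lia.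
congr program_action; rewrite /instr_action /flip upd_swap ?cmw //; last by lia.
rewrite upd_other; last by rewrite eq_sym cmw //; lia.
congr (upd (upd _ _ (_ (+) _)) _ _).
have -> : memory k (upd w c b) = memory k w.
  apply: (@eq_from_nth _ false); rewrite !size_map //= => a.
  rewrite size_iota => ak; rewrite !nth_memory ak /= upd_other // eq_sym cmw //; lia.
by case: o {h} => //= j; rewrite upd_other // eq_sym.
Qed.

Lemma program_inverse_upd k P c b w : (k + size P <= S)%N ->
  (forall j, c != inw j) -> (forall i, (i < S)%N -> c != mw i) ->
  program_inverse k P (upd w c b) = upd (program_inverse k P w) c b.
Proof.
move=> h cin cmw; elim: P k w h => [//|o P IH] k w /= h.
rewrite IH; last by lia.
move: (program_inverse _ _ _) => v.
rewrite /instr_action /flip upd_swap ?cmw //; last by lia.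
rewrite upd_other; last by rewrite eq_sym cmw //; lia.
congr (upd (upd _ _ (_ (+) _)) _ _).
have -> : memory k (upd v c b) = memory k v.
  apply: (@eq_from_nth _ false); rewrite !size_map //= => a.
  rewrite size_iota => ak; rewrite !nth_memory ak /= upd_other // eq_sym cmw //; lia.
by case: o {h} => //= j; rewrite upd_other // eq_sym.
Qed.

(** Generalized over the part [P0] already run; wires not yet written hold false, so flipping them
    stores the computed bit. *)
Lemma program_actionE k P0 P w : (k + size P <= S)%N -> size P0 = k ->
  memory k w = run P0 (fun j => w (inw j)) ->
  (forall i, (i < S)%N -> (k <= i)%N -> w (mw i) = false) ->
  memory (k + size P) (program_action k P w) = run (P0 ++ P) (fun j => w (inw j)) /\
  (forall z, (forall i, (i < S)%N -> z != mw i) -> program_action k P w z = w z).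
Proof.
elim: P k P0 w => [|o P IH] k P0 w /= h sP0 mem zero.
  by rewrite addn0 cats0.
have kS : (k < S)%N by lia.
set w' := instr_action k o w.
have inE j : w' (inw j) = w (inw j) by rewrite /w' /instr_action upd_other ?inw_mw.
have inE' : (fun j => w' (inw j)) = (fun j => w (inw j)) by apply/funext.
have [||||h1 h2] := IH k.+1 (rcons P0 o) w'.
- lia.
- by rewrite size_rcons sP0.
- rewrite inE' run_rcons -mem /memory -addn1 iotaD map_cat /= cats1 add0n.
  congr rcons.
    apply: (@eq_from_nth _ false); rewrite !size_map //= => a.
    rewrite size_iota => ak; rewrite !nth_memory ak /=.
    by rewrite /w' /instr_action upd_other ?mw_neq.
  by rewrite /w' /instr_action /flip upd_same zero.
- move=> i iS ki; rewrite /w' /instr_action upd_other ?zero //; first by lia.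
  by apply/eqP => /mw_inj e; have := e iS kS; lia.
split; first by rewrite addnS -addSn h1 inE' cat_rcons.
move=> z hz; rewrite h2 // /w' /instr_action upd_other //; exact: hz.
Qed.

End Program.

Definition noquery (c : circ) := all (predC (@is_query n t N)) c.

Lemma noquery_cat c1 c2 : noquery (c1 ++ c2) = noquery c1 && noquery c2.
Proof. exact: all_cat. Qed.

Lemma noquery_word i w : noquery (word_circuit n t i w).
Proof.
elim: w => [//|l w IH].
rewrite -[word_circuit _ _ _ _]/(letter_circuit n t i l ++ word_circuit n t i w).
by rewrite noquery_cat IH andbT; case: l.
Qed.

Lemma noquery_cnot i j : noquery (cnot_circuit n t i j).
Proof.
have H b (r : reflect (i != j) b) :
    noquery (if r is ReflectT h then [:: GateCNOT n t h] else [::]) by case: r.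
exact: H.
Qed.

Lemma size_cnot i j : (size (cnot_circuit n t i j : circ) <= 1)%N.
Proof.
have H b (r : reflect (i != j) b) :
    (size (if r is ReflectT h then [:: GateCNOT n t h] else [::]) <= 1)%N by case: r.
exact: H.
Qed.

Lemma size_word i w : (size (word_circuit n t i w : circ) <= 7 * size w)%N.
Proof.
elim: w => [//|l w IH]; rewrite /word_circuit /= size_cat mulnS leq_add //.
by case: l.
Qed.

Lemma noquery_instr m (inw : 'I_m -> 'I_N) mw k o : noquery (instr_circuit inw mw k o).
Proof.
case: o => [j||a b|a b]; rewrite /instr_circuit.
- exact: noquery_cnot.
- exact: noquery_word.
- by rewrite noquery_cat; do 2 case: ifP; rewrite ?noquery_cnot.
case: ifP => // _; case: ifP => _; first exact: noquery_cnot.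
by rewrite /toffoli_circuit !(noquery_word, noquery_cnot, noquery_cat).
Qed.

Lemma size_instr m (inw : 'I_m -> 'I_N) mw k o :
  (size (instr_circuit inw mw k o) <= 100)%N.
Proof.
have hc i j := size_cnot i j; have hw i w := size_word i w.
case: o => [j||a b|a b]; rewrite /instr_circuit.
- exact: leq_trans (hc _ _) _.
- exact: leq_trans (hw _ _) _.
- rewrite size_cat; have := hc (mw a) (mw k); have := hc (mw b) (mw k).
  by do 2 case: ifP => _ /=; lia.
case: ifP => // _; case: ifP => _; first exact: leq_trans (hc _ _) _.
have sc (c1 c2 : circ) a' b' : (size c1 <= a')%N -> (size c2 <= b')%N ->
    (size (c1 ++ c2) <= a' + b')%N by rewrite size_cat; apply: leq_add.
apply: leq_trans (sc _ _ _ _ (hw _ _) (sc _ _ _ _ (hc _ _) (sc _ _ _ _ (hw _ _)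
  (sc _ _ _ _ (hc _ _) (sc _ _ _ _ (hw _ _) (sc _ _ _ _ (hc _ _) (sc _ _ _ _ (hw _ _)
  (sc _ _ _ _ (hc _ _) (sc _ _ _ _ (hw _ _) (sc _ _ _ _ (hw _ _) (sc _ _ _ _ (hw _ _)
  (sc _ _ _ _ (hc _ _) (sc _ _ _ _ (hw _ _) (hc _ _)))))))))))))) _.
by [].
Qed.

Lemma noquery_program m (inw : 'I_m -> 'I_N) mw k P :
  noquery (program_circuit inw mw k P) /\ noquery (program_uncompute inw mw k P).
Proof.
elim: P k => [//|o P IH] k /=; have [h1 h2] := IH k.+1.
by rewrite !noquery_cat h1 h2 !noquery_instr.
Qed.

Lemma size_program m (inw : 'I_m -> 'I_N) mw k P :
  (size (program_circuit inw mw k P) <= 100 * size P)%N /\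
  (size (program_uncompute inw mw k P) <= 100 * size P)%N.
Proof.
elim: P k => [//|o P IH] k /=; have [h1 h2] := IH k.+1.
by rewrite !size_cat mulnS [(_ + size (instr_circuit _ _ _ _))%N]addnC !leq_add ?size_instr.
Qed.

(* If V represents q, the circuit acts as the identity for control 0 and as
   q * qchi q^-1 for control 1: the half-angle V is undone, or doubled. *)
Definition rotation_circuit (c j : 'I_N) (V : seq letter) : circ :=
  cnot_circuit n t j c ++ word_circuit n t c (winv V) ++
  cnot_circuit n t j c ++ word_circuit n t c V.

(** Conjugation by the negation X, which is the unit [k] up to a scalar. *)
Definition qchi (q : quat R) := Quat (qr q) (- qi q) (- qj q) (qk q).

Lemma swap_qact q u : swap true (qact q (swap true u)) = qact (qchi q) u.
Proof.
case: q u => a b c d [[x0 y0] [x1 y1]]; rewrite /qact /=.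
by congr pair; apply/eqP; rewrite eq_complex /=; apply/andP; split; apply/eqP; ring.
Qed.

Definition represents_quat (V : seq letter) (q : quat R) :=
  (forall u, act V u = qact q u) /\ qnorm q = 1.

Lemma represents_winv V q : represents_quat V q -> represents_quat (winv V) (qconj q).
Proof.
move=> [h q1]; split; last by rewrite qnorm_conj.
by move=> u; rewrite -{1}[u]qact1 -(qmulVr q1) qactM -h act_winvl.
Qed.

Lemma rotation_cket c j V q u w : j != c -> represents_quat V q ->
  cmx (rotation_circuit c j V) *m cket c u w =
  cket c (qact (if w j then q * qchi (qconj q) else 1) u) w.
Proof.
move=> jc hV; have [hi _] := represents_winv hV; have [h q1] := hV.
rewrite /rotation_circuit !circuit_mx_cat -!mulmxA cnot_cket // word_cket cnot_cket //
  word_cket.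
congr cket; rewrite h hi; case: (w j); first by rewrite swap_qact -qactM.
by rewrite /swap -qactM qmulVr.
Qed.

Definition rotations (c : 'I_N) (L : seq ('I_N * seq letter)) : circ :=
  flatten [seq rotation_circuit c x.1 x.2 | x <- L].

Lemma rotations_cat c L1 L2 : rotations c (L1 ++ L2) = rotations c L1 ++ rotations c L2.
Proof. by rewrite /rotations map_cat flatten_cat. Qed.

Lemma noquery_rotations c L : noquery (rotations c L).
Proof.
elim: L => [//|x L IH]; rewrite /rotations /= noquery_cat IH andbT.
by rewrite /rotation_circuit !(noquery_word, noquery_cnot, noquery_cat).
Qed.

Lemma size_rotations c L k : (forall x, x \in [seq size y.2 | y <- L] -> (x <= k)%N) ->
  (size (rotations c L) <= size L * (14 * k + 2))%N.
Proof.
elim: L => [//|x L IH] h; rewrite /rotations /= size_cat mulSn leq_add //; last first.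
  by apply: IH => y hy; apply: h; rewrite in_cons hy orbT.
have xk : (size x.2 <= k)%N by apply: h; rewrite mem_head.
rewrite /rotation_circuit !size_cat.
have := size_cnot x.1 c; have := size_word c x.2; have := size_word c (winv x.2).
rewrite size_rev size_map; lia.
Qed.

End Compilation.

(** * Products of controlled rotations and their errors *)

Section RotationProducts.
Variable R : realType.
Local Notation C := R[i].
Variables (n t N : nat).
Variables (f : 'I_(2 ^ n) -> 'I_(2 ^ n)) (enc : polar_code n t).

(** This is [q * q] when the last component of [q] vanishes, as it does for [qrotz] and [qroty]. The
    approximating words need not have this property, so the exact action of the circuit is kept. *)
Definition doubled (q : quat R) := q * qchi (qconj q).

(** The head of the list is the rightmost factor, because it is applied first. *)
Definition rotation_product (I : Type) (b : I -> bool) (q : I ->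
  quat R) (s : seq I) : quat R :=
  foldr (fun i p => p * (if b i then doubled (q i) else 1)) 1 s.

Lemma rotations_cket (I : Type) c (g : I -> 'I_N) (V : I -> seq letter) (q : I ->
  quat R) (s : seq I) u w :
  (forall i, g i != c) -> (forall i, represents_quat (V i) (q i)) ->
  circuit_mx R f enc (rotations n t c [seq (g i, V i) | i <- s]) *m cket c u w =
  cket c (qact (rotation_product (fun i => w (g i)) q s) u) w.
Proof.
move=> gc hV; elim: s u => [|i s IH] u; first by rewrite mul1mx qact1.
rewrite /rotations /= circuit_mx_cat -mulmxA (rotation_cket _ _ _ _ (gc i) (hV i)).
by rewrite -/(rotations n t c _) IH qactM.
Qed.

Lemma qchi_norm q : qnorm (qchi q) = qnorm q :> R.
Proof. by rewrite /qnorm /qnorm2 /= !sqrrN. Qed.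

Lemma doubled_norm q : qnorm q = 1 -> qnorm (doubled q) = 1.
Proof. by move=> h; rewrite qnormM qchi_norm qnorm_conj h mulr1. Qed.

Lemma qdistM (p q p' q' : quat R) : qnorm p = 1 -> qnorm q' = 1 ->
  qnorm (p * q - p' * q') <= qnorm (p - p') + qnorm (q - q').
Proof.
move=> p1 q1; have -> : p * q - p' * q' = (p - p') * q' + p * (q - q').
  by rewrite mulrBl mulrBr [RHS]addrC addrA subrK.
by apply: le_trans (qnormD _ _) _; rewrite !qnormM p1 q1 mulr1 mul1r.
Qed.

Lemma doubled_dist (q q' : quat R) : qnorm q = 1 -> qnorm q' = 1 ->
  qnorm (doubled q - doubled q') <= 2 * qnorm (q - q').
Proof.
move=> h h'; apply: le_trans (qdistM _ _ _ _) _; rewrite ?qchi_norm ?qnorm_conj //.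
have -> : qchi (qconj q) - qchi (qconj q') = qchi (qconj (q - q')).
  by rewrite !quatE /qchi /qconj /=; congr Quat; ring.
by rewrite qchi_norm qnorm_conj; lra.
Qed.

Lemma rotation_product_norm (I : Type) b (q : I -> quat R) s :
  (forall i, qnorm (q i) = 1) -> qnorm (rotation_product b q s) = 1.
Proof.
move=> h; elim: s => [|i s IH] /=; first exact: qnorm1.
by rewrite qnormM IH; case: (b i); rewrite ?doubled_norm ?qnorm1 ?mulr1.
Qed.

Lemma rotation_product_dist (I : Type) b (q q' : I -> quat R) s e : 0 <= e ->
  (forall i, qnorm (q i) = 1) -> (forall i, qnorm (q' i) = 1) ->
  (forall i, qnorm (q i - q' i) <= e) ->
  qnorm (rotation_product b q s - rotation_product b q' s) <= (size s)%:R * (2 * e).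
Proof.
move=> e0 h h' d; elim: s => [|i s IH] /=.
  by rewrite subrr /qnorm /qnorm2 /= expr0n /= !addr0 sqrtr0 mul0r.
apply: le_trans (qdistM _ _ _ _) _; first exact: rotation_product_norm.
  by case: (b i); rewrite ?doubled_norm ?qnorm1.
rewrite -natr1 mulrDl mul1r lerD //; case: (b i).
  by apply: le_trans (doubled_dist _ _) _; rewrite ?ler_pM2l.
by rewrite subrr /qnorm /qnorm2 /= expr0n /= !addr0 sqrtr0 mulr_ge0.
Qed.

(** As matrices, [diag (e^(ia), e^(-ia))] and, for [qroty], a real rotation of the amplitude pair;
    the angles are not halved. *)
Definition qrotz (a : R) := Quat (cos a) (sin a) 0 0.
Definition qroty (a : R) := Quat (cos a) 0 (sin a) 0.

Lemma qrotz_norm a : qnorm (qrotz a) = 1.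
Proof. by rewrite /qnorm /qnorm2 /= expr0n /= !addr0 cos2Dsin2 sqrtr1. Qed.
Lemma qroty_norm a : qnorm (qroty a) = 1.
Proof. by rewrite /qnorm /qnorm2 /= expr0n /= !addr0 cos2Dsin2 sqrtr1. Qed.

Lemma qrotzD a b : qrotz (a + b) = qrotz a * qrotz b.
Proof. by rewrite quatE /qmul /qrotz cosD sinD /=; congr Quat; ring. Qed.
Lemma qrotyD a b : qroty (a + b) = qroty a * qroty b.
Proof. by rewrite quatE /qmul /qroty cosD sinD /=; congr Quat; ring. Qed.

Lemma doubled_rotz a : doubled (qrotz a) = qrotz (a *+ 2).
Proof.
by rewrite mulr2n qrotzD /doubled; congr (_ * _);
  rewrite /qchi /qconj /= ?oppr0 ?opprK ?oppr0.
Qed.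
Lemma doubled_roty a : doubled (qroty a) = qroty (a *+ 2).
Proof.
by rewrite mulr2n qrotyD /doubled; congr (_ * _);
  rewrite /qchi /qconj /= ?oppr0 ?opprK ?oppr0.
Qed.

Lemma rotation_product_rotz (I : Type) b (a : I -> R) s :
  rotation_product b (fun i => qrotz (a i)) s =
  qrotz (\sum_(i <- s) (if b i then a i *+ 2 else 0)).
Proof.
elim: s => [|i s IH]; first by rewrite big_nil /qrotz cos0 sin0.
rewrite big_cons /= IH addrC qrotzD; congr (_ * _).
by case: (b i); [exact: doubled_rotz | rewrite /qrotz cos0 sin0].
Qed.
Lemma rotation_product_roty (I : Type) b (a : I -> R) s :
  rotation_product b (fun i => qroty (a i)) s =
  qroty (\sum_(i <- s) (if b i then a i *+ 2 else 0)).
Proof.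
elim: s => [|i s IH]; first by rewrite big_nil /qroty cos0 sin0.
rewrite big_cons /= IH addrC qrotyD; congr (_ * _).
by case: (b i); [exact: doubled_roty | rewrite /qroty cos0 sin0].
Qed.

Definition top_left (q : quat R) : C := Complex (qr q) (qi q).

Lemma top_left_dist p q : Normc.normc (top_left p - top_left q) <= qnorm (p - q).
Proof.
rewrite /top_left /= /qnorm ler_wsqrtr // /qnorm2 /= -addrA lerDl.
by rewrite addr_ge0 ?sqr_ge0.
Qed.

Lemma top_left_rot a b : top_left (qrotz a * qroty b) = polar (cos b) a.
Proof. by rewrite /top_left /polar /=; congr Complex; ring. Qed.

Lemma normc_polar r a : Normc.normc (polar r a) = `|r| :> R.
Proof.
rewrite /= !exprMn -mulrDr cos2Dsin2 mulr1; exact: sqrtr_sqr.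
Qed.

Lemma polarB r r' a : polar r a - polar r' a = polar (r - r') a :> C.
Proof. by rewrite /polar; apply/eqP; rewrite eq_complex /=; apply/andP; split;
  apply/eqP; ring. Qed.

Lemma polarV r a : r != 0 -> (polar r a)^-1 = polar r^-1 (- a) :> C.
Proof.
move=> r0; apply: (mulIf (x := polar r a)).
  by apply/eqP => /(congr1 (@Normc.normc _)); rewrite normc_polar Normc.normc0 => /eqP;
    rewrite normr_eq0 (negbTE r0).
rewrite mulVf; last first.
  by apply/eqP => /(congr1 (@Normc.normc _)); rewrite normc_polar Normc.normc0 => /eqP;
    rewrite normr_eq0 (negbTE r0).
rewrite /polar cosN sinN; apply/esym/eqP; rewrite eq_complex /=; apply/andP; split;
  apply/eqP.
  by rewrite -[RHS](cos2Dsin2 a); field.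
by field.
Qed.

End RotationProducts.

(** * Linear algebra of the block encoding *)

Section LinearAlgebra.
Variable R : realType.
Local Notation C := R[i].

Lemma embed_ket N k (a : 'I_k -> 'I_N) v : injective a ->
  embed R a *m ket R v = ket R (place a (wzero N) v).
Proof.
move=> ai; rewrite mulmx_ket; apply/matrixP => y z; rewrite !mxE eq_place // idxK.
congr ((nat_of_bool (_ && _))%:R).
  apply/forallP/eqP => [h|h i].
    by apply/ffunP => i; rewrite [LHS]ffunE; apply/eqP; apply: h.
  by rewrite -h [X in _ == X]ffunE.
by apply: eq_forallb => j; rewrite [wzero N j]ffunE eqbF_neg.
Qed.

Definition inner k (v w : 'cV[C]_k) : C := (v^t* *m w) ord0 ord0.

Lemma innerDl k (u v w : 'cV[C]_k) : inner (u + v) w = inner u w + inner v w.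
Proof.
rewrite /inner !mxE -big_split /=; apply: eq_bigr => i _.
by rewrite !mxE rmorphD mulrDl.
Qed.

Lemma innerDr k (u v w : 'cV[C]_k) : inner u (v + w) = inner u v + inner u w.
Proof.
rewrite /inner !mxE -big_split /=; apply: eq_bigr => i _.
by rewrite !mxE mulrDr.
Qed.

Lemma innerZl k a (u v : 'cV[C]_k) : inner (a *: u) v = Num.conj a * inner u v.
Proof.
rewrite /inner !mxE mulr_sumr; apply: eq_bigr => i _.
by rewrite !mxE rmorphM mulrA.
Qed.

Lemma innerZr k a (u v : 'cV[C]_k) : inner u (a *: v) = a * inner u v.
Proof.
rewrite /inner !mxE mulr_sumr; apply: eq_bigr => i _.
by rewrite !mxE mulrCA.
Qed.

Lemma inner_ket N (w w' : word N) : inner (ket R w) (ket R w') = (w == w')%:R.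
Proof.
rewrite /inner mulmx_ket !mxE idxK eq_sym.
by case: eqP => _; apply/eqP; rewrite eq_complex /= ?oppr0 !eqxx.
Qed.

Lemma inner_cket N (i : 'I_N) (u u' : C * C) w w' :
  inner (cket i u w) (cket i u' w') =
  (upd w i false == upd w' i false)%:R * (Num.conj u.1 * u'.1 + Num.conj u.2 * u'.2).
Proof.
have e b b' : (upd w i b == upd w' i b') = (b == b') && (upd w i false == upd w' i false).
  apply/eqP/andP => [h|[/eqP -> /eqP h]].
    have := congr1 (fun z : word N => z i) h; rewrite /= !upd_same => ->; split=> //.
    by rewrite -(upd_upd w i b) h upd_upd.
  by rewrite -(upd_upd w i false) h upd_upd.
rewrite /cket innerDl !innerDr !innerZl !innerZr !inner_ket.
rewrite (e false true) (e true false) (e true true) !eqxx.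
rewrite (_ : (false == true) = false) // (_ : (true == false) = false) // !andFb andTb.
rewrite !mulr0 addr0 add0r.
by case: (upd w i false == _); rewrite ?mulr1 ?mul1r // !mulr0 addr0 mul0r.
Qed.

Lemma qact_isometry q b b' : qnorm q = 1 ->
  Num.conj (qact q (eket R b)).1 * (qact q (eket R b')).1 +
  Num.conj (qact q (eket R b)).2 * (qact q (eket R b')).2 = (b == b')%:R.
Proof.
move=> /(congr1 (fun x => x ^+ 2)); rewrite sqr_qnorm expr1n /qnorm2.
case: q => a x y z /= h.
case: b; case: b'; apply/eqP; rewrite eq_complex /=; apply/andP; split; apply/eqP;
 by rewrite ?(mul0r, mulr0, mulr1, add0r, addr0, oppr0, subr0, sub0r); rewrite -?h; ring.
Qed.

(** Reindexing rows by the injective [g] turns the squared norm of the image into the sum of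
    [|d x|^2 |v x|^2]. *)
Lemma opnorm_sparse k (g : 'I_k -> 'I_k) (d : 'I_k -> C) (e : R) : injective g -> 0 <= e ->
  (forall x, Normc.normc (d x) <= e) ->
  opnorm (\matrix_(y, x) ((y == g x)%:R * d x)) <= e.
Proof.
move=> gi e0 de; apply: ge_sup.
  exists (l2norm (\matrix_(y, x) ((y == g x)%:R * d x) *m (0 : 'cV[C]_k))); exists 0 => //=.
  rewrite /l2norm big1 ?sqrtr0 ?ler01 // => i _.
  by rewrite mxE Normc.normc0 expr0n.
move=> _ [v v1 <-]; move: v1; rewrite /= /l2norm => v1.
set S := \sum_i _ in v1 *.
have S0 : 0 <= S by apply: sumr_ge0 => i _; rewrite sqr_ge0.
have S1 : S <= 1.
  by rewrite -[S]sqr_sqrtr // expr_le1 // sqrtr_ge0.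
rewrite -[leRHS]ger0_norm // -sqrtr_sqr ler_wsqrtr //.
apply: (@le_trans _ _ (\sum_i e ^+ 2 * Normc.normc (v i ord0) ^+ 2)); last first.
  by rewrite -mulr_sumr -/S ler_piMr // sqr_ge0.
rewrite (reindex_inj gi) /=; apply: ler_sum => x _.
rewrite mxE (bigD1 x) //= big1 => [|z zx]; last first.
  by rewrite mxE (inj_eq gi) eq_sym (negbTE zx) !mul0r.
rewrite mxE eqxx mul1r addr0 Normc.normcM exprMn ler_wpM2r ?sqr_ge0 //.
have n0 : 0 <= Normc.normc (d x) by case: (d x) => a b; rewrite /= sqrtr_ge0.
by rewrite lerXn2r ?nnegrE.
Qed.

Lemma invmx_sparse k (A : 'M[C]_k) (g : 'I_k -> 'I_k) :
  one_sparse A -> A \in unitmx -> (forall x, A x (g x) != 0) ->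
  invmx A = \matrix_(y, x) ((y == g x)%:R * (A x (g x))^-1).
Proof.
move=> [s1 s2] Au Ag; set B := \matrix_(y, x) _.
suff AB : A *m B = 1%:M by rewrite -[B]mul1mx -(mulVmx Au) -mulmxA AB mulmx1.
apply/matrixP => x z; rewrite !mxE (bigD1 (g z)) //= big1 => [|y yz]; last first.
  by rewrite mxE (negbTE yz) mul0r mulr0.
rewrite mxE eqxx mul1r addr0; case: eqVneq => [->|xz]; first by rewrite divff.
case: (eqVneq (A x (g z)) 0) => [->|h]; first by rewrite mul0r.
by case/eqP: xz; apply: s2 h (Ag z).
Qed.

(** [A (g x) x] is the conjugate of [A x (g x)], hence the only nonzero entry in row [g x]. *)
Lemma one_sparse_hermitian_involutive k (A : 'M[C]_k) (g : 'I_k -> 'I_k) :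
  one_sparse A -> A \is hermsymmx -> (forall x, A x (g x) != 0) -> involutive g.
Proof.
move=> [s1 _] /is_hermitianmxP; rewrite expr0 scale1r => Ah Ag x.
have h : A (g x) x != 0.
  by rewrite Ah !mxE conjC_eq0.
exact: s1 (Ag (g x)) h.
Qed.

End LinearAlgebra.

(** * The unitary realized by the circuit *)

Section BlockEncodingUnitary.
Variables (R : realType) (n : nat) (f : 'I_(2 ^ n) -> 'I_(2 ^ n)).
Variable Q : word n -> quat R.
Hypothesis f_inj : injective f.
Hypothesis Q1 : forall v, qnorm (Q v) = 1.
Local Notation C := R[i].

Definition sel_word (v : word (1 + n)) : word (1 + n) :=
  wcat (wleft v) (bits (f (idx (wright v)))).

Definition sel_col (v : word (1 + n)) : 'cV[C]_(2 ^ (1 + n)) :=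
  cket (lshift n ord0) (qact (Q (wright v)) (eket R (v (lshift n ord0)))) (sel_word v).

(** The operator taking [|b>|x>] to [(Q x |b>) |f x>], for arbitrary unit quaternions [Q x]. *)
Definition sel_mx : 'M[C]_(2 ^ (1 + n)) := \matrix_(y, x) sel_col (bits x) y ord0.

Lemma sel_mx_ket v : sel_mx *m ket R v = sel_col v.
Proof. by rewrite mulmx_ket; apply/matrixP => y z; rewrite (ord1 z) mxE mxE idxK. Qed.

Lemma wcatKl k l (u : word k) (v : word l) : wleft (wcat u v) = u.
Proof. by apply/ffunP => i; rewrite !ffunE (unsplitK (inl i)). Qed.
Lemma wcatKr k l (u : word k) (v : word l) : wright (wcat u v) = v.
Proof. by apply/ffunP => i; rewrite !ffunE (unsplitK (inr i)). Qed.
Lemma wcatE k l (w : word (k + l)) : wcat (wleft w) (wright w) = w.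
Proof.
by apply/ffunP => i; rewrite ffunE; case: splitP => j ij; rewrite ffunE; congr (w _);
  apply: val_inj.
Qed.
Lemma wcatl k l (u : word k) (v : word l) i : wcat u v (lshift l i) = u i.
Proof. by rewrite ffunE (unsplitK (inl i)). Qed.
Lemma wcatr k l (u : word k) (v : word l) i : wcat u v (rshift k i) = v i.
Proof. by rewrite ffunE (unsplitK (inr i)). Qed.

(** Columns with distinct right halves are orthogonal because [f] is injective; those with equal
    right halves come from the two orthonormal columns of one unit quaternion. *)
Lemma sel_mx_unitary : sel_mx \is unitarymx.
Proof.
apply/unitarymxP; apply: mulmx1C; apply: eq_on_kets => w.
rewrite mul1mx -mulmxA sel_mx_ket; apply/matrixP => y z; rewrite (ord1 z).
have -> : (sel_mx^t* *m sel_col w) y ord0 = inner (sel_col (bits y)) (sel_col w).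
  rewrite /inner !mxE; apply: eq_bigr => k _; congr (_ * _).
  by rewrite [LHS]mxE [RHS]mxE; congr Num.conj; rewrite [LHS]mxE [RHS]mxE [LHS]mxE.
rewrite inner_cket [in RHS]mxE.
case: (eqVneq (upd (sel_word (bits y)) (lshift n ord0) false)
              (upd (sel_word w) (lshift n ord0) false)) => [e|ne]; last first.
  rewrite mul0r; case: eqP => // e; by rewrite e eqxx in ne.
have er : wright (bits y) = wright w.
  apply: (can_inj (@idxK n)); apply: f_inj; apply: (can_inj (@bitsK n)).
  rewrite -[LHS](@wcatKr 1 _ (wleft (bits y))) -[RHS](@wcatKr 1 _ (wleft w)).
  apply/ffunP => i; have := congr1 (fun u : word (1 + n) => u (rshift 1 i)) e.
  by rewrite /= !upd_other // !ffunE.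
rewrite mul1r er qact_isometry //; congr ((nat_of_bool _)%:R).
apply/eqP/eqP => [h|->//].
rewrite -[bits y]wcatE -[w]wcatE er; congr wcat.
by apply/ffunP => i; rewrite [LHS]ffunE [RHS]ffunE (ord1 i) h.
Qed.

Lemma sel_mx_block : (embed R (@rshift 1 n))^t* *m sel_mx *m embed R (@rshift 1 n) =
  \matrix_(y, x) ((y == f x)%:R * top_left (Q (bits x))).
Proof.
apply: eq_on_kets => v; rewrite -!mulmxA embed_ket; last exact: rshift_inj.
have pl u : place (@rshift 1 n) (wzero (1 + n)) u = wcat (wzero 1) u.
  apply/esym/eqP; rewrite eq_place; last exact: rshift_inj.
  apply/andP; split; first by apply/eqP/ffunP => i; rewrite ffunE wcatr.
  apply/forallP => j; apply/implyP => hj.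
  case: (split_ordP j) hj => k -> hj; first by rewrite wcatl !ffunE.
  by rewrite codom_f in hj.
have adj w : (embed R (@rshift 1 n))^t* *m ket R w =
    (~~ w (lshift n ord0))%:R *: ket R (wright w).
  apply/matrixP => y z; rewrite mulmx_ket !mxE idxK.
  have -> : [forall j, (j \notin codom (@rshift 1 n)) ==> ~~ w j] = ~~ w (lshift n ord0).
    apply/forallP/idP => [/(_ (lshift n ord0))/implyP -> //|h j].
      by apply/codomP => -[k /(congr1 val)].
    apply/implyP; case: (split_ordP j) => k -> hj; first by rewrite (ord1 k).
    by rewrite codom_f in hj.
  have -> : [forall i, w (rshift 1 i) == bits y i] = (bits y == wright w).
    apply/forallP/eqP => [h|-> i]; last by rewrite [wright w i]ffunE.
    by apply/ffunP => i; rewrite [RHS]ffunE; apply/esym/eqP/h.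
  by case: (_ == _); case: (w _); apply/eqP;
    rewrite eq_complex /= ?(mul0r, mulr0, mul1r, oppr0, subr0, addr0) !eqxx.
rewrite pl sel_mx_ket /sel_col wcatKr wcatl ffunE /cket mulmxDr -!scalemxAr !adj !upd_same.
rewrite scale0r scaler0 addr0 scale1r mulmx_ket.
apply/matrixP => y z; rewrite !mxE idxK /top_left /= !mulr1 !mulr0 addr0 mulrC.
congr ((nat_of_bool _)%:R * _).
have -> : wright (upd (sel_word (wcat (wzero 1) v)) (lshift n ord0) false) =
  bits (f (idx v)).
  by apply/ffunP => i; rewrite [LHS]ffunE upd_other // wcatr wcatKr.
by rewrite (can_eq (@bitsK n)).
Qed.

End BlockEncodingUnitary.

(** * The circuit *)

Section Layout.
Variables (R : realType) (n t S : nat).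

(* The rotated qubit, two address registers, the (modulus, phase) register and
   the scratch bits of the classical computation. *)
Definition wire_type : finType := (unit + 'I_n + 'I_n + 'I_(t + t) + 'I_S.+1)%type.
Local Notation N := #|wire_type|.

Definition wire (z : wire_type) : 'I_N := enum_rank z.
Definition wc : 'I_N := wire (inl (inl (inl (inl tt)))).
Definition wx (j : 'I_n) : 'I_N := wire (inl (inl (inl (inr j)))).
Definition wy (j : 'I_n) : 'I_N := wire (inl (inl (inr j))).
Definition wm (j : 'I_(t + t)) : 'I_N := wire (inl (inr j)).
(** [inord] needs a nonempty ordinal type, hence [S.+1] scratch wires. *)
Definition ws (i : nat) : 'I_N := wire (inr (inord i)).

Lemma wire_inj : injective wire. Proof. exact: enum_rank_inj. Qed.

Lemma wireP (Pr : 'I_N -> Prop) : Pr wc -> (forall j, Pr (wx j)) -> (forall j, Pr (wy j)) ->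
  (forall j, Pr (wm j)) -> (forall i, (i < S.+1)%N -> Pr (ws i)) -> forall i, Pr i.
Proof.
move=> h1 h2 h3 h4 h5 i; rewrite -(enum_valK i).
case: (enum_val i) => [[[[[]|j]|j]|j]|j]; [exact: h1|exact: h2|exact: h3|exact: h4|].
by have := h5 j (ltn_ord j); rewrite /ws inord_val.
Qed.

Definition state (b : bool) (x y : word n) (m : word (t + t)) : word N :=
  [ffun i => match enum_val i with
             | inl (inl (inl (inl _))) => b
             | inl (inl (inl (inr j))) => x j
             | inl (inl (inr j)) => y j
             | inl (inr j) => m j
             | inr _ => false
             end].

Lemma state_c b x y m : state b x y m wc = b.
Proof. by rewrite ffunE enum_rankK. Qed.
Lemma state_x b x y m j : state b x y m (wx j) = x j.
Proof. by rewrite ffunE enum_rankK. Qed.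
Lemma state_y b x y m j : state b x y m (wy j) = y j.
Proof. by rewrite ffunE enum_rankK. Qed.
Lemma state_m b x y m j : state b x y m (wm j) = m j.
Proof. by rewrite ffunE enum_rankK. Qed.
Lemma state_s b x y m i : state b x y m (ws i) = false.
Proof. by rewrite ffunE enum_rankK. Qed.
Definition stateE := (state_c, state_x, state_y, state_m, state_s).

Lemma neq_wire z z' : (wire z == wire z') = (z == z').
Proof. exact: (inj_eq wire_inj). Qed.

Lemma upd_state b b' x y m : upd (state b x y m) wc b' = state b' x y m.
Proof.
apply/ffunP; apply: wireP => [|j|j|j|i _]; rewrite ?upd_same ?stateE //;
by rewrite upd_other ?stateE // neq_wire.
Qed.

Lemma ket_state b x y m : ket R (state b x y m) = cket wc (eket R b) (state false x y m).
Proof. by rewrite (ket_cket R wc) state_c /cket !upd_state. Qed.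

Definition copy_xy (i : 'I_(n + n)) : 'I_N :=
  match split i with inl j => wx j | inr j => wy j end.
Definition copy_yx (i : 'I_(n + n)) : 'I_N :=
  match split i with inl j => wy j | inr j => wx j end.
Definition copy_xym (i : 'I_(n + n + (t + t))) : 'I_N :=
  match split i with inl j => copy_xy j | inr j => wm j end.

Lemma wx_inj : injective wx. Proof. by move=> i j /wire_inj[]. Qed.
Lemma wy_inj : injective wy. Proof. by move=> i j /wire_inj[]. Qed.
Lemma wm_inj : injective wm. Proof. by move=> i j /wire_inj[]. Qed.
Lemma ws_inj i j : (i < S.+1)%N -> (j < S.+1)%N -> ws i = ws j -> i = j.
Proof. by move=> hi hj /wire_inj[] /(congr1 val); rewrite /= !inordK. Qed.

Lemma split_inj k l (T : eqType) (g : 'I_k -> T) (h : 'I_l -> T) :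
  injective g -> injective h -> (forall i j, g i != h j) ->
  injective (fun i : 'I_(k + l) => match split i with inl j => g j | inr j => h j end).
Proof.
move=> gi hi gh i j; rewrite -{2}(splitK i) -{2}(splitK j).
case: (split i) => i'; case: (split j) => j' e.
- by rewrite (gi _ _ e).
- by case/eqP: (gh i' j').
- by case/eqP: (gh j' i').
by rewrite (hi _ _ e).
Qed.

Lemma copy_xy_inj : injective copy_xy.
Proof. by apply: split_inj wx_inj wy_inj _ => i j; rewrite neq_wire. Qed.
Lemma copy_yx_inj : injective copy_yx.
Proof. by apply: split_inj wy_inj wx_inj _ => i j; rewrite neq_wire. Qed.
Lemma copy_xym_inj : injective copy_xym.
Proof.
apply: split_inj copy_xy_inj wm_inj _ => i j.
by rewrite /copy_xy; case: (split i) => k; rewrite neq_wire.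
Qed.

(** The index enters in the first address register and its image under [f] leaves in the second, the
    first being erased; the missing swap is a relabelling of wires. *)
Definition src (i : 'I_(1 + n)) : 'I_N :=
  match split i with inl _ => wc | inr j => wx j end.
Definition dst (i : 'I_(1 + n)) : 'I_N :=
  match split i with inl _ => wc | inr j => wy j end.

Lemma src_inj : injective src.
Proof.
by apply: split_inj _ wx_inj _ => [i j _|i j]; rewrite ?neq_wire // (ord1 i) (ord1 j).
Qed.
Lemma dst_inj : injective dst.
Proof.
by apply: split_inj _ wy_inj _ => [i j _|i j]; rewrite ?neq_wire // (ord1 i) (ord1 j).
Qed.

Lemma split_l k l (i : 'I_k) : split (lshift l i) =
  inl i. Proof. exact: (unsplitK (inl i)). Qed.
Lemma split_r k l (i : 'I_l) : split (rshift k i) =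
  inr i. Proof. exact: (unsplitK (inr i)). Qed.

Lemma place_src v : place src (wzero N) v =
  state (v (lshift n ord0)) (wright v) (wzero n) (wzero (t + t)).
Proof.
apply/esym/eqP; rewrite eq_place; last exact: src_inj.
apply/andP; split.
  apply/eqP/ffunP => i; rewrite [LHS]ffunE /src; case: (split_ordP i) => j ->.
    by rewrite state_c (ord1 j).
  by rewrite state_x [LHS]ffunE.
apply/forallP; apply: wireP => [|j|j|j|i _]; apply/implyP;
  rewrite ?stateE ?[wzero _ _]ffunE //.
  by case/codomP; exists (lshift n ord0); rewrite /src split_l.
by case/codomP; exists (rshift 1 j); rewrite /src split_r.
Qed.

Lemma place_dst v : place dst (wzero N) v =
  state (v (lshift n ord0)) (wzero n) (wright v) (wzero (t + t)).
Proof.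
apply/esym/eqP; rewrite eq_place; last exact: dst_inj.
apply/andP; split.
  apply/eqP/ffunP => i; rewrite [LHS]ffunE /dst; case: (split_ordP i) => j ->.
    by rewrite state_c (ord1 j).
  by rewrite state_y [LHS]ffunE.
apply/forallP; apply: wireP => [|j|j|j|i _]; apply/implyP;
  rewrite ?stateE ?[wzero _ _]ffunE //.
  by case/codomP; exists (lshift n ord0); rewrite /dst split_l.
by case/codomP; exists (rshift 1 j); rewrite /dst split_r.
Qed.

Variables (f : 'I_(2 ^ n) -> 'I_(2 ^ n)) (enc : polar_code n t).
Local Notation cmx := (circuit_mx R f enc).

Definition query_xy : gate n t N := QueryF t copy_xy_inj.
Definition query_yx : gate n t N := QueryF t copy_yx_inj.
Definition query_A : gate n t N := QueryA copy_xym_inj.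

Lemma query_xy_state b x y m : cmx [:: query_xy] *m ket R (state b x y m) =
  ket R (state b x (wxor y (bits (f (idx x)))) m).
Proof.
rewrite circuit_mx1 on_wires_basis; last exact: copy_xy_inj.
congr ket; apply/esym/eqP; rewrite eq_place; last exact: copy_xy_inj.
have -> : [ffun i => state b x y m (copy_xy i)] = wcat x y.
  by apply/ffunP => i; rewrite !ffunE /copy_xy; case: (split i) => j; rewrite enum_rankK.
rewrite wcatKl wcatKr; apply/andP; split.
  by apply/eqP/ffunP => i; rewrite [LHS]ffunE [RHS]ffunE /copy_xy;
    case: (split i) => j; rewrite stateE.
apply/forallP; apply: wireP => [|j|j|j|i _]; apply/implyP; rewrite ?stateE //.
by case/codomP; exists (rshift n j); rewrite /copy_xy split_r.
Qed.

Lemma query_yx_state b x y m : cmx [:: query_yx] *m ket R (state b x y m) =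
  ket R (state b (wxor x (bits (f (idx y)))) y m).
Proof.
rewrite circuit_mx1 on_wires_basis; last exact: copy_yx_inj.
congr ket; apply/esym/eqP; rewrite eq_place; last exact: copy_yx_inj.
have -> : [ffun i => state b x y m (copy_yx i)] = wcat y x.
  by apply/ffunP => i; rewrite !ffunE /copy_yx; case: (split i) => j; rewrite enum_rankK.
rewrite wcatKl wcatKr; apply/andP; split.
  by apply/eqP/ffunP => i; rewrite [LHS]ffunE [RHS]ffunE /copy_yx;
    case: (split i) => j; rewrite stateE.
apply/forallP; apply: wireP => [|j|j|j|i _]; apply/implyP; rewrite ?stateE //.
by case/codomP; exists (rshift n j); rewrite /copy_yx split_r.
Qed.

Definition code (x y : word n) : word (t + t) :=
  wcat (bits (enc (idx x) (idx y)).1) (bits (enc (idx x) (idx y)).2).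

Lemma query_A_state b x y m : cmx [:: query_A] *m ket R (state b x y m) =
  ket R (state b x y (wxor m (code x y))).
Proof.
rewrite circuit_mx1 on_wires_basis; last exact: copy_xym_inj.
congr ket; apply/esym/eqP; rewrite eq_place; last exact: copy_xym_inj.
have -> : [ffun i => state b x y m (copy_xym i)] = wcat (wcat x y) m.
  apply/ffunP => i; rewrite !ffunE /copy_xym; case: (split i) => j; rewrite ?enum_rankK //.
  by rewrite ffunE /copy_xy; case: (split j) => k; rewrite enum_rankK.
rewrite !(wcatKl, wcatKr); apply/andP; split.
  apply/eqP/ffunP => i; rewrite [LHS]ffunE [RHS]ffunE /copy_xym; case: (split i) => j;
    rewrite ?stateE //.
  by rewrite [RHS]ffunE /copy_xy; case: (split j) => k; rewrite stateE.
apply/forallP; apply: wireP => [|j|j|j|i _]; apply/implyP; rewrite ?stateE //.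
by case/codomP; exists (rshift (n + n) j); rewrite /copy_xym split_r.
Qed.

Lemma query_cket g b x y m b' x' y' m' u :
  (forall b, cmx [:: g] *m ket R (state b x y m) = ket R (state b x' y' m')) ->
  cmx [:: g] *m cket wc u (state b x y m) = cket wc u (state b' x' y' m').
Proof. by move=> h; rewrite mulmx_cket /cket !upd_state !h. Qed.

Lemma wxorK k (v : word k) : wxor v v = wzero k.
Proof. by apply/ffunP => i; rewrite !ffunE addbb. Qed.
Lemma wxor0 k (v : word k) : wxor (wzero k) v = v.
Proof. by apply/ffunP => i; rewrite !ffunE. Qed.

Variable P : seq (instr t).
Hypothesis PS : (size P <= S.+1)%N.
Variable rots : seq ('I_N * seq letter).
Variable rot_quat : word N -> quat R.
Hypothesis rots_cket : forall u w,
  cmx (rotations n t wc rots) *m cket wc u w = cket wc (qact (rot_quat w) u) w.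

Definition input_wire (j : 'I_t) : 'I_N := wm (lshift t j).

Definition block_circuit : circuit n t N :=
  [:: query_xy] ++ [:: query_A] ++ program_circuit n t input_wire ws 0 P ++
  rotations n t wc rots ++ program_uncompute n t input_wire ws 0 P ++
  [:: query_A] ++ [:: query_yx].

Definition computed_state (x : word n) : word N :=
  program_action input_wire ws 0 P (state false x (bits (f (idx x))) (code x (bits (f
    (idx x))))).

Lemma input_ws j i : (i < S.+1)%N -> input_wire j != ws i.
Proof. by rewrite neq_wire. Qed.

Lemma block_circuit_cket u x : involutive f ->
  cmx block_circuit *m cket wc u (state false x (wzero n) (wzero (t + t))) =
  cket wc (qact (rot_quat (computed_state x)) u)
       (state false (wzero n) (bits (f (idx x))) (wzero (t + t))).
Proof.
move=> fK; rewrite /block_circuit.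
set y := bits (f (idx x)).
have cin j : wc != input_wire j by rewrite neq_wire.
have cws i : (i < S.+1)%N -> wc != ws i by rewrite neq_wire.
have PS' : (0 + size P <= S.+1)%N by [].
have wsi := ws_inj.
rewrite circuit_mx_cat -mulmxA (query_cket _ false u (fun b => query_xy_state b _ _ _))
  wxor0 -/y.
rewrite circuit_mx_cat -mulmxA (query_cket _ false u (fun b => query_A_state b _ _ _))
  wxor0.
rewrite circuit_mx_cat -mulmxA (realizes_cket u _ (program_realizes R f enc wsi
  input_ws PS')); last first.
  by move=> w b; apply: (program_action_upd (S := S.+1)).
(* The rotations change only the amplitudes on [wc], so uncomputation meets the very word that the
   program produced. *)
rewrite circuit_mx_cat -mulmxA rots_cket.
rewrite circuit_mx_cat -mulmxA (realizes_cket _ _ (uncompute_realizes R f enc wsi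
  input_ws PS')); last first.
  by move=> w b; apply: (program_inverse_upd (S := S.+1)).
rewrite (program_actionK wsi input_ws PS').
rewrite circuit_mx_cat -mulmxA (query_cket _ false _ (fun b => query_A_state b _ _ _))
  wxorK.
rewrite (query_cket _ false _ (fun b => query_yx_state b _ _ _)).
by rewrite /y bitsK fK idxK wxorK.
Qed.

Lemma computed_memory x i : (i < size P)%N ->
  computed_state x (ws i) = nth false (run P (fun j => code x (bits (f (idx x)))
    (lshift t j))) i.
Proof.
move=> iP; rewrite /computed_state; set w := state _ _ _ _.
have PS' : (0 + size P <= S.+1)%N by [].
have [||h _] := @program_actionE _ t S.+1 input_wire ws ws_inj input_ws 0 [::] P w PS'
  erefl.
  by [].
  by move=> k kS _; rewrite state_s.
have -> : (fun j => code x (bits (f (idx x))) (lshift t j)) = (fun j => w (input_wire j)).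
  by apply/funext => j; rewrite state_m.
rewrite -[P in run P _]/([::] ++ P) -h nth_memory add0n iP.
by [].
Qed.

Lemma computed_code x j : computed_state x (wm j) = code x (bits (f (idx x))) j.
Proof.
rewrite /computed_state; set w := state _ _ _ _.
have PS' : (0 + size P <= S.+1)%N by [].
have [||_ h] := @program_actionE _ t S.+1 input_wire ws ws_inj input_ws 0 [::] P w PS'
  erefl.
  by [].
  by move=> k kS _; rewrite state_s.
by rewrite h ?state_m // => i _; rewrite neq_wire.
Qed.

Lemma block_circuit_implements : involutive f ->
  implements (cmx block_circuit) src dst (sel_mx f (fun x => rot_quat (computed_state x))).
Proof.
move=> fK; apply: eq_on_kets => v; rewrite -[LHS]mulmxA -[RHS]mulmxA embed_ket;
  last exact: src_inj.
rewrite place_src ket_state.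
rewrite block_circuit_cket // sel_mx_ket /sel_col mulmx_cket !embed_ket; try exact: dst_inj.
rewrite !place_dst /cket !upd_same !upd_state.
have e b : wright (upd (sel_word f v) (lshift n ord0) b) = bits (f (idx (wright v))).
  by apply/ffunP => i; rewrite [LHS]ffunE upd_other // wcatr.
by rewrite !e.
Qed.

Lemma block_circuit_queries : query_count block_circuit = 4.
Proof.
have nq (c : circuit n t N) : noquery c -> query_count c = 0%N.
  by rewrite /noquery /query_count all_predC has_count -leqNgt leqn0 => /eqP.
have [h1 h2] := noquery_program n t input_wire ws 0 P.
have h3 := noquery_rotations n t wc rots.
rewrite /block_circuit /query_count !count_cat -![count _ _]/(query_count _).
by rewrite (nq _ h1) (nq _ h2) (nq _ h3).
Qed.

Lemma block_circuit_aux k :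
  (forall x, x \in [seq size y.2 | y <- rots] -> (x <= k)%N) ->
  (aux_count block_circuit <= 200 * size P + size rots * (14 * k + 2))%N.
Proof.
move=> hk; have [h1 h2] := size_program n t input_wire ws 0 P.
have h3 := @size_rotations n t N wc rots k hk.
rewrite /block_circuit /aux_count; set pr := predC _.
rewrite !count_cat (_ : count pr [:: query_xy] = 0%N) //.
rewrite (_ : count pr [:: query_A] = 0%N) // (_ : count pr [:: query_yx] = 0%N) //.
have c (s : circuit n t N) : (count pr s <= size s)%N by exact: count_size.
have := c (program_circuit n t input_wire ws 0 P).
have := c (program_uncompute n t input_wire ws 0 P).
have := c (rotations n t wc rots).
lia.
Qed.

End Layout.

(** * Choice of the rotation words *)

Section ConcreteCircuit.
Variables (R : realType) (n t k l e L : nat).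
Hypothesis k0 : (0 < k)%N.
Hypothesis kt : (k < 2 ^ t)%N.
Hypothesis l0 : (0 < l)%N.
Hypothesis netL : @net R L (2^-1 ^+ e).
Local Notation C := R[i].

Definition word_value (x : 'I_t -> bool) : nat := idx [ffun j => x j].

Lemma word_value_lt x : (word_value x < 2 ^ t)%N.
Proof. exact: ltn_ord. Qed.

Lemma word_value_bits i : exists o : option 'I_t, forall x,
  bit i (word_value x) = if o is Some j then x j else false.
Proof.
have [it|ti] := ltnP i t; last first.
  by exists None => x; apply: bit_ge ti; apply: word_value_lt.
have jt : (t - i.+1 < t)%N by lia.
exists (Some (Ordinal jt)) => x.
have := congr1 (fun w : word t => w (Ordinal jt)) (idxK [ffun j => x j]).
rewrite /= [RHS]ffunE ffunE /= => <-.
by rewrite /bit /word_value; congr (odd (_ %/ 2 ^ _)); lia.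
Qed.

Lemma bits_value (y : 'I_(2 ^ t)) : word_value (bits y) = y.
Proof.
rewrite /word_value; have -> : [ffun j => bits y j] = bits y by apply/ffunP => j;
  rewrite ffunE.
by rewrite bitsK.
Qed.

Lemma approx_word (u : quat R) : qnorm u = 1 -> exists Vq : seq letter * quat R,
  [/\ (size Vq.1 <= L)%N, represents_quat Vq.1 Vq.2 & qnorm (Vq.2 - u) <= 2^-1 ^+ e].
Proof.
move=> u1; have [q [V hV Vq] hq] := netL u1.
by exists (V, q); split=> //; rewrite qdistC.
Qed.

(** Negative because inverting an entry negates its phase; half of [2 pi] times the weight of bit
    [i], because the controlled rotation doubles the angle. *)
Definition phase_half_angle (i : 'I_t) : R := - (pi * (2 ^ (t - i.+1))%:R / 2 ^+ t).

Lemma phase_sum (y : 'I_(2 ^ t)) :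
  \sum_(i <- Finite.enum 'I_t) (if bits y i then phase_half_angle i *+ 2 else 0) =
  - (2 * pi * (y%:R / 2 ^+ t)).
Proof.
have {1}-> : y%:R = (idx (bits y))%:R :> R by rewrite bitsK.
rewrite -enumT big_enum /= natr_sum mulr_suml mulr_sumr -sumrN; apply: eq_bigr => i _.
rewrite /phase_half_angle natrM; case: (bits y i); rewrite ?mul0r ?mulr0 ?oppr0 //.
by rewrite mul1r -mulr_natr; ring.
Qed.

(** The circuit is chosen before [f] and [enc]; only the description [Q] of its effect depends on
    them. *)
Lemma block_circuit_exists : exists N (c : circuit n t N) (src dst : 'I_(1 + n) -> 'I_N),
  [/\ injective src /\ injective dst, query_count c = 4%N,
      (aux_count c <= 200 * (t + 2 + l * (100 * (t + (l + 3) ^ 2))) + (l + t) * (14 * L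
        + 2))%N &
      forall (f : 'I_(2 ^ n) -> 'I_(2 ^ n)) (enc : polar_code n t), involutive f ->
      exists Q : word n -> quat R, (forall v, qnorm (Q v) = 1) /\
        implements (circuit_mx R f enc c) src dst (sel_mx f Q) /\
        forall x, (k <= (enc x (f x)).1)%N ->
          Normc.normc (top_left (Q (bits x)) -
            polar (k%:R / (enc x (f x)).1%:R) (- (2 * pi * ((enc x (f x)).2%:R / 2 ^+ t))))
          <= (l + t)%:R * (2 * 2^-1 ^+ e) + 4 * 2^-1 ^+ l].
Proof.
have [P [sP hP]] := cordic_program word_value_lt kt word_value_bits l.
(* The program yields the position of each angle bit only existentially; the positions are collected
   into a function in order to wire the rotations. *)
have [pos hpos] : {pos : nat -> nat & forall j, (j < l)%N -> (pos j < size P)%N /\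
    forall x, nth false (run P x) (pos j) = cordic_bit k (word_value x) j}.
  apply: (@choice _ _ (fun j i => (j < l)%N -> (i < size P)%N /\
    forall x, nth false (run P x) i = cordic_bit k (word_value x) j)) => j.
  have [/hP[i iP h]|_] := ltnP j l; last by exists 0%N.
  by exists i.
have [Vy hy] := choice (fun j => approx_word (qroty_norm (half_angle R j.+1))).
have [Vz hz] := choice (fun i => approx_word (qrotz_norm (phase_half_angle i))).
pose S := size P.
have PS : (size P <= S.+1)%N by rewrite leqnSn.
pose gy j := ws n t S (pos j); pose gz (i : 'I_t) := @wm n t S (rshift t i).
pose rots := [seq (gy j, (Vy j).1) | j <- iota 0 l] ++ [seq (gz i,
  (Vz i).1) | i <- Finite.enum 'I_t].
(* The circuit applies the modulus rotations first, so they stand on the right. *)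
pose rq (w : word #|wire_type n t S|) :=
  rotation_product (fun i => w (gz i)) (fun i => (Vz i).2) (Finite.enum 'I_t) *
  rotation_product (fun j => w (gy j)) (fun j => (Vy j).2) (iota 0 l).
have rq1 w : qnorm (rq w) = 1.
  by rewrite qnormM !rotation_product_norm ?mulr1 // => i;
    [case: (hy i) => _ [] | case: (hz i) => _ []].
exists #|wire_type n t S|, (block_circuit P rots), (@src n t S), (@dst n t S).
split.
- by split; [exact: src_inj | exact: dst_inj].
- exact: block_circuit_queries.
- have hL : forall x, x \in [seq size y.2 | y <- rots] -> (x <= L)%N.
    move=> x; rewrite map_cat mem_cat -!map_comp => /orP[] /mapP[i _ ->] /=.
      by case: (hy i).
    by case: (hz i).
  apply: leq_trans (block_circuit_aux PS hL) _.
  apply: leq_add; first by rewrite leq_mul2l sP orbT.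
  by rewrite size_cat !size_map size_iota -enumT size_enum_ord.
move=> f enc fK.
pose Q x := rq (computed_state S f enc P x).
exists Q; split; first by move=> v; apply: rq1.
split.
  apply: block_circuit_implements => // u w.
  rewrite rotations_cat circuit_mx_cat -mulmxA.
  rewrite (rotations_cket f enc (c := wc n t S) (g := gy) (q := fun j => (Vy j).2));
    last 2 first.
  - by move=> j; rewrite neq_wire.
  - by move=> j; case: (hy j).
  rewrite (rotations_cket f enc (c := wc n t S) (g := gz) (q := fun j => (Vz j).2));
    last 2 first.
  - by move=> j; rewrite neq_wire.
  - by move=> j; case: (hz j).
  by rewrite qactM.
move=> x; set r : nat := (enc x (f x)).1; set th := (enc x (f x)).2 => kr.
set w := computed_state S f enc P (bits x).
have wz i : w (gz i) = bits th i by rewrite /w /gz computed_code // /code !bitsK wcatr.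
have wy j : (j < l)%N -> w (gy j) = cordic_bit k r j.
  move=> jl; have [pP h] := hpos _ jl.
  have -> : w (gy j) = nth false (run P (fun i => code enc (bits x) (bits (f (idx (bits
    x)))) (lshift t i))) (pos j).
    exact: computed_memory.
  rewrite h /code !bitsK; congr cordic_bit.
  rewrite -[RHS]bits_value; congr (nat_of_ord (idx _)).
  by apply/ffunP => i; rewrite [LHS]ffunE [RHS]ffunE wcatl.
have h1 i : represents_quat (Vy i).1 (Vy i).2 by case: (hy i).
have e0 : 0 <= 2^-1 ^+ e :> R by rewrite exprn_ge0 // invr_ge0 ler0n.
pose u := qrotz (- (2 * pi * (th%:R / 2 ^+ t))) * qroty (cordic_angle R k r l).
have du : qnorm (rq w - u) <= (l + t)%:R * (2 * 2^-1 ^+ e).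
  apply: le_trans (qdistM _ _ _ _) _; rewrite ?qroty_norm //.
    by apply: rotation_product_norm => i; case: (hz i) => _ [].
  rewrite [leRHS](_ : _ = t%:R * (2 * 2^-1 ^+ e) + l%:R * (2 * 2^-1 ^+ e)); last first.
    by rewrite natrD; ring.
  apply: lerD; last first.
    have <- : rotation_product (fun j => w (gy j)) (fun j => qroty (half_angle R j.+1))
      (iota 0 l) =
        qroty (cordic_angle R k r l).
      rewrite rotation_product_roty; congr qroty.
      rewrite /cordic_angle -(big_mkord xpredT (fun j => if cordic_bit k r j then
        half_angle R j.+1 *+ 2 else 0)).
      rewrite /index_iota subn0; apply: eq_big_seq => j; rewrite mem_iota => /andP[_ jl].
      by rewrite wy.
    have := @rotation_product_dist R nat (fun j => w (gy j)) (fun j => (Vy j).2)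
      (fun j => qroty (half_angle R j.+1)) (iota 0 l) (2^-1 ^+ e) e0.
    rewrite size_iota; apply => i; first by case: (hy i) => _ [].
      exact: qroty_norm.
    by case: (hy i).
  have <- : rotation_product (fun i => w (gz i)) (fun i => qrotz (phase_half_angle i))
    (Finite.enum 'I_t) =
      qrotz (- (2 * pi * (th%:R / 2 ^+ t))).
    rewrite rotation_product_rotz -phase_sum; congr qrotz.
    by apply: eq_bigr => i _; rewrite wz.
  have := @rotation_product_dist R 'I_t (fun j => w (gz j)) (fun j => (Vz j).2)
    (fun j => qrotz (phase_half_angle j)) (Finite.enum 'I_t) (2^-1 ^+ e) e0.
  rewrite -enumT size_enum_ord; apply => i; first by case: (hz i) => _ [].
    exact: qrotz_norm.
  by case: (hz i).
have e1 : top_left (Q (bits x)) - polar (k%:R / r%:R) (- (2 * pi * (th%:R / 2 ^+ t))) =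
    (top_left (rq w) - top_left u) +
    polar (cos (cordic_angle R k r l) - k%:R / r%:R) (- (2 * pi * (th%:R / 2 ^+ t))).
  by rewrite /u top_left_rot -polarB addrA subrK.
rewrite e1; apply: le_trans (le_normcD _ _) _; apply: lerD.
  exact: le_trans (top_left_dist _ _) du.
by rewrite normc_polar; apply: cordic_approx.
Qed.

End ConcreteCircuit.

(** The minimum is attained, so it is the modulus of an entry; its code [k] is the integer compiled
    into the circuit. *)
Lemma min_entryP (R : realType) n t p (enc : polar_code n t) (A : 'M[R[i]]_(2 ^ n))
    (f : 'I_(2 ^ n) -> 'I_(2 ^ n)) :
  represents p enc A -> (forall x, A x (f x) != 0) ->
  exists k, [/\ (0 < k)%N, (k < 2 ^ t)%N, min_entry A f = k%:R / 2 ^+ p &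
    forall x, (k <= (enc x (f x)).1)%N].
Proof.
move=> hA hf; have p0 : 0 < 2 ^+ p :> R by rewrite exprn_gt0.
have mE x : Normc.normc (A x (f x)) = (enc x (f x)).1%:R / 2 ^+ p.
  by rewrite hA normc_polar ger0_norm // divr_ge0 ?ler0n // ltW.
have [x0 hx0] : exists x, min_entry A f = Normc.normc (A x (f x)).
  rewrite /min_entry; apply: (big_ind (fun v => exists x, v = Normc.normc (A x (f x)))).
  - by exists (idx (wzero n)).
  - by move=> u v [x ->] [y ->]; case: (leP _ _); [exists x | exists y].
  - by move=> x _; exists x.
exists (enc x0 (f x0)).1; split.
- rewrite lt0n; apply/eqP => z; have := hf x0; rewrite hA z mul0r /polar !mul0r.
  by rewrite eqxx.
- exact: ltn_ord.
- by rewrite hx0 mE.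
move=> x; have : min_entry A f <= Normc.normc (A x (f x)) by apply: bigmin_le.
by rewrite hx0 !mE ler_pM2r ?invr_gt0 // ler_nat.
Qed.

(** The degree 7 is 6 for the word length plus 1 for the number [l + t] of rotations; the arithmetic
    contributes only degree 3. The constants are generous. *)
Lemma size_bound K t l : (0 < t)%N -> (t < l)%N ->
  (200 * (t + 2 + l * (100 * (t + (l + 3) ^ 2))) + (l + t) * (14 * (K * (2 * l).+1 ^ 6)
    + 2) <=
   (400 * 1000 + 30 * 1000 * K) * l ^ 7)%N.
Proof.
move=> t0 tl; have l0 : (0 < l)%N by lia.
have l4 : (l + 3 <= 4 * l)%N by lia.
have l3 : ((2 * l).+1 <= 3 * l)%N by lia.
have lt2 : (l + t <= 2 * l)%N by lia.
have b1 : ((l + 3) ^ 2 <= 16 * l ^ 2)%N by rewrite (_ : 16 = 4 ^ 2)%N // -expnMn leq_exp2r.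
have p1 k : (l <= l ^ k.+1)%N by rewrite -{1}(expn1 l) leq_pexp2l.
have p37 : (l ^ 3 <= l ^ 7)%N by rewrite leq_pexp2l.
have b4 : (l * (100 * (t + (l + 3) ^ 2)) <= 1700 * l ^ 3)%N.
  rewrite (expnS l 2) (mulnCA 1700) leq_mul2l; apply/orP; right.
  have := p1 1%N; move: (l ^ 2)%N ((l + 3) ^ 2)%N b1 {p1 p37} => y z; lia.
have a1 : (200 * (t + 2 + l * (100 * (t + (l + 3) ^ 2))) <= 399 * 1000 * l ^ 3)%N.
  apply: (@leq_trans (200 * (t + 2 + 1700 * l ^ 3))).
    by rewrite leq_mul2l leq_add2l b4 orbT.
  have := p1 2%N; move: (l ^ 3)%N {p1 p37 b1 b4} => z; lia.
have h6 : ((2 * l).+1 ^ 6 <= 729 * l ^ 6)%N.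
  by rewrite (_ : 729 = 3 ^ 6)%N // -expnMn leq_exp2r.
have a2 : ((l + t) * (14 * (K * (2 * l).+1 ^ 6) + 2) <= 2 * l * (14 * K * (729 * l ^ 6)
  + 2))%N.
  apply: leq_mul => //.
  by rewrite leq_add2r -mulnA !leq_mul2l h6 !orbT.
apply: leq_trans (leq_add a1 a2) _.
have := p1 6%N; rewrite (expnS l 6) in p37 *; move: (l ^ 6)%N (l ^ 3)%N p37 => y z.
by move=> {p1 b1 b4 a1 h6 a2 l4 l3 lt2 t0 tl}; nia.
Qed.

(** * Precision and error estimates *)

Section FinalBounds.
Variable R : realType.
Local Notation C := R[i].

Lemma polar_scale (a r x : R) : (a%:C)%C * polar r x = polar (a * r) x.
Proof. by rewrite /polar; apply/eqP; rewrite eq_complex /=; apply/andP; split;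
  apply/eqP; ring. Qed.

(** The difference of [invmx A] and the scaled block has one entry per column, [mu^-1] times the
    error of the rotated qubit. Since [mu >= 2^-p >= 2^-t], precision [2^-t * delta] suffices. *)
Lemma block_encoding_sel n t p k m (A : 'M[C]_(2 ^ n)) f (enc : polar_code n t) (Q :
  word n -> quat R)
    (delta : R) :
  one_sparse A -> A \in unitmx -> injective f -> represents p enc A ->
  (forall x, A x (f x) != 0) -> (0 < k)%N -> (p <= t)%N -> 0 <= delta ->
  2^-1 ^+ m <= 2^-1 ^+ t * delta ->
  (forall v, qnorm (Q v) = 1) ->
  (forall x, Normc.normc (top_left (Q (bits x)) -
     polar (k%:R / (enc x (f x)).1%:R) (- (2 * pi * ((enc x (f x)).2%:R / 2 ^+ t)))) <=
       2^-1 ^+ m) ->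
  block_encoding (k%:R / 2 ^+ p)^-1 1 delta (sel_mx f Q) (invmx A).
Proof.
move=> As Au fi hA hf k0 pt d0 hm Q1 hQ; split; first exact: sel_mx_unitary.
have p0 : 0 < 2 ^+ p :> R by rewrite exprn_gt0.
have kR : 0 < k%:R :> R by rewrite ltr0n.
set mu : R := k%:R / 2 ^+ p.
have mu0 : 0 < mu by rewrite divr_gt0.
have muE : 2^-1 ^+ t <= mu.
  apply: (@le_trans _ _ (2^-1 ^+ p)).
    by rewrite ler_wiXn2l // ?invr_ge0 ?ler0n // invf_le1 ?ltr0n // ler1n.
  by rewrite exprVn /mu ler_peMl ?invr_ge0 ?(ltW p0) // ler1n.
rewrite /= sel_mx_block (invmx_sparse As Au hf).
rewrite (_ : _ - _ = \matrix_(y, x) ((y == f x)%:R *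
    ((A x (f x))^-1 - ((mu^-1)%:C)%C * top_left (Q (bits x))))); last first.
  by apply/matrixP => y x; rewrite !mxE mulrBr [in RHS]mulrCA.
apply: opnorm_sparse => // x.
have := hf x; rewrite hA => Ax.
have r0 : ((enc x (f x)).1%:R : R) != 0.
  by apply: contraNneq Ax => ->; rewrite mul0r /polar !mul0r.
set r : R := (enc x (f x)).1%:R in r0 Ax *; set th : R := 2 * pi * _ in Ax *.
have -> : (polar (r / 2 ^+ p) th)^-1 = ((mu^-1)%:C)%C * polar (k%:R / r) (- th).
  rewrite polarV; last by rewrite mulf_neq0 // invr_neq0 // gt_eqF.
  rewrite polar_scale; congr polar; rewrite /mu; field.
  by rewrite r0 !gt_eqF.
rewrite -mulrBr Normc.normcM.
have -> : Normc.normc ((mu^-1)%:C)%C = mu^-1.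
  by rewrite /= expr0n addr0 sqrtr_sqr ger0_norm // invr_ge0 ltW.
rewrite ler_pdivrMl //; apply: le_trans (_ : 2^-1 ^+ m <= _).
  have := hQ x; rewrite -/r -/th; apply: le_trans.
  by rewrite -normcN opprB.
by apply: le_trans hm _; rewrite ler_wpM2r.
Qed.

(** From [1/2 <= expR (- 1/2)]; this avoids estimating the logarithm of 2. *)
Lemma half_pow_le (q : nat) (x : R) : 2 * x <= q%:R -> 2^-1 ^+ q <= expR (- x).
Proof.
move=> h; apply: (@le_trans _ _ (expR (- 2^-1) ^+ q)).
  apply: lerXn2r; rewrite ?nnegrE ?invr_ge0 ?ler0n ?expR_ge0 //.
  by have := expR_ge1Dx (- 2^-1 : R); lra.
by rewrite -expRM_natr ler_expR; lra.
Qed.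

Lemma precision_exists (delta : R) : 0 < delta ->
  exists q : nat, 2^-1 ^+ q <= delta /\ q%:R <= 3 * Num.max 1 (ln (1 / delta)).
Proof.
move=> d0; set m := Num.max _ _.
have m1 : 1 <= m by rewrite le_max lexx.
have m2 : ln (1 / delta) <= m by rewrite le_max lexx orbT.
(* As [m >= 1], rounding [2 m] up stays within [3 m]. *)
exists (Num.truncn (2 * m)).+1; split.
  apply: (@le_trans _ _ (expR (- m))).
    by apply: half_pow_le; apply/ltW/truncnS_gt.
  rewrite -[leRHS]lnK ?posrE // ler_expR.
  by rewrite div1r lnV ?posrE // in m2; lra.
have : (Num.truncn (2 * m))%:R <= 2 * m by rewrite truncn_le; lra.
by rewrite -natr1; lra.
Qed.

(** Taking words to precision [2^-(2l)] absorbs the number of rotations: [l * 2^-l <= 1], so the sum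
    is at most [8 * 2^-l]. *)
Lemma error_bound l m : (m.+4 <= l)%N ->
  (l + l)%:R * (2 * 2^-1 ^+ (2 * l)) + 4 * 2^-1 ^+ l <= 2^-1 ^+ m :> R.
Proof.
move=> ml.
have h2 : 0 <= (2^-1 : R) <= 1 by lra.
have /andP[h0 h1] := h2.
have l2 : l%:R * 2^-1 ^+ l <= 1 :> R.
  by rewrite exprVn ler_pdivrMr ?exprn_gt0 // mul1r -natrX ler_nat ltnW // ltn_expl.
have hl : 2^-1 ^+ l <= 2^-1 ^+ m.+4 :> R by rewrite ler_wiXn2l.
have p : 0 <= 2^-1 ^+ l :> R by rewrite exprn_ge0.
have : l%:R * 2^-1 ^+ l * 2^-1 ^+ l <= 2^-1 ^+ l :> R by rewrite ler_piMl.
rewrite mul2n -addnn exprD natrD.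
rewrite !exprS in hl.
have p' : 0 <= 2^-1 ^+ m :> R by rewrite exprn_ge0.
move: (2^-1 ^+ m) (2^-1 ^+ l) p p' hl => y z; lra.
Qed.

End FinalBounds.

Theorem lemma34 (R : realType) :
  exists P : {poly R},
  forall (n n' p : nat) (mu delta : R), (p <= n')%N -> 0 < delta ->
  exists (N : nat) (c : circuit n n' N) (src dst : 'I_(1 + n) -> 'I_N),
  [/\ injective src /\ injective dst,
      (query_count c <= 4)%N,
      (aux_count c)%:R <= P.[n'%:R * Num.max 1 (ln (1 / delta))]
    & forall (A : 'M[R[i]]_(2 ^ n)) (f : 'I_(2 ^ n) -> 'I_(2 ^ n))
             (enc : polar_code n n'),
      one_sparse A -> A \is hermsymmx -> A \in unitmx ->
      represents p enc A ->
      (forall x, A x (f x) != 0) ->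
      min_entry A f = mu ->
      exists U : 'M[R[i]]_(2 ^ (1 + n)),
        implements (circuit_mx R f enc c) src dst U /\
        block_encoding mu^-1 1 delta U (invmx A)].
Proof.
have [K HK] := solovay_kitaev R.
pose K1 : nat := (400 * 1000 + 30 * 1000 * K)%N.
(* The 8 comes from [l = t + q + 4], where [t], [q] and 4 are at most 1, 3 and 4 times [t * m]. *)
exists ((K1%:R * 8 ^+ 7)%:P * 'X^7) => n t p mu delta pt d0.
set m := Num.max 1 _; have m1 : 1 <= m by rewrite le_max lexx.
have PE : ((K1%:R * 8 ^+ 7)%:P * 'X^7).[t%:R * m] = K1%:R * (8 * (t%:R * m)) ^+ 7.
  by rewrite hornerM hornerC hornerXn -mulrA -exprMn.
(* If [mu] is not of this form, it is the minimal entry of no admissible [A]; the empty circuit then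
   satisfies the claim vacuously. *)
have [[k [k0 kt muE]]|nok] := pselect (exists k, [/\ (0 < k)%N, (k < 2 ^ t)%N & mu = k%:R / 2 ^+ p]);
    last first.
  exists (1 + n)%N, [::], id, id; split=> //.
  - by split=> x y.
  - by rewrite PE mulr_ge0 ?ler0n // exprn_ge0 // !mulr_ge0 ?ler0n // (le_trans ler01).
  move=> A f enc _ _ _ hA hf hmu; case: nok.
  by have [k [k0 kt kE _]] := min_entryP hA hf; exists k; rewrite -hmu.
have t0 : (0 < t)%N by case: (t) kt => //; rewrite expn0; case: (k) k0.
have [q [qd]] := precision_exists d0; rewrite -/m => qm.
(* [t] bits compensate the factor [mu^-1], [q] bits account for [delta], and 4 absorb the constants
   of [error_bound]. *)
pose l := (t + q).+4.
have l0 : (0 < l)%N by [].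
have [N [c [src [dst [inj qc ac H]]]]] := @block_circuit_exists R n t k l (2 * l) _ k0 kt l0 (HK (2 * l)%N).
exists N, c, src, dst; split=> //; first by rewrite qc.
  rewrite PE.
  apply: (@le_trans _ _ (K1%:R * l%:R ^+ 7)).
    rewrite -natrX -natrM ler_nat; apply: leq_trans ac _.
    by apply: size_bound => //; rewrite /l; lia.
  rewrite ler_wpM2l ?ler0n //; apply: lerXn2r; rewrite ?nnegrE ?ler0n //.
    by rewrite !mulr_ge0 ?ler0n // (le_trans ler01).
  have tR : 1 <= t%:R :> R by rewrite ler1n.
  have tm : t%:R <= t%:R * m by rewrite ler_peMr ?ler0n.
  have tm' : m <= t%:R * m by rewrite ler_peMl // (le_trans ler01).
  have -> : l%:R = t%:R + q%:R + 4 :> R by rewrite /l -!natr1 natrD; ring.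
  lra.
move=> A f enc As Ah Au hA hf hmu.
have fK := one_sparse_hermitian_involutive As Ah hf.
have [Q [Q1 [hU hQ]]] := H f enc fK.
exists (sel_mx f Q); split=> //; rewrite muE.
have [k' [_ _ k'E kle]] := min_entryP hA hf.
have kk : k' = k.
  have p0 : 0 < 2 ^+ p :> R by rewrite exprn_gt0.
  apply/eqP; rewrite -(eqr_nat R); apply/eqP; apply: (mulIf (x := (2 ^+ p)^-1)).
    by rewrite invr_neq0 // gt_eqF.
  by rewrite -k'E hmu muE.
apply: (@block_encoding_sel R n t p k (t + q)) => //; first exact: inv_inj fK.
- exact: ltW.
- by rewrite exprD ler_wpM2l // exprn_ge0 // invr_ge0 ler0n.
move=> x; apply: le_trans (hQ x _) _; first by rewrite -kk.
apply: le_trans (@error_bound R l (t + q) (leqnn _)).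
rewrite lerD2r ler_wpM2r //; first by rewrite mulr_ge0 // exprn_ge0 // invr_ge0 ler0n.
by rewrite ler_nat leq_add2l /l; lia.
Qed.
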